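(* Let $d\ge 3$ and $n\ge 2$ be integers, let $V$ be a complex vector space of dimension $n+1$, and let $X=v_d(\mathbb{P}V)\subset\mathbb{P}S^dV=\mathbb{P}^N$, $N=\binom{n+d}{d}-1$, be the $n$-dimensional Veronese variety. If it is not the case that both $d=4$ and $n\ge 3$, then $$\mathrm{Sing}(\sigma_3(X))=\sigma_2(X)$$ as sets. In the exceptional case $d=4$, for each $n\ge 3$, $$\mathrm{Sing}(\sigma_3(v_4(\mathbb{P}V)))=\mathcal{D}_4\cup\sigma_2(v_4(\mathbb{P}V))$$ as sets, where $\mathcal{D}_4$ denotes the locus of all degenerate forms $f$ (i.e. those with $\dim\langle f\rangle=2$) in $\sigma_3(v_4(\mathbb{P}V))\setminus\sigma_2(v_4(\mathbb{P}V))$.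
   Context: The ground field is $\mathbb{C}$. $S^dV$ is the space of homogeneous polynomials of degree $d$ in $n+1=\dim V$ variables (a basis $x_0,\dots,x_n$ of $V$), and a nonzero form $f\in S^dV$ is identified with the point $[f]\in\mathbb{P}S^dV$. The Veronese variety $v_d(\mathbb{P}V)\subset\mathbb{P}S^dV$ is the set of points $[\ell^d]$ with $0\ne\ell\in V$. For a projective variety $X\subset\mathbb{P}W$, the $k$-th secant variety is $$\sigma_k(X)=\overline{\bigcup_{x_1,\dots,x_k\in X}\mathbb{P}\langle x_1,\dots,x_k\rangle}\subset\mathbb{P}W,$$ where $\langle x_1,\dots,x_k\rangle\subset W$ is the linear span of the points and the overline is Zariski closure. $\mathrm{Sing}(Z)$ denotes the set of singular points of the (reduced) variety $Z$. For a form $f\in S^dV$, the space of essential variables is $\langle f\rangle:=\{\partial\in V^\vee\mid\partial(f)=0\}^\perp\subset V$, where $V^\vee$ (the dual space) acts on forms by differentiation (the dual basis vector $y_i$ acts as $\partial/\partial x_i$). Thus $\dim\langle f\rangle$ is the minimal number of variables needed to express $f$, after a linear change of coordinates. A form $f\in\sigma_3(X)\setminus\sigma_2(X)$ is called degenerate if $\dim\langle f\rangle=2$. *)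

(* Defs.v *)
From HB Require Import structures.
From mathcomp Require Import all_boot all_order all_algebra.
From mathcomp Require Import complex mpoly.
From mathcomp Require Import classical_sets reals.

Set Implicit Arguments.
Unset Strict Implicit.
Unset Printing Implicit Defensive.

Import GRing.Theory.
Local Open Scope ring_scope.
Local Open Scope classical_set_scope.

(* A point of the projective space PW is given by a nonzero vector of W, up to
   scaling; a subset of PW is accordingly a set of nonzero vectors of W that is
   stable under multiplication by nonzero scalars. *)

Section Projective.
Variables (F : fieldType) (W : vectType F).

(* Polynomial functions on W, in the coordinates of a fixed basis of W. *)
Definition polyfun := {mpoly F[\dim {: W}]}.

Definition wcoord (w : W) : 'I_(\dim {: W}) -> F :=
  fun i => coord (vbasis {: W}) i w.

Definition peval (P : polyfun) (w : W) : F := P.@[wcoord w].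

(* The differential of P at w, in the direction u. *)
Definition pdiff (P : polyfun) (w u : W) : F :=
  \sum_i (P^`M(i)).@[wcoord w] * wcoord u i.

Definition homogeneous (P : polyfun) : Prop := exists k, P \is k.-homog.

Definition zeros (I : set polyfun) : set W :=
  [set w | w != 0 /\ forall P, I P -> peval P w = 0].

(* The homogeneous elements of the ideal of A. *)
Definition hideal (A : set W) : set polyfun :=
  [set P | homogeneous P /\ forall w, A w -> peval P w = 0].

Definition zclosed (A : set W) : Prop :=
  exists I : set polyfun, (forall P, I P -> homogeneous P) /\ A = zeros I.

Definition zclosure (A : set W) : set W := zeros (hideal A).

Definition zirreducible (A : set W) : Prop :=
  [/\ zclosed A, A !=set0 &
      forall B C, zclosed B -> zclosed C ->
        A `<=` B `|` C -> A `<=` B \/ A `<=` C].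

(* The set A of vectors is a linear subspace of dimension r. *)
Definition subspace_dim (A : set W) (r : nat) : Prop :=
  exists U : {vspace W}, (forall w, w \in U <-> A w) /\ \dim U = r.

(* A chain Y 0, ..., Y r of irreducible closed subsets of Z through w; these
   correspond to the chains of primes of the local ring of Z at w. *)
Definition irr_chain (Z : set W) (w : W) (r : nat) (Y : nat -> set W) : Prop :=
  (forall i, (i <= r)%N -> [/\ zirreducible (Y i), Y i w & Y i `<=` Z]) /\
  (forall i, (i < r)%N -> Y i `<` Y i.+1).

(* The Krull dimension of the local ring of Z at w is r. *)
Definition local_dim (Z : set W) (w : W) (r : nat) : Prop :=
  (exists Y, irr_chain Z w r Y) /\
  (forall s, (exists Y, irr_chain Z w s Y) -> (s <= r)%N).

(* The linear subspace of W whose projectivization is the embedded Zariski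
   tangent space of the reduced variety Z at the point [w]; its dimension is one
   more than that of the Zariski tangent space. *)
Definition tangent_cone (Z : set W) (w : W) : set W :=
  [set u | forall P, hideal Z P -> pdiff P w u = 0].

Definition smooth_at (Z : set W) (w : W) : Prop :=
  exists r, local_dim Z w r /\ subspace_dim (tangent_cone Z w) r.+1.

Definition Sing (Z : set W) : set W := [set w | Z w /\ ~ smooth_at Z w].

Definition secant (k : nat) (X : set W) : set W :=
  zclosure [set w | w != 0 /\
    exists xs : k.-tuple W, (forall i, X (tnth xs i)) /\ w \in <<xs>>%VS].

End Projective.

Section Veronese.
Variables (F : fieldType) (n : nat).

(* S^d V, where V = S^1 V has the n + 1 variables as a basis. *)
Definition form (d : nat) := dhomog n.+1 F d.

Definition veronese (d : nat) : set (form d) :=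
  [set f | exists (l : form 1) (c : F),
     [/\ l != 0, c != 0 & mpoly_of_dhomog f = c *: mpoly_of_dhomog l ^+ d]].

(* The action on forms of an element of the dual space of V, given by its
   coordinates a in the dual basis. *)
Definition dual_act (a : 'rV[F]_n.+1) (p : {mpoly F[n.+1]}) : {mpoly F[n.+1]} :=
  \sum_i a 0 i *: p^`M(i).

Definition essential (d : nat) (f : form d) : set (form 1) :=
  [set l | forall a, dual_act a (mpoly_of_dhomog f) = 0 ->
                     dual_act a (mpoly_of_dhomog l) = 0].

Definition degenerate (d : nat) : set (form d) :=
  [set f | [/\ secant 3 (@veronese d) f, ~ secant 2 (@veronese d) f
             & subspace_dim (essential f) 2]].

End Veronese.

Arguments veronese F n d : clear implicits.
Arguments degenerate F n d : clear implicits.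

(* Main.v *)
Require Import Defs.
From HB Require Import structures.
From mathcomp Require Import all_boot all_order all_algebra.
From mathcomp Require Import complex mpoly.
From mathcomp Require Import classical_sets reals.
From mathcomp Require Import boolp ring zify.

Set Implicit Arguments.
Unset Strict Implicit.
Unset Printing Implicit Defensive.
Import GRing.Theory Num.Theory.
Local Open Scope ring_scope.
Local Open Scope classical_set_scope.

Section RingPred.
Variables (K : fieldType) (X : Type).

Record ringpred (S : (X -> K) -> Prop) : Prop := RingPred {
  rp_cst : forall c, S (fun=> c);
  rp_add : forall p q, S p -> S q -> S (fun x => p x + q x);
  rp_mul : forall p q, S p -> S q -> S (fun x => p x * q x) }.

Variables (S : (X -> K) -> Prop) (HS : ringpred S).

Lemma rp_opp p : S p -> S (fun x => - p x).
Proof.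
move=> Sp; rewrite (_ : (fun x => _) = fun x => (-1) * p x).
  exact: (rp_mul HS (rp_cst HS _) Sp).
by apply: funext => x; rewrite mulN1r.
Qed.

Lemma rp_sub p q : S p -> S q -> S (fun x => p x - q x).
Proof. by move=> Sp Sq; apply: (rp_add HS) => //; apply: rp_opp. Qed.

Lemma rp_sum (I : Type) (r : seq I) (P : pred I) (p : I -> X -> K) :
  (forall i, P i -> S (p i)) -> S (fun x => \sum_(i <- r | P i) p i x).
Proof.
move=> Sp; elim: r => [|i r IH].
  rewrite (_ : (fun x => _) = fun=> 0); first exact: (rp_cst HS).
  by apply: funext => x; rewrite big_nil.
have [Pi|nPi] := boolP (P i).
  rewrite (_ : (fun x => _) = fun x => p i x + \sum_(j <- r | P j) p j x).
    exact: (rp_add HS (Sp _ Pi) IH).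
  by apply: funext => x; rewrite big_cons Pi.
rewrite (_ : (fun x => _) = fun x => \sum_(j <- r | P j) p j x) //.
by apply: funext => x; rewrite big_cons (negbTE nPi).
Qed.

Lemma rp_prod (I : Type) (r : seq I) (P : pred I) (p : I -> X -> K) :
  (forall i, P i -> S (p i)) -> S (fun x => \prod_(i <- r | P i) p i x).
Proof.
move=> Sp; elim: r => [|i r IH].
  rewrite (_ : (fun x => _) = fun=> 1); first exact: (rp_cst HS).
  by apply: funext => x; rewrite big_nil.
have [Pi|nPi] := boolP (P i).
  rewrite (_ : (fun x => _) = fun x => p i x * \prod_(j <- r | P j) p j x).
    exact: (rp_mul HS (Sp _ Pi) IH).
  by apply: funext => x; rewrite big_cons Pi.
rewrite (_ : (fun x => _) = fun x => \prod_(j <- r | P j) p j x) //.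
by apply: funext => x; rewrite big_cons (negbTE nPi).
Qed.

Lemma rp_exp p k : S p -> S (fun x => p x ^+ k).
Proof.
move=> Sp; elim: k => [|k IH]; first exact: (rp_cst HS).
rewrite (_ : (fun x => _) = fun x => p x * p x ^+ k); first exact: (rp_mul HS).
by apply: funext => x; rewrite exprS.
Qed.

Lemma rp_mulmx m n k (A : X -> 'M[K]_(m, n)) (B : X -> 'M[K]_(n, k)) :
  (forall i j, S (fun x => A x i j)) -> (forall i j, S (fun x => B x i j)) ->
  forall i j, S (fun x => (A x *m B x) i j).
Proof.
move=> SA SB i j.
rewrite (_ : (fun x => _) = fun x => \sum_l A x i l * B x l j).
  by apply: rp_sum => l _; apply: (rp_mul HS).
by apply: funext => x; rewrite mxE.
Qed.

Lemma rp_det n (A : X -> 'M[K]_n) :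
  (forall i j, S (fun x => A x i j)) -> S (fun x => \det (A x)).
Proof.
move=> SA; rewrite /determinant; apply: rp_sum => s _; apply: (rp_mul HS).
  exact: (rp_cst HS).
by apply: rp_prod => i _.
Qed.

Lemma rp_adj n (A : X -> 'M[K]_n) :
  (forall i j, S (fun x => A x i j)) ->
  forall i j, S (fun x => (\adj (A x)) i j).
Proof.
move=> SA i j; rewrite (_ : (fun x => _) = fun x => cofactor (A x) j i).
  apply: (rp_mul HS); first exact: (rp_cst HS).
  apply: rp_det => k l.
  by rewrite (_ : (fun x => _) = fun x => A x (lift j k) (lift i l)) //;
    apply: funext => x; rewrite !mxE.
by apply: funext => x; rewrite mxE.
Qed.

End RingPred.

Section PolyFn.
Variable K : numFieldType.

Definition lform (T : lmodType K) (b : T -> K) : Prop :=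
  forall a u v, b (a *: u + v) = a * b u + b v.

Inductive polyfn (T : lmodType K) : (T -> K) -> Prop :=
| polyfn_cst c : polyfn (fun=> c)
| polyfn_lin b : lform b -> polyfn b
| polyfn_add p q : polyfn p -> polyfn q -> polyfn (fun x => p x + q x)
| polyfn_mul p q : polyfn p -> polyfn q -> polyfn (fun x => p x * q x).

Lemma polyfn_ring (T : lmodType K) : ringpred (@polyfn T).
Proof. by split; [exact: polyfn_cst | exact: polyfn_add | exact: polyfn_mul]. Qed.

Section LForm.
Variables (T : lmodType K) (b : T -> K) (Hb : lform b).
Lemma lformD u v : b (u + v) = b u + b v.
Proof. by rewrite -[u]scale1r Hb mul1r scale1r. Qed.
Lemma lform0 : b 0 = 0.
Proof. by apply: (@addrI _ (b 0)); rewrite -lformD !addr0. Qed.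
Lemma lformZ a u : b (a *: u) = a * b u.
Proof. by rewrite -[a *: u]addr0 Hb lform0 addr0. Qed.
Lemma lformB u v : b (u - v) = b u - b v.
Proof. by rewrite -scaleN1r addrC Hb mulN1r addrC. Qed.
Lemma lform_sum (I : Type) (r : seq I) (P : pred I) (F : I -> T) :
  b (\sum_(i <- r | P i) F i) = \sum_(i <- r | P i) b (F i).
Proof. exact: (big_morph b lformD lform0). Qed.
End LForm.

Lemma rp_comp (T : lmodType K) (X : Type) (S : (X -> K) -> Prop)
    (Psi : X -> T) : ringpred S -> (forall b, lform b -> S (fun x => b (Psi x))) ->
  forall p, polyfn p -> S (fun x => p (Psi x)).
Proof.
move=> HS Sb p; elim=> [c|b Hb|q r _ Sq _ Sr|q r _ Sq _ Sr].
- exact: rp_cst.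
- exact: Sb.
- exact: (rp_add HS Sq Sr).
- exact: (rp_mul HS Sq Sr).
Qed.

Lemma polyfn_comp (T T' : lmodType K) (g : T -> T') p :
  (forall b, lform b -> polyfn (fun x => b (g x))) ->
  polyfn p -> polyfn (fun x => p (g x)).
Proof. by move=> gb; apply: rp_comp => //; apply: polyfn_ring. Qed.

Definition is_poly (g : K -> K) : Prop := exists q : {poly K}, forall t, g t = q.[t].

Lemma is_poly_ring : ringpred is_poly.
Proof.
split=> [c|p q [p' Hp] [q' Hq]|p q [p' Hp] [q' Hq]].
- by exists c%:P => t; rewrite hornerC.
- by exists (p' + q') => t; rewrite hornerD Hp Hq.
- by exists (p' * q') => t; rewrite hornerM Hp Hq.
Qed.

Lemma is_poly_id : is_poly id.
Proof. by exists 'X => t; rewrite hornerX. Qed.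

Lemma horner_ext0 (q : {poly K}) : (forall t, q.[t] = 0) -> q = 0.
Proof.
move=> q0; apply/eqP/negPn/negP => nz.
have := max_poly_roots nz (rs := [seq i%:R | i <- iota 0 (size q)]).
rewrite size_map size_iota ltnn => H; apply: notF; apply: H.
  by apply/allP => x _; rewrite rootE q0.
rewrite map_inj_uniq ?iota_uniq // => i j /eqP.
by rewrite eqr_nat => /eqP.
Qed.

Lemma horner_ext (q r : {poly K}) : (forall t, q.[t] = r.[t]) -> q = r.
Proof.
move=> E; apply/eqP; rewrite -subr_eq0; apply/eqP/horner_ext0 => t.
by rewrite hornerD hornerN E subrr.
Qed.

(* Two nonzero polynomials in one variable have a common nonroot. *)
Lemma is_poly_mul_neq0 g h t0 t1 : is_poly g -> is_poly h ->
  g t0 != 0 -> h t1 != 0 -> exists t, g t * h t != 0.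
Proof.
move=> [p Hp] [q Hq]; rewrite Hp Hq => p0 q0.
have nz (r : {poly K}) t : r.[t] != 0 -> r != 0.
  by apply: contraNneq => ->; rewrite horner0.
have pq : p * q != 0 by rewrite mulf_neq0 ?(nz _ _ p0) ?(nz _ _ q0).
apply: contrapT => H; move/eqP: pq; apply; apply: horner_ext0 => t.
rewrite hornerM -Hp -Hq; apply: contrapT => /eqP Ht.
by apply: H; exists t.
Qed.

Lemma is_poly_density g h t0 : is_poly g -> is_poly h -> h t0 != 0 ->
  (forall t, h t != 0 -> g t = 0) -> forall t, g t = 0.
Proof.
move=> Pg Ph h0 H t; apply/eqP/negPn/negP => gt.
have [s] := is_poly_mul_neq0 Pg Ph gt h0.
by have [->|/H->] := eqVneq (h s) 0; rewrite ?mulr0 ?mul0r eqxx.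
Qed.

Lemma polyfn_curve (T : lmodType K) (p : T -> K) (c : K -> T) : polyfn p ->
  (forall b, lform b -> is_poly (fun t => b (c t))) -> is_poly (fun t => p (c t)).
Proof. by move=> pp Hc; apply: (rp_comp is_poly_ring) pp. Qed.

Lemma polyfn_line (T : lmodType K) (p : T -> K) (x u : T) : polyfn p ->
  is_poly (fun t => p (x + t *: u)).
Proof.
move=> pp; apply: polyfn_curve => // b Hb; exists ((b x)%:P + (b u)%:P * 'X) => t.
by rewrite hornerD hornerM hornerX !hornerC lformD // lformZ // mulrC.
Qed.

(* A polynomial function vanishing off the zeros of a nonzero one is zero. *)
Lemma polyfn_density (T : lmodType K) (g h : T -> K) (x0 : T) :
  polyfn g -> polyfn h -> h x0 != 0 ->
  (forall x, h x != 0 -> g x = 0) -> forall x, g x = 0.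
Proof.
move=> pg ph h0 H x.
have := @is_poly_density (fun t => g (x + t *: (x0 - x)))
  (fun t => h (x + t *: (x0 - x))) 1 (polyfn_line _ _ pg) (polyfn_line _ _ ph).
rewrite scale1r addrC subrK => /(_ h0 (fun t => H _) 0).
by rewrite scale0r addr0.
Qed.

End PolyFn.

Section Peval.
Variables (K : numFieldType) (W : vectType K).
Implicit Types (P : polyfun W) (w u : W).

Lemma wcoord_lform i : lform (fun w : W => wcoord w i).
Proof. by move=> a u v; rewrite /wcoord linearP. Qed.

Lemma lform_wcoord b w : lform b ->
  b w = \sum_i wcoord w i * b (vbasis {: W})`_i.
Proof.
move=> Hb; rewrite {1}(coord_vbasis (memvf w)) (lform_sum Hb).
by apply: eq_bigr => i _; rewrite (lformZ Hb).
Qed.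

Lemma peval_polyfn P : polyfn (peval P).
Proof.
rewrite (_ : peval P = fun w => \sum_(m <- msupp P)
    (P@_m * \prod_i wcoord w i ^+ m i)); last first.
  by apply: funext => w; rewrite /peval mevalE.
have HR := @polyfn_ring K W.
apply: (rp_sum HR) => m _; apply: polyfn_mul; first exact: polyfn_cst.
apply: (rp_prod HR) => i _; apply: (rp_exp HR); apply: polyfn_lin.
exact: wcoord_lform.
Qed.

Lemma polyfn_peval p : polyfn p -> exists P, forall w, p w = peval P w.
Proof.
elim=> [c|b Hb|q r _ [Q HQ] _ [R HR]|q r _ [Q HQ] _ [R HR]].
- by exists c%:MP => w; rewrite /peval mevalC.
- exists (\sum_(i < \dim {: W}) (b (vbasis {: W})`_i) *: 'X_i) => w.
  rewrite /peval raddf_sum /= (lform_wcoord w Hb).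
  by apply: eq_bigr => i _; rewrite mevalZ mevalXU mulrC.
- by exists (Q + R) => w; rewrite HQ HR /peval mevalD.
- by exists (Q * R) => w; rewrite HQ HR /peval mevalM.
Qed.

Lemma pdiff_lform P w : lform (pdiff P w).
Proof.
move=> a u v; rewrite /pdiff mulr_sumr -big_split /=.
apply: eq_bigr => i _; rewrite /wcoord linearP /=; ring.
Qed.

Lemma pdiff_polyfn P u : polyfn (fun w => pdiff P w u).
Proof.
apply: (rp_sum (polyfn_ring W)) => i _; apply: polyfn_mul; last exact: polyfn_cst.
exact: peval_polyfn.
Qed.

Lemma pdiffD P Q w u : pdiff (P + Q) w u = pdiff P w u + pdiff Q w u.
Proof.
rewrite /pdiff -big_split /=; apply: eq_bigr => i _.
by rewrite mderivD mevalD mulrDl.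
Qed.

Lemma pdiff_sum (I : Type) (r : seq I) (F : I -> polyfun W) w u :
  pdiff (\sum_(i <- r) F i) w u = \sum_(i <- r) pdiff (F i) w u.
Proof.
apply: (big_morph (fun P => pdiff P w u)) => [P Q|]; first exact: pdiffD.
by rewrite /pdiff big1 // => i _; rewrite mderiv0 meval0 mul0r.
Qed.

(* The substitution of univariate polynomials into P, and its derivative. *)
Let subst (q : 'I_(\dim {: W}) -> {poly K}) P : {poly K} := mmap polyC q P.

Let subst_horner q P t : (subst q P).[t] = P.@[fun i => (q i).[t]].
Proof.
rewrite /subst /mmap mevalE horner_sum; apply: eq_bigr => m _.
rewrite hornerM hornerC; congr (_ * _).
by rewrite horner_prod; apply: eq_bigr => i _; rewrite horner_exp.
Qed.

Let subst_deriv q P : (subst q P)^`() = \sum_i subst q P^`M(i) * (q i)^`().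
Proof.
pose D (P : polyfun W) := (subst q P)^`() = \sum_i subst q P^`M(i) * (q i)^`().
have D0 : D 0.
  by rewrite /D /subst mmap0 deriv0 big1 // => i _; rewrite mderiv0 mmap0 mul0r.
have DD P1 P2 : D P1 -> D P2 -> D (P1 + P2).
  rewrite /D /subst mmapD derivD => -> ->; rewrite -big_split /=.
  by apply: eq_bigr => i _; rewrite mderivD mmapD mulrDl.
have DM P1 P2 : D P1 -> D P2 -> D (P1 * P2).
  rewrite /D /subst rmorphM derivM => -> ->.
  rewrite mulr_suml mulr_sumr -big_split /=.
  apply: eq_bigr => i _; rewrite mderivM mmapD !rmorphM /=; ring.
have DC c : D c%:MP.
  rewrite /D /subst mmapC derivC big1 // => i _.
  by rewrite mderivC mmap0 mul0r.
have DX i : D 'X_i.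
  rewrite /D /subst mmapX mmap1U (bigD1 i) //= big1 ?addr0.
    have U0 : (U_(i) - U_(i))%MM = 0%MM :> 'X_{1..\dim {: W}}.
      by apply/mnmP => j; rewrite mnmBE subnn mnm0E.
    by rewrite mderivX mnm1E eqxx U0 scale1r mpolyX0 rmorph1 mul1r.
  move=> j ji; rewrite mderivX mnm1E eq_sym (negbTE ji) scale0r.
  by rewrite mmap0 mul0r.
rewrite -/(D P); elim/mpolyind: P => // c m P _ _ DP; apply: (DD) => //.
rewrite -mul_mpolyC; apply: (DM) => //; rewrite mpolyXE_id.
apply: (big_ind D) => [||i _]; first exact: (DC 1); first exact: (DM).
by elim: (m i) => [|k IH]; [exact: (DC 1) | rewrite exprS; apply: (DM)].
Qed.

(* u is the velocity at 0 of the polynomial curve c. *)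
Definition velocity (c : K -> W) u : Prop :=
  forall b, lform b -> exists2 q : {poly K},
    forall t, b (c t) = q.[t] & b u = q^`().[0].

Lemma velocity_poly (c : K -> W) u b : velocity c u -> lform b ->
  is_poly (fun t => b (c t)).
Proof. by move=> Hc Hb; case: (Hc b Hb) => q Hq _; exists q. Qed.

Lemma pdiff_velocity P c u : velocity c u ->
  exists2 q : {poly K}, forall t, peval P (c t) = q.[t]
                      & pdiff P (c 0) u = q^`().[0].
Proof.
move=> Hc.
have H i : {q : {poly K} | (forall t, wcoord (c t) i = q.[t]) /\
    wcoord u i = q^`().[0]}.
  by apply: cid; case: (Hc _ (wcoord_lform i)) => r ? ?; exists r.
pose r i := sval (H i).
have r1 i t : wcoord (c t) i = (r i).[t] by rewrite /r; case: (H i) => ? [].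
have r2 i : wcoord u i = (r i)^`().[0] by rewrite /r; case: (H i) => ? [].
exists (subst r P) => [t|].
  by rewrite subst_horner; apply: meval_eq => i; rewrite r1.
rewrite subst_deriv horner_sum; apply: eq_bigr => i _.
rewrite hornerM subst_horner -r2; congr (_ * _).
by apply: meval_eq => j; rewrite r1.
Qed.

(* A polynomial vanishing along c has zero derivative along its velocity. *)
Lemma pdiff_velocity0 P c u : velocity c u -> (forall t, peval P (c t) = 0) ->
  pdiff P (c 0) u = 0.
Proof.
move=> /(pdiff_velocity P)[q Hq ->] Hc.
have -> : q = 0 by apply: horner_ext0 => t; rewrite -Hq Hc.
by rewrite deriv0 horner0.
Qed.

Lemma velocity_line w u : velocity (fun t => w + t *: u) u.
Proof.
move=> b Hb; exists ((b w)%:P + (b u)%:P * 'X) => [t|].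
  by rewrite lformD // lformZ // hornerD hornerM !hornerC hornerX mulrC.
by rewrite derivD derivM !derivC derivX mul0r !add0r mulr1 hornerC.
Qed.

Lemma velocity_sum (N : nat) (w : nat -> W) :
  velocity (fun t => \sum_(i < N.+2) t ^+ i *: w i) (w 1%N).
Proof.
move=> b Hb; exists (\poly_(i < N.+2) b (w i)) => [t|].
  rewrite horner_poly (lform_sum Hb); apply: eq_bigr => i _.
  by rewrite lformZ // mulrC.
by rewrite horner_coef0 coef_deriv coef_poly.
Qed.

Lemma velocity_exists (c : K -> W) :
  (forall i, is_poly (fun t => wcoord (c t) i)) -> exists u, velocity c u.
Proof.
move=> H; pose r i := sval (cid (H i)).
have r1 i t : wcoord (c t) i = (r i).[t] by rewrite /r; case: (cid (H i)) => ? /=.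
exists (\sum_(i < \dim {: W}) (r i)^`().[0] *: (vbasis {: W})`_i) => b Hb.
exists (\sum_(i < \dim {: W}) (b (vbasis {: W})`_i) *: r i) => [t|].
  rewrite (lform_wcoord _ Hb) horner_sum; apply: eq_bigr => i _.
  by rewrite hornerZ r1 mulrC.
rewrite (lform_sum Hb) linear_sum /= horner_sum; apply: eq_bigr => i _.
by rewrite lformZ // derivZ hornerZ mulrC.
Qed.

End Peval.

Section Cones.
Variables (K : numFieldType) (W : vectType K).
Implicit Types (P Q : polyfun W) (w u : W) (A Y : set W).

Definition is_cone A : Prop := forall c w, c != 0 -> A w -> A (c *: w).

Lemma wcoordZ c w i : wcoord (c *: w) i = c * wcoord w i.
Proof. by rewrite /wcoord linearZ. Qed.

Lemma peval_homogZ k P c w : P \is k.-homog ->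
  peval P (c *: w) = c ^+ k * peval P w.
Proof.
move=> /dhomogP HP; rewrite /peval !mevalE mulr_sumr.
rewrite big_seq [RHS]big_seq; apply: eq_bigr => m /HP Hm.
rewrite mulrCA; congr (_ * _); rewrite -Hm /= mdegE -prodrXr -big_split /=.
by apply: eq_bigr => i _; rewrite wcoordZ exprMn.
Qed.

Lemma peval0_homog k P : P \is k.-homog -> (0 < k)%N -> peval P 0 = 0.
Proof.
move=> HP k0; rewrite -[0 : W](scale0r 0) (peval_homogZ _ _ HP).
by rewrite expr0n eqn0Ngt k0 mul0r.
Qed.

Lemma pihomog_sum P : P = \sum_(k < msize P) pihomog mdeg k P.
Proof. exact: pihomog_partitionE. Qed.

Lemma peval_sum (I : Type) (r : seq I) (p : pred I) (F : I -> polyfun W) w :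
  peval (\sum_(i <- r | p i) F i) w = \sum_(i <- r | p i) peval (F i) w.
Proof. by rewrite /peval raddf_sum. Qed.

(* Vanishing on all nonzero multiples of w is inherited by the components. *)
Lemma pihomog_line P w : (forall c, c != 0 -> peval P (c *: w) = 0) ->
  forall k, peval (pihomog mdeg k P) w = 0.
Proof.
move=> H k; have [lk|gk] := ltnP k (msize P); last first.
  rewrite pihomogE big_seq_cond big_pred0 ?/peval ?meval0 // => m.
  apply/negP => /andP [/msize_mdeg_lt lm /eqP mk].
  by move: lm; rewrite mk ltnNge gk.
pose q := \poly_(i < msize P) peval (pihomog mdeg i P) w.
suff q0 : q = 0.
  by have := coef_poly (msize P) (fun i => peval (pihomog mdeg i P) w) k;
    rewrite lk -/q q0 coef0 => <-.
apply: horner_ext0; apply: (@is_poly_density _ _ id 1).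
- by exists q.
- exact: is_poly_id.
- exact: oner_neq0.
move=> t t0; rewrite horner_poly -[RHS](H t t0).
rewrite [in RHS](pihomog_sum P) peval_sum.
by apply: eq_bigr => i _; rewrite (peval_homogZ _ _ (pihomogP _ _ _)) mulrC.
Qed.

Lemma hideal_pihomog A P k : is_cone A -> (forall w, A w -> peval P w = 0) ->
  hideal A (pihomog mdeg k P).
Proof.
move=> cA HP; split; first by exists k; apply: pihomogP.
by move=> w Aw; apply: pihomog_line => c c0; apply/HP/cA.
Qed.

Lemma zclosureP A w : is_cone A ->
  zclosure A w <-> w != 0 /\
    forall P, (forall a, A a -> peval P a = 0) -> peval P w = 0.
Proof.
move=> cA; split=> -[w0 H]; split=> // P HP.
  rewrite (pihomog_sum P) peval_sum big1 // => k _.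
  exact: (H _ (hideal_pihomog k cA HP)).
by apply: H; case: HP.
Qed.

Lemma zclosed_zclosure A : zclosed (zclosure A).
Proof. by exists (hideal A); split=> // P []. Qed.

Lemma sub_zclosure A w : A w -> w != 0 -> zclosure A w.
Proof. by move=> Aw w0; split=> // P [_]; apply. Qed.

Lemma zclosed_cone A : zclosed A -> is_cone A.
Proof.
move=> [I [HI ->]] c w c0 [w0 Hw]; split.
  by rewrite scaler_eq0 negb_or c0.
move=> P IP; case: (HI P IP) => k HP.
by rewrite (peval_homogZ _ _ HP) (Hw P IP) mulr0.
Qed.

(* The homogeneous coordinate ring of an irreducible set is a domain. *)
Lemma zirreducible_cancel Y P Q : zirreducible Y -> homogeneous Q ->
  (exists2 y, Y y & peval Q y != 0) ->
  (forall y, Y y -> peval P y * peval Q y = 0) -> forall y, Y y -> peval P y = 0.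
Proof.
move=> [cY _ irrY] HQ [y0 Yy0 Qy0] HPQ.
have nz y : Y y -> y != 0 by case: cY => I [_ ->] [].
have H k y : Y y -> peval Q y != 0 -> peval (pihomog mdeg k P) y = 0.
  move=> Yy Qy; apply: pihomog_line => c c0.
  have := HPQ (c *: y) (zclosed_cone cY c0 Yy).
  case: HQ => e HQ; rewrite (peval_homogZ c y HQ) => /eqP.
  by rewrite !mulf_eq0 expf_eq0 (negbTE c0) andbF (negbTE Qy) !orbF => /eqP.
pose B := zeros [set R | exists k, R = pihomog mdeg k P].
pose C := zeros [set Q].
have cB : zclosed B.
  by eexists; split; [|reflexivity] => R [k ->]; exists k; apply: pihomogP.
have cC : zclosed C by eexists; split; [|reflexivity] => R ->.
have YBC : Y `<=` B `|` C.
  move=> y Yy; have [Qy|Qy] := eqVneq (peval Q y) 0; [right|left].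
    by split; [exact: nz | move=> R ->].
  by split; [exact: nz | move=> R [k ->]; apply: H].
case: (irrY B C cB cC YBC) => [YB y Yy|YC].
  rewrite (pihomog_sum P) peval_sum big1 // => k _.
  by case: (YB y Yy) => _; apply; exists k.
by case: (YC y0 Yy0) => _ /(_ Q erefl) Q0; rewrite Q0 eqxx in Qy0.
Qed.

End Cones.

Section Counting.
Variable K : fieldType.

Fixpoint expo (k s : nat) : finType :=
  if s is s'.+1 then (expo k s' * 'I_k)%type else 'I_k : finType.

Fixpoint mon (R : comNzRingType) (g : nat -> R) k s : expo k s -> R :=
  match s return expo k s -> R with
  | 0 => fun j => g 0%N ^+ (j : 'I_k)
  | s'.+1 => fun a => mon g a.1 * g s'.+1 ^+ a.2
  end.

Lemma card_expo k s : #|expo k s| = (k ^ s.+1)%N.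
Proof.
elim: s => [|s IH] /=; first by rewrite card_ord expn1.
by rewrite card_prod IH card_ord -expnSr.
Qed.

Lemma mon_morph (R R' : comNzRingType) (f : {rmorphism R -> R'}) g k s a :
  f (@mon R g k s a) = mon (f \o g) a.
Proof.
elim: s a => [|s IH] a /=; first by rewrite rmorphXn.
by rewrite rmorphM IH rmorphXn.
Qed.

Lemma msizeM_bound m (p q : {mpoly K[m]}) a b :
  (msize p <= a.+1 -> msize q <= b.+1 -> msize (p * q) <= (a + b).+1)%N.
Proof.
move=> pa qb; have [->|p0] := eqVneq p 0; first by rewrite mul0r msize0.
have [->|q0] := eqVneq q 0; first by rewrite mulr0 msize0.
rewrite msizeM //; move: (msize p) (msize q) pa qb => x y; lia.
Qed.

Lemma msizeX_bound m (p : {mpoly K[m]}) a k :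
  (msize p <= a.+1 -> msize (p ^+ k) <= (a * k).+1)%N.
Proof.
move=> pa; elim: k => [|k IH]; first by rewrite expr0 msize1.
by rewrite exprS mulnS; apply: msizeM_bound.
Qed.

Lemma msize_mon m (G : nat -> {mpoly K[m]}) E k s a :
  (forall j, j <= s -> msize (G j) <= E.+1)%N ->
  (msize (@mon _ G k s a) <= (s.+1 * (E * k)).+1)%N.
Proof.
have X j e : (msize (G j) <= E.+1 -> e < k -> msize (G j ^+ e) <= (E * k).+1)%N.
  move=> Ej ek; apply: leq_trans (msizeX_bound e Ej) _.
  by rewrite ltnS leq_mul2l ltnW ?orbT.
elim: s a => [|s IH] a HE /=.
  by rewrite mul1n; apply: X => //; apply: HE.
rewrite mulSnr; apply: msizeM_bound; last by apply: X => //; apply: HE.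
by apply: IH => j js; apply: HE; apply: leqW.
Qed.

(* More than m polynomials in m variables satisfy an algebraic relation: the
   monomials in them outnumber those of comparable degree in the variables. *)
Lemma algebraic_relation m s (G : nat -> {mpoly K[m]}) : (m <= s)%N ->
  exists k (c : expo k s -> K),
    (exists a, c a != 0) /\ \sum_a c a *: mon G a = 0.
Proof.
move=> ms; pose E := (\max_(j < s.+1) msize (G j))%N.
have HE j : (j <= s -> msize (G j) <= E.+1)%N.
  by move=> js; apply/leqW/(@leq_bigmax _ (fun j : 'I_s.+1 => msize (G j))
    (Ordinal (js : j < s.+1)%N)).
pose e := (s.+1 * E).+1; pose k := (e ^ m).+1.
pose N := (s.+1 * (E * k)).+1.
have Nk : (N <= e * k)%N by rewrite /N /e; lia.
pose X := {ffun 'I_m -> 'I_N}.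
pose mX (x : X) : 'X_{1..m} := [multinom x i : nat | i < m].
pose M := \matrix_(i < #|expo k s|, j < #|{: X}|)
  (mon G (enum_val i : expo k s))@_(mX (enum_val j)).
have lt : (#|{: X}| < #|expo k s|)%N.
  rewrite card_ffun !card_ord card_expo.
  apply: leq_ltn_trans (_ : (e * k) ^ m < _)%N; first by case: (m) => // p; rewrite leq_exp2r.
  apply: leq_trans (_ : k ^ m.+1 <= _)%N; last by rewrite leq_pexp2l.
  by rewrite expnMn expnS ltn_mul2r expn_gt0 /= /k ltnS leqnn.
have : kermx M != 0.
  rewrite -mxrank_eq0 mxrank_ker -lt0n subn_gt0.
  exact: leq_ltn_trans (rank_leq_col M) lt.
case/rowV0Pn=> v /sub_kermxP vM v0.
exists k, (fun a => v 0 (enum_rank a)); split.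
  apply: contrapT => H; move/eqP: v0; apply; apply/rowP => i; rewrite mxE.
  apply: contrapT => /eqP vi; apply: H; exists (enum_val i).
  by rewrite enum_valK.
apply/mpolyP => x; rewrite mcoeff0 raddf_sum /=.
have [/forallP xN|] := boolP [forall i, x i < N]%N; last first.
  rewrite negb_forall; case/existsP=> i; rewrite -leqNgt => xi; apply: big1 => a _.
  rewrite mcoeffZ memN_msupp_eq0 ?mulr0 //; apply: msize_mdeg_ge.
  apply: leq_trans (msize_mon _ HE) _; apply: leq_trans xi _.
  by rewrite mdegE (bigD1 i) //= leq_addr.
pose y : X := [ffun i => Ordinal (xN i)].
have xy : x = mX y by apply/mnmP => i; rewrite mnmE ffunE.
transitivity ((v *m M) 0 (enum_rank y)); last by rewrite vM mxE.
rewrite mxE.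
rewrite (reindex (@enum_val _ (mem (expo k s)))) /=; last first.
  exists enum_rank => ? _; [exact: enum_valK | exact: enum_rankK].
by apply: eq_bigr => i _; rewrite mcoeffZ !mxE enum_valK enum_rankK xy.
Qed.

End Counting.

Section ParamCone.
Variables (K : numFieldType) (T W : vectType K) (phi : T -> W).
Hypothesis phi_poly : forall b, lform b -> polyfn (fun A => b (phi A)).
Hypothesis phi_cone : forall c A, exists A', phi A' = c *: phi A.
Hypothesis phi_neq0 : exists A, phi A != 0.
Implicit Types (P Q : polyfun W) (w u : W).

Definition vanish P : Prop := forall A, peval P (phi A) = 0.

Definition pcone : set W :=
  [set w | w != 0 /\ forall P, vanish P -> peval P w = 0].

Lemma pcone_is_cone : is_cone pcone.
Proof.
move=> c w c0 [w0 Hw]; split; first by rewrite scaler_eq0 negb_or c0.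
move=> P HP; have pZ : polyfn (fun w => peval P (c *: w)).
  apply: polyfn_comp (peval_polyfn P) => b Hb; apply: polyfn_lin => a u v.
  by rewrite scalerDr (lformD Hb) !(lformZ Hb); ring.
have [Q HQ] := polyfn_peval pZ; rewrite HQ; apply: Hw => A.
by rewrite -HQ; have [A' <-] := phi_cone c A; apply: HP.
Qed.

Lemma pcone_phi A : phi A != 0 -> pcone (phi A).
Proof. by move=> A0; split=> // P; apply. Qed.

(* The zero vector is no exception: it is a limit of nonzero values. *)
Lemma vanish_neq0 P : (forall A, phi A != 0 -> peval P (phi A) = 0) -> vanish P.
Proof.
move=> HP A; have [A0|A0] := eqVneq (phi A) 0; last exact: HP.
have [B B0] := phi_neq0.
have := @is_poly_density _ (fun t => peval P (0 + t *: phi B)) id 1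
  (polyfn_line 0 (phi B) (peval_polyfn P)) (is_poly_id _) (oner_neq0 _).
move=> /(_ _ 0); rewrite scale0r addr0 A0; apply=> t t0.
rewrite add0r; have [B' E] := phi_cone t B; rewrite -E; apply: HP.
by rewrite E scaler_eq0 negb_or t0.
Qed.

Lemma vanish_pcone P : (forall w, pcone w -> peval P w = 0) -> vanish P.
Proof. by move=> HP; apply: vanish_neq0 => A A0; apply/HP/pcone_phi. Qed.

Lemma pcone_peval P w : pcone w -> vanish P -> peval P w = 0.
Proof. by case=> _; apply. Qed.

Lemma pcone_polyfn (p : W -> K) w : pcone w -> polyfn p ->
  (forall A, p (phi A) = 0) -> p w = 0.
Proof.
move=> [_ Hw] /polyfn_peval[P HP] H; rewrite HP; apply: Hw => A.
by rewrite -HP.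
Qed.

Lemma zclosed_pcone : zclosed pcone.
Proof.
exists (hideal pcone); split=> [P []//|]; apply/seteqP; split=> w.
  by move=> Zw; split; [case: Zw | move=> P [_]; apply].
move/(zclosureP _ pcone_is_cone) => [w0 H]; split=> // P HP.
by apply: H => a [_]; apply.
Qed.

Lemma tangent_pcone w u :
  tangent_cone pcone w u <-> forall P, vanish P -> pdiff P w u = 0.
Proof.
split=> H P HP; last by apply/H/vanish_pcone; case: HP.
rewrite (pihomog_sum P) pdiff_sum big1 // => k _.
by apply/H/(hideal_pihomog k pcone_is_cone) => v [_]; apply.
Qed.

Lemma tangent_lin w a u v : tangent_cone pcone w u -> tangent_cone pcone w v ->
  tangent_cone pcone w (a *: u + v).
Proof.
move=> Hu Hv P HP.
by rewrite (pdiff_lform P w) (Hu P HP) (Hv P HP) mulr0 addr0.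
Qed.

Lemma tangent_self w : pcone w -> tangent_cone pcone w w.
Proof.
move=> Zw; apply/tangent_pcone => P HP.
rewrite -[X in pdiff P X w](addr0 w) -(scale0r w).
apply: (pdiff_velocity0 (velocity_line w w)) => t.
have := @is_poly_density _ (fun t => peval P (w + t *: w)) (fun t => 1 + t) 0
  (polyfn_line w w (peval_polyfn P)).
apply=> [||s s0]; first by apply: (rp_add (is_poly_ring K));
  [exact: (rp_cst (is_poly_ring K)) | exact: is_poly_id].
  by rewrite addr0 oner_neq0.
rewrite -{1}[w]scale1r -scalerDl.
by apply: pcone_peval => //; apply: pcone_is_cone.
Qed.

Section Chain.
Variables (w : W) (s : nat) (Y : nat -> set W).
Hypothesis HY : irr_chain pcone w s Y.

Let Yirr i : (i <= s)%N -> zirreducible (Y i).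
Proof. by move=> is'; case: HY => /(_ i is')[]. Qed.

Let step i : (i < s)%N -> exists P, [/\ homogeneous P,
  forall y, Y i y -> peval P y = 0 & exists2 y, Y i.+1 y & peval P y != 0].
Proof.
move=> lis; have [_ /(_ i lis)[sub nsub]] := HY.
have [cY _ _] := Yirr (ltnW lis); have [cY1 _ _] := Yirr lis.
move: cY cY1 => [I [HI EI]] [I1 [_ EI1]].
apply: contrapT => H; apply: nsub => y Yy.
rewrite EI; split; first by move: Yy; rewrite EI1 => -[].
move=> P IP; apply: contrapT => /eqP Py; apply: H; exists P; split.
- exact: HI.
- by move=> z; rewrite EI => -[_]; apply.
- by exists y.
Qed.

Let g0 : exists P : polyfun W, P \is 1.-homog /\ peval P w != 0.
Proof.
have [[_ Yw sub] _] := (HY.1 0%N (leq0n _), HY.2).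
have [w0 _] := sub _ Yw; apply: contrapT => H.
move/eqP: w0; apply; rewrite (coord_vbasis (memvf w)) big1 // => i _.
suff -> : coord (vbasis {: W}) i w = 0 by rewrite scale0r.
apply: contrapT => /eqP wi; apply: H; exists 'X_i; split.
  by rewrite dhomogX /= mdeg1.
by rewrite /peval mevalXU.
Qed.

(* Polynomials separating consecutive terms of the chain are algebraically
   independent on its last term. *)
Let indep : exists g : nat -> polyfun W, forall k t, (t <= s)%N ->
  forall c : expo k t -> K,
    (forall y, Y t y -> peval (\sum_a c a *: mon g a) y = 0) ->
  forall a, c a = 0.
Proof.
have [h0 [h0hom h0w]] := g0.
have Hstep i : {P : polyfun W | (i < s)%N -> [/\ homogeneous P,
    forall y, Y i y -> peval P y = 0 & exists2 y, Y i.+1 y & peval P y != 0]}.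
  apply: cid; have [/step[P HP]|nlt] := boolP (i < s)%N; first by exists P.
  by exists 0.
pose g i := if i is i'.+1 then sval (Hstep i') else h0.
exists g => k; elim=> [|t IH] ts c Hc.
  have Hw z : z != 0 -> \sum_(j < k) c j * (z * peval h0 w) ^+ j = 0.
    move=> z0; have [[cY _ _] Yw _] := HY.1 0%N (leq0n _).
    rewrite -[RHS](Hc _ (zclosed_cone cY z0 Yw)) peval_sum.
    apply: eq_bigr => j _ /=; rewrite /peval mevalZ rmorphXn /=.
    congr (_ * _ ^+ _); rewrite -[RHS]/(peval h0 (z *: w)).
    by rewrite (peval_homogZ z w h0hom) expr1.
  pose q := \poly_(j < k) (if insub j is Some j' then c j' else 0).
  have q0 : q = 0.
    apply: horner_ext0; apply: (@is_poly_density _ _ id 1).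
    - by exists q.
    - exact: is_poly_id.
    - exact: oner_neq0.
    move=> z z0; rewrite horner_poly.
    have := Hw (z / peval h0 w) (mulf_neq0 z0 (invr_neq0 h0w)).
    rewrite divfK // => E; rewrite -[RHS]E; apply: eq_bigr => j _.
    by rewrite valK.
  move=> a; have := coef_poly k (fun j => if insub j is Some j' then c j' else 0) a.
  by rewrite -/q q0 coef0 ltn_ord valK => <-.
pose C (j : 'I_k) := \sum_(a : expo k t) c (a, j) *: mon g a.
have gt : [/\ homogeneous (g t.+1), forall y, Y t y -> peval (g t.+1) y = 0
    & exists2 y, Y t.+1 y & peval (g t.+1) y != 0].
  by rewrite /g; case: (Hstep t) => P /=; apply.
have CE y : peval (\sum_a c a *: mon g a) y
    = \sum_(j < k) peval (C j) y * peval (g t.+1) y ^+ j.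
  rewrite peval_sum (eq_bigr (fun a => (peval (c (a.1, a.2) *: mon g a.1) y) *
     peval (g t.+1) y ^+ (a.2 : 'I_k))); last first.
    by move=> [a j] _ /=; rewrite /peval !mevalZ mevalM rmorphXn /= mulrA.
  rewrite -(pair_big xpredT xpredT (fun a j => peval (c (a, j) *: mon g a) y *
     peval (g t.+1) y ^+ (j : 'I_k))) /= exchange_big /=.
  by apply: eq_bigr => j _; rewrite /C peval_sum mulr_suml.
suff H (j : 'I_k) : forall a, c (a, j) = 0 by case.
have [N] := ubnP (j : nat); elim: N => // N IHN in j *; rewrite ltnS => jN.
have {}IHN (i : 'I_k) : (i < j)%N -> forall y, peval (C i) y = 0.
  move=> ij y; rewrite /C peval_sum big1 // => a _.
  by rewrite IHN ?scale0r ?/peval ?meval0 // (leq_trans ij jN).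
have [hg g0' [y1 Yy1 gy1]] := gt.
pose Q := \sum_(i < k | (j <= i)%N) C i * g t.+1 ^+ (i - j).
have HQ y : Y t.+1 y -> peval Q y = 0.
  have hgj : homogeneous (g t.+1 ^+ j).
    by case: hg => e he; exists (e * j)%N; apply: dhomogMn.
  apply: (zirreducible_cancel (Yirr ts) hgj) => [|z Yz].
    by exists y1 => //; rewrite /peval rmorphXn /= expf_neq0.
  rewrite -[RHS](Hc z Yz) CE /peval !rmorphXn /= raddf_sum /= mulr_suml.
  rewrite [RHS](bigID (fun i : 'I_k => (j <= i)%N)) /= [X in _ = _ + X]big1 ?addr0.
    apply: eq_bigr => i ji; rewrite mevalM rmorphXn /= -mulrA -exprD.
    by rewrite subnK.
  by move=> i; rewrite -ltnNge => ij; rewrite -/(peval _ _) IHN ?mul0r.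
apply: IH (ltnW ts) _ _ => y Yy; have [_ _] := HY.2 t ts.
have Yy' : Y t.+1 y by case: (HY.2 t ts) => sub _; apply: sub.
have := HQ y Yy'; rewrite /Q (bigD1 j) //= subnn expr0 mulr1.
rewrite /peval mevalD -/(peval _ _) -[X in _ + X]/(peval _ _) [X in _ + X]peval_sum.
rewrite [X in _ + X]big1 ?addr0 //.
move=> i /andP [ji ij]; rewrite /peval mevalM rmorphXn /=.
rewrite -[X in _ * X ^+ _]/(peval _ _) (g0' y Yy) expr0n subn_eq0.
have : (j < i)%N by rewrite ltn_neqAle ji andbT eq_sym.
by rewrite ltnNge => /negbTE ->; rewrite mulr0.
Qed.

Lemma chain_length : (s < \dim {: T})%N.
Proof.
rewrite ltnNge; apply/negP => ms; have [g indep_g] := indep.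
have pull i : {Q : polyfun T | forall A, peval (g i) (phi A) = peval Q A}.
  by apply: cid; apply/polyfn_peval/polyfn_comp => //; apply: peval_polyfn.
have [k [c [[a ca] Hc]]] := algebraic_relation (fun i => sval (pull i)) ms.
move/eqP: ca; apply; apply: (indep_g k s (leqnn s) c _ a) => y Yy.
have [_ _ /(_ y Yy) Zy] := HY.1 s (leqnn s).
apply: (pcone_peval Zy) => A; rewrite peval_sum.
transitivity (peval (\sum_a c a *: mon (fun i => sval (pull i)) a) A).
  rewrite peval_sum; apply: eq_bigr => b _; rewrite /peval !mevalZ; congr (_ * _).
  elim: (s) b => [|s' IH] b /=; first rewrite !rmorphXn /=.
    by congr (_ ^+ _); exact: (svalP (pull 0%N) A).
  rewrite !mevalM !rmorphXn IH /=; congr (_ * _ ^+ _).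
  exact: (svalP (pull s'.+1) A).
by rewrite Hc /peval meval0.
Qed.

End Chain.

Lemma local_dim_lt w r : local_dim pcone w r -> (r < \dim {: T})%N.
Proof. by case=> -[Y HY] _; apply: chain_length HY. Qed.

(* The rank of a matrix of linear functionals is lower semicontinuous: if it
   exceeds r at w, then some r+1 by r+1 compression has nonzero determinant. *)
Lemma rank_pcone p q (L : W -> 'M[K]_(p, q)) r (h : T -> K) A0 w :
  (forall i j, lform (fun w => L w i j)) -> polyfn h -> h A0 != 0 ->
  (forall A, h A != 0 -> (\rank (L (phi A)) <= r)%N) -> pcone w ->
  (\rank (L w) <= r)%N.
Proof.
move=> HL Ph h0 Hr Zw; rewrite leqNgt; apply/negP => rL.
pose B := pid_mx (R := K) (m := r.+1) (n := p) r.+1 *m invmx (col_ebase (L w)).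
pose C := invmx (row_ebase (L w)) *m pid_mx (R := K) (m := q) (n := r.+1) r.+1.
pose D v := \det (B *m L v *m C).
have PD : polyfn D.
  have HR := polyfn_ring W; apply: (rp_det HR).
  apply: (rp_mulmx HR); last by move=> i j; apply: (rp_cst HR).
  apply: (rp_mulmx HR); first by move=> i j; apply: (rp_cst HR).
  by move=> i j; apply: polyfn_lin.
have D0 A : D (phi A) = 0.
  apply: (polyfn_density (polyfn_comp phi_poly PD) Ph h0) => {}A hA.
  apply/eqP/negPn/negP => DA; have : row_free (B *m L (phi A) *m C).
    by rewrite row_free_unit unitmxE unitfE.
  rewrite /row_free => /eqP rk; have := Hr A hA.
  have := leq_trans (mxrankM_maxl (B *m L (phi A)) C) (mxrankM_maxr B (L (phi A))).
  by rewrite rk => /leq_trans H /H; rewrite ltnn.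
have := pcone_polyfn Zw PD D0; rewrite /D.
have -> : B *m L w *m C = 1%:M.
  rewrite -{1}(mulmx_ebase (L w)) /B /C !mulmxA mulmxKV ?col_ebase_unit //.
  rewrite mulmxK ?row_ebase_unit // !mul_pid_mx.
  have := leq_trans rL (rank_leq_row (L w)); have := leq_trans rL (rank_leq_col (L w)).
  move: (\rank _) rL => k rL qr pr.
  by rewrite (_ : minn _ _ = r.+1) ?pid_mx_1 //; lia.
by rewrite det1 => /eqP; rewrite oner_eq0.
Qed.

End ParamCone.

Section RatFn.
Variables (K : numFieldType) (T : lmodType K) (delta : T -> K).
Hypothesis delta_poly : polyfn delta.

Definition ratfn (g : T -> K) : Prop := exists N (h : T -> K),
  polyfn h /\ forall v, delta v != 0 -> delta v ^+ N * g v = h v.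

Lemma ratfn_poly g : polyfn g -> ratfn g.
Proof. by move=> Pg; exists 0%N, g; split=> // v _; rewrite mul1r. Qed.

Lemma ratfn_ring : ringpred ratfn.
Proof.
have HR := polyfn_ring T.
split=> [c|p q [N [h [Ph Hh]]] [M [k [Pk Hk]]]|p q [N [h [Ph Hh]]] [M [k [Pk Hk]]]].
- exact/ratfn_poly/polyfn_cst.
- exists (N + M)%N, (fun v => delta v ^+ M * h v + delta v ^+ N * k v); split.
    by apply: polyfn_add; apply: polyfn_mul => //; apply: (rp_exp HR).
  by move=> v dv; rewrite -Hh // -Hk // exprD; ring.
- exists (N + M)%N, (fun v => h v * k v); split; first exact: polyfn_mul.
  by move=> v dv; rewrite -Hh // -Hk // exprD; ring.
Qed.

Lemma ratfn_ext g g' : (forall v, delta v != 0 -> g v = g' v) ->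
  ratfn g -> ratfn g'.
Proof.
by move=> E [N [h [Ph Hh]]]; exists N, h; split=> // v dv; rewrite -E // Hh.
Qed.

Lemma ratfn_divides g h : polyfn h ->
  (forall v, delta v != 0 -> delta v * g v = h v) -> ratfn g.
Proof. by move=> Ph E; exists 1%N, h; split=> // v dv; rewrite expr1 E. Qed.

Lemma ratfn_invmx n (A : T -> 'M[K]_n) :
  (forall i j, ratfn (fun v => A v i j)) ->
  ratfn (fun v => (\det (A v))^-1) -> (forall v, delta v != 0 -> \det (A v) != 0) ->
  forall i j, ratfn (fun v => invmx (A v) i j).
Proof.
move=> RA Rd dA i j.
apply: (@ratfn_ext (fun v => (\det (A v))^-1 * (\adj (A v)) i j)).
  by move=> v dv; rewrite /invmx unitmxE unitfE dA // !mxE.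
by apply: (rp_mul ratfn_ring) => //; apply: (rp_adj ratfn_ring).
Qed.

End RatFn.

Section Separating.
Variables (K : numFieldType) (W : vectType K) (E : finType) (xi : E -> W -> K).
Hypothesis xi_lin : forall e, lform (xi e).
Hypothesis xi_sep : forall w, (forall e, xi e w = 0) -> w = 0.

Lemma lform_separating b : lform b ->
  exists c : E -> K, forall w, b w = \sum_e c e * xi e w.
Proof.
move=> Hb; pose M := \matrix_(i < \dim {: W}, j < #|E|)
  xi (enum_val j) (vbasis {: W})`_i.
pose cw w : 'rV_(\dim {: W}) := \row_i wcoord w i.
have xiM w : cw w *m M = \row_j xi (enum_val j) w.
  apply/rowP => j; rewrite !mxE (lform_wcoord w (xi_lin _)).
  by apply: eq_bigr => i _; rewrite !mxE.
have /row_freeP[N MN] : row_free M.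
  apply/row_freeP; suff : row_free M by move/row_freeP.
  rewrite -kermx_eq0; apply/rowV0P => v /sub_kermxP vM.
  pose w := \sum_i v 0 i *: (vbasis {: W})`_i.
  have vw : v = cw w.
    apply/rowP => i; rewrite mxE /wcoord.
    by rewrite coord_sum_free // (basis_free (vbasisP _)).
  suff w0 : w = 0 by rewrite vw w0; apply/rowP => i; rewrite !mxE /wcoord linear0.
  apply: xi_sep => e; move: vM; rewrite vw xiM => /rowP/(_ (enum_rank e)).
  by rewrite !mxE enum_rankK.
exists (fun e => \sum_i N (enum_rank e) i * b (vbasis {: W})`_i) => w.
have -> : b w = \sum_i (cw w *m M *m N) 0 i * b (vbasis {: W})`_i.
  rewrite -mulmxA MN mulmx1 (lform_wcoord w Hb).
  by apply: eq_bigr => i _; rewrite mxE.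
rewrite (eq_bigr (fun i => \sum_e xi e w * N (enum_rank e) i *
    b (vbasis {: W})`_i)); last first.
  move=> i _; rewrite mxE mulr_suml (reindex (@enum_rank E)) /=.
    by apply: eq_bigr => e _; rewrite xiM mxE enum_rankK.
  by exists enum_val => ? _; [exact: enum_rankK | exact: enum_valK].
rewrite exchange_big /=; apply: eq_bigr => e _; rewrite mulr_suml.
by apply: eq_bigr => i _; ring.
Qed.

Lemma rp_separating (X : Type) (S : (X -> K) -> Prop) (Psi : X -> W) :
  ringpred S -> (forall e, S (fun x => xi e (Psi x))) ->
  forall b, lform b -> S (fun x => b (Psi x)).
Proof.
move=> HS Sxi b Hb; have [c Hc] := lform_separating Hb.
rewrite (_ : (fun x => _) = fun x => \sum_e c e * xi e (Psi x)).
  by apply: (rp_sum HS) => e _; apply: (rp_mul HS) => //; apply: (rp_cst HS).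
by apply: funext => x.
Qed.

Lemma lform_eq0 (w : W) : (forall b, lform b -> b w = 0) -> w = 0.
Proof. by move=> H; apply: xi_sep => e; apply: H. Qed.

End Separating.

Section Chart.
Variables (K : numFieldType) (T W : vectType K) (phi : T -> W).
Hypothesis phi_poly : forall b, lform b -> polyfn (fun A => b (phi A)).
Hypothesis phi_cone : forall c A, exists A', phi A' = c *: phi A.
Hypothesis phi_neq0 : exists A, phi A != 0.
Local Notation Z := (pcone phi).

Lemma zclosure_sub (A C : set W) : A `<=` C -> zclosed C -> zclosure A `<=` C.
Proof.
move=> AC [I [HI EC]] w [w0 Hw]; rewrite EC; split=> // P IP.
apply: Hw; split; first exact: HI.
by move=> a /AC; rewrite EC => -[_]; apply.
Qed.

Lemma lform_homog (b : W -> K) : lform b ->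
  exists P : polyfun W, homogeneous P /\ forall w, peval P w = b w.
Proof.
move=> Hb; exists (\sum_(i < \dim {: W}) (b (vbasis {: W})`_i) *: 'X_i); split.
  exists 1%N; apply: rpred_sum => i _; apply: dhomogZ.
  by rewrite dhomogX /= mdeg1.
move=> w; rewrite peval_sum (lform_wcoord w Hb).
by apply: eq_bigr => i _; rewrite /peval mevalZ mevalXU mulrC.
Qed.

Variables (I : finType).
Local Notation V := {ffun I -> K^o}.
Variables (pi : W -> V) (delta : V -> K) (Psi : V -> W).
Hypothesis cardI : #|I| = \dim {: T}.
Hypothesis pi_lin : forall i, lform (fun w => pi w i : K).
Hypothesis delta_poly : polyfn delta.
Hypothesis delta0 : delta 0 = 0.
Hypothesis Psi_rat : forall b, lform b -> ratfn delta (fun v => b (Psi v)).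
Hypothesis piPsi : forall v, delta v != 0 -> pi (Psi v) = v.
Hypothesis Psi_mem : forall v P, delta v != 0 -> vanish phi P -> peval P (Psi v) = 0.
Variables (h : T -> K) (A0 : T).
Hypothesis (h_poly : polyfn h) (hA0 : h A0 != 0).
Hypothesis Psipi : forall A, h A != 0 -> delta (pi (phi A)) != 0 ->
  Psi (pi (phi A)) = phi A.

Let coordV i : lform (fun v : V => v i : K).
Proof. by move=> a u v; rewrite !ffunE. Qed.

Let lform_pi (b : V -> K) : lform b -> lform (fun w => b (pi w)).
Proof.
move=> Hb a u v; rewrite -Hb; congr b; apply/ffunP => i.
by rewrite !ffunE; apply: pi_lin.
Qed.

Let pi_poly p : polyfn p -> polyfn (fun w => p (pi w)).
Proof. by apply: polyfn_comp => b Hb; apply/polyfn_lin/lform_pi. Qed.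

(* Z is the graph of a rational map over the open set where delta o pi is
   nonzero. *)
Let graph b : lform b -> exists N hb, [/\ polyfn hb,
  forall v, delta v != 0 -> delta v ^+ N * b (Psi v) = hb v &
  polyfn (fun w => delta (pi w) * (hb (pi w) - delta (pi w) ^+ N * b w)) /\
  forall A, delta (pi (phi A)) * (hb (pi (phi A)) -
    delta (pi (phi A)) ^+ N * b (phi A)) = 0].
Proof.
move=> Hb; have [N [hb [Phb Hhb]]] := Psi_rat Hb; exists N, hb.
have HR := polyfn_ring W.
have Pp : polyfn (fun w => delta (pi w) * (hb (pi w) - delta (pi w) ^+ N * b w)).
  apply: polyfn_mul; first exact: pi_poly.
  apply: (rp_sub HR); first exact: pi_poly.
  by apply: polyfn_mul; [apply: (rp_exp HR); apply: pi_poly | apply: polyfn_lin].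
split=> //; split=> //.
apply: (polyfn_density (polyfn_comp phi_poly Pp) h_poly hA0) => A hA.
have [->|dA] := eqVneq (delta (pi (phi A))) 0; first by rewrite mul0r.
by rewrite -Hhb // Psipi // subrr mulr0.
Qed.

Let lform0P (u : W) : (forall b, lform b -> b u = 0) -> u = 0.
Proof.
move=> H; rewrite (coord_vbasis (memvf u)) big1 // => i _.
by have := H _ (wcoord_lform i); rewrite /wcoord => ->; rewrite scale0r.
Qed.

Section Point.
Variable w : W.
Hypotheses (Zw : Z w) (dw : delta (pi w) != 0).
Let v0 := pi w.

Let Psi_v0 : Psi v0 = w.
Proof.
apply/eqP; rewrite -subr_eq0; apply/eqP/lform0P => b Hb.
have [N [hb [_ Hhb [Pp Hp]]]] := graph Hb.
have /eqP := pcone_polyfn Zw Pp Hp.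
rewrite mulf_eq0 (negbTE dw) /= -Hhb // -mulrBr mulf_eq0.
by rewrite expf_eq0 (negbTE dw) andbF /= (lformB Hb) => /eqP.
Qed.

Let tangent_ker u : tangent_cone Z w u -> pi u = 0 -> u = 0.
Proof.
move=> Tu pu; apply: lform0P => b Hb.
have [N [hb [_ _ [Pp Hp]]]] := graph Hb.
have [P HP] := polyfn_peval Pp.
have vP : vanish phi P by move=> A; rewrite -HP.
have /(tangent_pcone phi_cone phi_neq0) /(_ P vP) := Tu.
have [q Hq] := pdiff_velocity P (velocity_line w u).
rewrite scale0r addr0 => -> q0.
have piw t : pi (w + t *: u) = v0.
  apply/ffunP => i; rewrite (lformD (pi_lin i)) (lformZ (pi_lin i)) pu.
  by rewrite ffunE mulr0 addr0.
pose c := delta v0 * (hb v0 - delta v0 ^+ N * b w).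
pose e := delta v0 ^+ N.+1 * b u.
have qE : q = c%:P - e%:P * 'X.
  apply: horner_ext => t; rewrite -Hq -HP piw (lformD Hb) (lformZ Hb).
  by rewrite hornerD hornerN hornerM !hornerC hornerX /c /e exprS; ring.
move/eqP: q0; rewrite qE derivB derivM !derivC derivX mul0r !add0r mulr1.
rewrite hornerN hornerC oppr_eq0 mulf_eq0 expf_eq0 (negbTE dw) andbF.
by move/eqP.
Qed.

Let Psi_scale c v P : delta v != 0 -> vanish phi P -> peval P (c *: Psi v) = 0.
Proof.
move=> dv HP; have [->|c0] := eqVneq c 0.
  rewrite scale0r; have [A EA] := phi_cone 0 A0.
  by rewrite -(HP A) EA scale0r.
have [P0|P0] := eqVneq (Psi v) 0; first by rewrite P0 scaler0 -P0 Psi_mem.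
suff ZP : Z (Psi v) by apply: (pcone_peval _ HP); apply: pcone_is_cone.
by split=> // Q HQ; apply: Psi_mem.
Qed.

Let tangent_onto (v : V) : exists2 u, tangent_cone Z w u & pi u = v.
Proof.
pose l t : V := v0 + t *: v.
have H i : {Nh : nat * (V -> K) | polyfn Nh.2 /\
    forall v, delta v != 0 -> delta v ^+ Nh.1 * wcoord (Psi v) i = Nh.2 v}.
  by apply: cid; case: (Psi_rat (wcoord_lform i)) => M [k Hk]; exists (M, k).
pose N := (\sum_i (sval (H i)).1).+1.
have lpoly p : polyfn p -> is_poly (fun t => p (l t)) by apply: polyfn_line.
have HR := is_poly_ring K.
pose r t := (delta v0)^-1 ^+ N * delta (l t) ^+ N.
have rpoly : is_poly r.
  by apply: (rp_mul HR); [apply: (rp_cst HR) | apply: (rp_exp HR); apply: lpoly].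
pose c t := r t *: Psi (l t).
have [u Hu] : exists u, velocity c u.
  apply: velocity_exists => i; have [Ph Eh] := svalP (H i).
  move: Ph Eh; set Mh := sval (H i) => Ph Eh.
  have leN : (Mh.1 < N)%N by rewrite /N ltnS (bigD1 i) //= leq_addr.
  rewrite (_ : (fun t => _) = fun t => (delta v0)^-1 ^+ N *
     (delta (l t) ^+ (N - Mh.1) * Mh.2 (l t))).
    apply: (rp_mul HR); first exact: (rp_cst HR).
    apply: (rp_mul HR); last exact: lpoly.
    by apply: (rp_exp HR); apply: lpoly.
  apply: funext => t; rewrite /c wcoordZ /r -mulrA; congr (_ * _).
  have [dl|dl] := eqVneq (delta (l t)) 0.
    by rewrite dl !expr0n /= subn_eq0 leqNgt leN !mul0r.
  by rewrite -Eh // mulrA -exprD subnK // ltnW.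
have l0 : l 0 = v0 by rewrite /l scale0r addr0.
have c0 : c 0 = w by rewrite /c /r l0 -exprMn mulVf // expr1n scale1r.
have Tu : tangent_cone Z w u.
  apply/(tangent_pcone phi_cone phi_neq0) => P HP; rewrite -c0.
  apply: (pdiff_velocity0 Hu) => t; rewrite /c.
  have [dl|dl] := eqVneq (delta (l t)) 0; last exact: Psi_scale.
  rewrite /r dl expr0n /= mulr0 scale0r -(scale0r (Psi v0)); exact: Psi_scale.
have [rq Hrq] := rpoly.
have piu : pi u = v + rq^`().[0] *: v0.
  apply/ffunP => i; have [q Hq ->] := Hu _ (pi_lin i).
  have -> : q = rq * ((v0 i)%:P + (v i)%:P * 'X).
    apply: horner_ext => t; rewrite -Hq hornerM hornerD hornerM !hornerC hornerX.
    rewrite -Hrq /c (lformZ (pi_lin i)).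
    have [dl|dl] := eqVneq (delta (l t)) 0.
      by rewrite /r dl expr0n /= mulr0 !mul0r.
    by rewrite piPsi // /l !ffunE; congr (_ * (_ + _)); apply: mulrC.
  rewrite derivM derivD derivM !derivC derivX mul0r !add0r mulr1.
  rewrite hornerD !hornerM hornerD hornerM !hornerC hornerX mulr0 addr0 -Hrq.
  by rewrite /r l0 -exprMn mulVf // expr1n mul1r !ffunE addrC.
exists (- rq^`().[0] *: w + u).
  by apply: tangent_lin => //; apply: tangent_self.
apply/ffunP => i; rewrite (pi_lin i) piu !ffunE /=.
by rewrite -/v0 mulNr addrCA addNr addr0.
Qed.

Let tangent_dim : subspace_dim (tangent_cone Z w) #|I|.
Proof.
pose e (i : I) : V := [ffun j => (i == j)%:R].
have Hs i : {u | tangent_cone Z w u /\ pi u = e i}.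
  by apply: cid; case: (tangent_onto (e i)) => u ? ?; exists u.
pose X := [tuple sval (Hs (enum_val i)) | i < #|I|].
have XE (i : 'I_#|I|) : X`_i = sval (Hs (enum_val i)).
  by rewrite -(tnth_nth 0 X i) tnth_mktuple.
have coordX (k : 'I_#|I| -> K) j :
    pi (\sum_i k i *: X`_i) j = k (enum_rank j).
  rewrite (lform_sum (pi_lin j)) (bigD1 (enum_rank j)) //= big1 ?addr0.
    rewrite (lformZ (pi_lin j)) XE.
    by case: (Hs _) => u [_ /= ->]; rewrite ffunE enum_rankK eqxx mulr1.
  move=> i ij; rewrite (lformZ (pi_lin j)) XE.
  case: (Hs _) => u [_ /= ->]; rewrite ffunE.
  case: eqP => [E|_]; last by rewrite mulr0.
  by rewrite -E enum_valK eqxx in ij.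
have freeX : free X.
  apply/freeP => k Hk j; rewrite -[j]enum_valK -coordX Hk.
  exact: (lform0 (pi_lin _)).
have TX (k : 'I_#|I| -> K) : tangent_cone Z w (\sum_i k i *: X`_i).
  elim/big_ind: _ => [|u v|i _].
  - by move=> P _; rewrite (lform0 (pdiff_lform P w)).
  - by rewrite -[u in u + v]scale1r; apply: tangent_lin.
  - rewrite XE; case: (Hs _) => u [Tu _] /=.
    rewrite -[X in tangent_cone _ _ X]addr0; apply: tangent_lin => // P _.
    by rewrite (lform0 (pdiff_lform P w)).
exists <<X>>%VS; split; last by rewrite (eqnP freeX) size_tuple.
move=> u; split=> [Xu|Tu]; first by rewrite (coord_span Xu).
have -> : u = \sum_(i < #|I|) pi u (enum_val i) *: X`_i.
  apply/eqP; rewrite -subr_eq0; apply/eqP; apply: tangent_ker.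
    by rewrite -scaleN1r addrC; apply: tangent_lin.
  apply/ffunP => j; rewrite (lformB (pi_lin j)) coordX enum_rankK subrr.
  by rewrite ffunE.
apply: rpred_sum => i _; apply: rpredZ; apply: memv_span.
by apply: mem_nth; rewrite size_tuple.
Qed.

Let v0_neq0 : exists i0, v0 i0 != 0.
Proof.
apply: contrapT => H; have [w0 _] := Zw; move/eqP: w0; apply.
apply: tangent_ker; first exact: tangent_self.
apply/ffunP => i; rewrite ffunE; apply: contrapT => /eqP vi.
by apply: H; exists i.
Qed.

Let chain : exists Y, irr_chain Z w #|I|.-1 Y.
Proof.
have [i0 vi0] := v0_neq0; pose s := enum (predC1 i0).
have sizes : size s = #|I|.-1 by rewrite -cardE cardC1.
pose L k : set V := [set v | forall i, i \notin take k s ->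
  v i * v0 i0 = v i0 * v0 i].
have L0 k : L k v0 by move=> i _; rewrite mulrC.
have Lline k v v' t : L k v -> L k v' -> L k (v + t *: (v' - v)).
  move=> Hv Hv' i Hi; rewrite !ffunE /= mulrDl [RHS]mulrDl -!mulrA.
  by rewrite !mulrBl (Hv i Hi) (Hv' i Hi).
pose G k : set W := [set x | exists v, [/\ L k v, delta v != 0 & x = Psi v]].
have Psi0 v : delta v != 0 -> Psi v != 0.
  move=> dv; have := dv; apply: contraNneq => P0; rewrite -(piPsi dv) P0.
  suff -> : pi 0 = 0 by rewrite delta0.
  by apply/ffunP => i; rewrite (lform0 (pi_lin i)) ffunE.
have GZ k : G k `<=` Z.
  by move=> x [v [_ dv ->]]; split; [exact: Psi0 | move=> P; apply: Psi_mem].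
pose Y k := zclosure (G k).
have Yw k : Y k w.
  apply: sub_zclosure; last by case: Zw.
  by exists v0; split=> //; rewrite Psi_v0.
have outside k B : zclosed B -> ~ (Y k `<=` B) ->
    exists P v, [/\ forall x, B x -> peval P x = 0, L k v, delta v != 0
                  & peval P (Psi v) != 0].
  move=> [J [HJ EB]] nYB; apply: contrapT => H; apply: nYB => y [y0 Hy].
  rewrite EB; split=> // P JP; apply: Hy; split; first exact: HJ.
  move=> x [v [Lv dv ->]]; apply: contrapT => /eqP Px; apply: H.
  by exists P, v; split=> // z; rewrite EB => -[_]; apply.
have Yirr k : zirreducible (Y k).
  split; [exact: zclosed_zclosure | by exists w | move=> B C cB cC YBC].
  apply: contrapT => /not_orP[nB nC].
  have [P [v1 [BP Lv1 dv1 Pv1]]] := outside k B cB nB.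
  have [Q [v2 [CQ Lv2 dv2 Qv2]]] := outside k C cC nC.
  have rat R : ratfn delta (fun v => peval R (Psi v)).
    exact: (rp_comp (ratfn_ring delta_poly) Psi_rat (peval_polyfn R)).
  have [N1 [h1 [Ph1 Hh1]]] := rat P; have [N2 [h2 [Ph2 Hh2]]] := rat Q.
  pose l t := v1 + t *: (v2 - v1).
  have lpoly p : polyfn p -> is_poly (fun t => p (l t)) by apply: polyfn_line.
  have l0 : l 0 = v1 by rewrite /l scale0r addr0.
  have l1 : l 1 = v2 by rewrite /l scale1r addrC subrK.
  have [||t Ht] := is_poly_mul_neq0 (t0 := 0) (t1 := 1) (lpoly _ Ph1) (lpoly _ Ph2).
  - by rewrite l0 -Hh1 // mulf_neq0 // expf_neq0.
  - by rewrite l1 -Hh2 // mulf_neq0 // expf_neq0.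
  have [|t' Ht'] := is_poly_mul_neq0 (t1 := 0)
      (rp_mul (is_poly_ring K) (lpoly _ Ph1) (lpoly _ Ph2)) (lpoly _ delta_poly) Ht.
    by rewrite l0.
  move: Ht'; rewrite !mulf_eq0 !negb_or => /andP[/andP[h1t h2t] dt].
  have Pt : peval P (Psi (l t')) != 0.
    by apply: contraNneq h1t => P0; rewrite -Hh1 // P0 mulr0.
  have Qt : peval Q (Psi (l t')) != 0.
    by apply: contraNneq h2t => P0; rewrite -Hh2 // P0 mulr0.
  have Yt : Y k (Psi (l t')).
    apply: sub_zclosure; last exact: Psi0.
    by exists (l t'); split=> //; apply: Lline.
  by case: (YBC _ Yt) => [/BP|/CQ] R0; [rewrite R0 eqxx in Pt | rewrite R0 eqxx in Qt].
exists Y; split=> k kI.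
  split=> //; apply: zclosure_sub; [exact: GZ | exact: zclosed_pcone].
split.
  move=> x [x0 Hx]; split=> // P [hP HP]; apply: Hx; split=> // y.
  move=> [v [Lv dv ->]]; apply: HP; exists v; split=> // i Hi; apply: Lv.
  apply: contraNN Hi; rewrite -(@take_takel _ k k.+1 s) //.
  exact: mem_take.
have ks : (k < size s)%N by rewrite sizes.
pose i := nth i0 s k.
have i_s : i \in s by apply: mem_nth.
have ii0 : i != i0 by move: i_s; rewrite mem_enum.
have i_k : i \notin take k s.
  have := enum_uniq (predC1 i0); rewrite -/s -{1}(cat_take_drop k s) cat_uniq.
  move=> /and3P[_ /hasPn H _]; apply/negP => ik.
  by have := H i; rewrite ik; case/(_ _)/negP; rewrite // (drop_nth i0) // inE eqxx.
pose e : V := [ffun j => (i == j)%:R].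
have [t Ht] : exists t, t * delta (v0 + t *: e) != 0.
  have := is_poly_mul_neq0 (t0 := 1) (t1 := 0) (is_poly_id K)
    (polyfn_line v0 e delta_poly).
  by rewrite scale0r addr0; apply; [exact: oner_neq0 | exact: dw].
move: Ht; rewrite mulf_eq0 negb_or => /andP[t0 dt].
set v := v0 + t *: e in dt.
have vE j : v j = v0 j + t * (i == j)%:R by rewrite !ffunE.
have Yv : Y k.+1 (Psi v).
  apply: sub_zclosure; last exact: Psi0.
  exists v; split=> // j; rewrite (take_nth i0) // mem_rcons inE negb_or -/i.
  move=> /andP[ji _]; rewrite !vE ![i == _]eq_sym (negbTE ji).
  by rewrite [i0 == i]eq_sym (negbTE ii0) !mulr0 !addr0 mulrC.
move=> /(_ _ Yv) [_ Hv].
have Hb : lform (fun x => pi x i * v0 i0 - pi x i0 * v0 i).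
  by move=> a x y; rewrite !pi_lin; ring.
have [P [hP EP]] := lform_homog Hb.
have := Hv P; rewrite EP piPsi // !vE eqxx (negbTE ii0) mulr0 addr0 mulr1.
rewrite mulrDl [v0 i * _]mulrC addrC addKr => H.
have /eqP : t * v0 i0 = 0.
  apply: H; split=> // x [v' [Lv' dv' ->]].
  by rewrite EP piPsi // (Lv' i i_k) subrr.
by rewrite mulf_eq0 (negbTE t0) (negbTE vi0).
Qed.

Lemma chart_smooth : smooth_at Z w.
Proof.
have I0 : (0 < #|I|)%N.
  by apply/card_gt0P; case: v0_neq0 => i _; exists i.
exists #|I|.-1; split; last by rewrite prednK.
split; first exact: chain.
move=> s [Y HY]; have := chain_length phi_poly HY.
by rewrite -cardI; case: (#|I|) I0.
Qed.

End Point.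
End Chart.

Section Derivations.
Variables (F : numFieldType) (n : nat).
Local Notation P := {mpoly F[n.+1]}.
Implicit Types (p q : P) (u v a : 'rV[F]_n.+1) (s : seq 'rV[F]_n.+1).

Lemma dual_act_is_linear v : linear (@dual_act F n v).
Proof.
move=> c p q; rewrite /dual_act scaler_sumr -big_split /=.
by apply: eq_bigr => i _; rewrite linearP scalerDr !scalerA mulrC.
Qed.

HB.instance Definition _ v :=
  GRing.isLinear.Build F P P _ (@dual_act F n v) (dual_act_is_linear v).

Lemma dual_actDl c u v p :
  dual_act (c *: u + v) p = c *: dual_act u p + dual_act v p.
Proof.
rewrite /dual_act scaler_sumr -big_split /=.
by apply: eq_bigr => i _; rewrite !mxE scalerDl scalerA.
Qed.

Lemma dual_actM v p q : dual_act v (p * q) = dual_act v p * q + p * dual_act v q.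
Proof.
rewrite /dual_act mulr_suml mulr_sumr -big_split /=; apply: eq_bigr => i _.
by rewrite mderivM scalerDr scalerAl scalerAr.
Qed.

Lemma dual_actC v c : dual_act v c%:MP = 0.
Proof. by rewrite /dual_act big1 // => i _; rewrite mderivC scaler0. Qed.

Lemma dual_act_comm u v p : dual_act u (dual_act v p) = dual_act v (dual_act u p).
Proof.
have E a b : dual_act a (dual_act b p) =
    \sum_i \sum_j (a 0 i * b 0 j) *: p^`M(j)^`M(i).
  apply: eq_bigr => i _; rewrite /dual_act (linear_sum (mderiv i)) scaler_sumr.
  by apply: eq_bigr => j _; rewrite /= mderivZ scalerA.
rewrite !E exchange_big; apply: eq_bigr => i _; apply: eq_bigr => j _.
by rewrite mulrC mderiv_comm.
Qed.

Lemma mderiv_homog k i p : p \is k.+1.-homog -> p^`M(i) \is k.-homog.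
Proof.
move=> /dhomogP Hp; apply/dhomogP => m; rewrite mcoeff_msupp mcoeff_deriv.
rewrite mulrn_eq0 /= -mcoeff_msupp => /Hp /=.
by rewrite mdegD mdeg1 addn1 => -[].
Qed.

Lemma dual_act_homog k v p : p \is k.+1.-homog -> dual_act v p \is k.-homog.
Proof.
move=> Hp; apply: rpred_sum => i _; apply: dhomogZ; exact: mderiv_homog.
Qed.

Lemma homog0_const p : p \is 0.-homog -> p = (p@_0%MM)%:MP.
Proof.
move=> /dhomogP Hp; apply/mpolyP => m; rewrite mcoeffC.
have [->|m0] := eqVneq m 0%MM; first by rewrite mulr1.
rewrite mulr0; apply: memN_msupp_eq0; apply/negP => /Hp /= /eqP.
by rewrite mdeg_eq0 (negbTE m0).
Qed.

Lemma mderiv_eq0 k p : p \is k.+1.-homog -> (forall i, p^`M(i) = 0) -> p = 0.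
Proof.
move=> /dhomogP Hp H; apply/mpolyP => m; rewrite mcoeff0.
have [mp|/memN_msupp_eq0 //] := boolP (m \in msupp p).
have /= mk := Hp m mp; have [i mi] : exists i, m i != 0%N.
  apply: contrapT => H0; have /eqP : mdeg m = 0%N.
    rewrite mdegE big1 // => i _; apply: contrapT => /eqP mi.
    by apply: H0; exists i.
  by rewrite mk.
have := congr1 (mcoeff (m - U_(i))%MM) (H i).
rewrite mcoeff_deriv mcoeff0 submK ?lep1mP // => /eqP.
by rewrite mulrn_eq0 /= => /eqP.
Qed.

(* Iterated derivatives. *)
Definition Ds s p : P := foldr (fun v q => dual_act v q) p s.

Lemma Ds_is_linear s : linear (Ds s).
Proof.
move=> c p q; elim: s => //= v s ->.
by rewrite -[in RHS]dual_act_is_linear.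
Qed.

HB.instance Definition _ s := GRing.isLinear.Build F P P _ (Ds s) (Ds_is_linear s).

Lemma Ds_dual_act s v p : Ds s (dual_act v p) = dual_act v (Ds s p).
Proof. by elim: s => //= u s ->; rewrite dual_act_comm. Qed.

Lemma Ds_cat s1 s2 p : Ds (s1 ++ s2) p = Ds s1 (Ds s2 p).
Proof. by rewrite /Ds foldr_cat. Qed.

Lemma Ds_perm s1 s2 p : perm_eq s1 s2 -> Ds s1 p = Ds s2 p.
Proof.
elim: s1 s2 p => [|v s1 IH] s2 p; first by rewrite perm_sym => /perm_nilP ->.
move=> H; have vs2 : v \in s2 by rewrite -(perm_mem H) mem_head.
move: H; case/splitPr: vs2 => r1 r2.
rewrite perm_sym -cat1s perm_catCA /= perm_cons perm_sym => /IH /= ->.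
by rewrite !Ds_cat /= Ds_dual_act.
Qed.

Lemma Ds_homog s p k : p \is (size s + k).-homog -> Ds s p \is k.-homog.
Proof.
elim: s k => [|v s IH] k //= Hp; apply: dual_act_homog; apply: IH.
by rewrite addnS.
Qed.

(* A form is determined by its derivatives along the words in a basis. *)
Lemma Ds_sep (u : 'M[F]_n.+1) k p : u \in unitmx -> p \is k.-homog ->
  (forall e : seq 'I_n.+1, size e = k -> (Ds [seq row i u | i <- e] p)@_0%MM = 0) ->
  p = 0.
Proof.
move=> uu; elim: k p => [|k IH] p Hp H.
  by rewrite (homog0_const Hp) (H [::]).
have Hu j : dual_act (row j u) p = 0.
  apply: IH => [|e ek]; first exact: dual_act_homog.
  by rewrite Ds_dual_act; apply: (H (j :: e)); rewrite /= ek.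
apply: (mderiv_eq0 Hp) => i.
have -> : p^`M(i) = dual_act (delta_mx 0 i) p.
  rewrite /dual_act (bigD1 i) //= big1 ?addr0 ?mxE ?eqxx ?scale1r //.
  by move=> j ji; rewrite !mxE eqxx (negbTE ji) scale0r.
rewrite -(mulmxKV uu (delta_mx 0 i)).
rewrite mulmx_sum_row; elim/big_ind: _ => [|a b Ha Hb|j _].
- by rewrite /dual_act big1 // => j _; rewrite mxE scale0r.
- by rewrite -[a]scale1r dual_actDl Ha Hb scaler0 addr0.
- rewrite -[X in dual_act X]addr0 dual_actDl Hu scaler0 add0r.
  by rewrite /dual_act big1 // => l _; rewrite mxE scale0r.
Qed.

Definition dot v a : F := \sum_i v 0 i * a 0 i.
Definition linf a : P := \sum_i a 0 i *: 'X_i.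

Lemma dual_act_linf v a : dual_act v (linf a) = (dot v a)%:MP.
Proof.
have E i : (linf a)^`M(i) = (a 0 i)%:MP.
  rewrite /linf raddf_sum (bigD1 i) //= big1 ?addr0.
    rewrite mderivZ mderivX mnm1E eqxx.
    have -> : (U_(i) - U_(i))%MM = 0%MM :> 'X_{1..n.+1}.
      by apply/mnmP => j; rewrite mnmBE subnn mnm0E.
    by rewrite mpolyX0 scale1r -alg_mpolyC.
  by move=> j ji; rewrite mderivZ mderivX mnm1E (negbTE ji) scale0r scaler0.
rewrite /dual_act (eq_bigr (fun i => (v 0 i * a 0 i)%:MP)) -?raddf_sum //.
by move=> i _; rewrite E -mul_mpolyC -mpolyCM.
Qed.

Lemma linf_homog a : linf a \is 1.-homog.
Proof.
by apply: rpred_sum => i _; apply: dhomogZ; rewrite dhomogX /= mdeg1.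
Qed.

Lemma linfP c u v : linf (c *: u + v) = c *: linf u + linf v.
Proof.
rewrite /linf scaler_sumr -big_split /=; apply: eq_bigr => i _.
by rewrite !mxE scalerDl scalerA.
Qed.

Lemma homog1_linf p : p \is 1.-homog -> p = linf (\row_i p@_U_(i)).
Proof.
move=> /dhomogP Hp; apply/mpolyP => m; rewrite /linf raddf_sum /=.
have [/mdeg1P[i /eqP ->]|m1] := boolP (mdeg m == 1%N).
  rewrite (bigD1 i) //= big1 ?addr0 => [|j ji]; rewrite mcoeffZ mxE mcoeffXU.
    by rewrite eqxx mulr1.
  by rewrite (negbTE ji) mulr0.
rewrite memN_msupp_eq0; last by apply: contraNN m1 => /Hp /= ->.
rewrite big1 // => i _; rewrite mcoeffZ mcoeffX.
case: eqP => [mE|_]; last by rewrite mulr0.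
by case/negP: m1; rewrite -mE mdeg1.
Qed.

End Derivations.

Section Polar.
Variables (F : numFieldType) (n d : nat).
Local Notation W := (Defs.form F n d).
Implicit Types (f g : W) (u v a : 'rV[F]_n.+1) (s : seq 'rV[F]_n.+1).

Lemma fact_neq0 : (d`!)%:R != 0 :> F.
Proof. by rewrite pnatr_eq0 -lt0n fact_gt0. Qed.

(* The polarization of f, a symmetric d-linear form. *)
Definition polar s f : F := (Ds s (mpoly_of_dhomog f))@_0%MM / (d`!)%:R.

Lemma polar_lform s : lform (polar s).
Proof.
move=> c f g; rewrite /polar.
rewrite (Ds_is_linear s c (mpoly_of_dhomog f) (mpoly_of_dhomog g)) mcoeffD mcoeffZ.
by rewrite mulrDl mulrA.
Qed.

Lemma polar_perm s1 s2 f : perm_eq s1 s2 -> polar s1 f = polar s2 f.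
Proof. by move=> H; rewrite /polar (Ds_perm _ H). Qed.

Lemma polarDl c u v s f :
  polar (c *: u + v :: s) f = c * polar (u :: s) f + polar (v :: s) f.
Proof.
by rewrite /polar /= dual_actDl mcoeffD mcoeffZ mulrDl mulrA.
Qed.

Lemma polar_suml s f (I : Type) (r : seq I) (p : pred I) (c : I -> F) (u : I -> 'rV_n.+1) :
  polar ((\sum_(i <- r | p i) c i *: u i) :: s) f
  = \sum_(i <- r | p i) c i * polar (u i :: s) f.
Proof.
elim: r => [|i r IH].
  rewrite !big_nil /polar /= [X in X@__]big1 ?mcoeff0 ?mul0r // => i _.
  by rewrite mxE scale0r.
by rewrite !big_cons; case: (p i); rewrite // polarDl IH.
Qed.

Lemma polar_dual_act0 v s f :
  dual_act v (mpoly_of_dhomog f) = 0 -> v \in s -> polar s f = 0.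
Proof.
move=> Hv vs; rewrite (polar_perm _ (perm_to_rem vs)) /polar /= -Ds_dual_act Hv.
by rewrite raddf0 mcoeff0 mul0r.
Qed.

Definition word (u : 'M[F]_n.+1) (e : seq 'I_n.+1) := [seq row i u | i <- e].

Lemma dhomog_eq0 f : mpoly_of_dhomog f = 0 -> f = 0.
Proof. by move=> H; apply: val_inj. Qed.

Lemma polar_sep (u : 'M[F]_n.+1) f : u \in unitmx ->
  (forall e, size e = d -> polar (word u e) f = 0) -> f = 0.
Proof.
move=> uu H; apply: dhomog_eq0; apply: (Ds_sep uu (dhomog_is_dhomog f)) => e ed.
have /eqP := H e ed; rewrite /polar mulf_eq0 invr_eq0 (negbTE fact_neq0) orbF.
by move/eqP.
Qed.

Lemma polar_ext (u : 'M[F]_n.+1) f g : u \in unitmx ->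
  (forall e, size e = d -> polar (word u e) f = polar (word u e) g) -> f = g.
Proof.
move=> uu H; apply/eqP; rewrite -subr_eq0; apply/eqP/(polar_sep uu) => e ed.
by rewrite (lformB (polar_lform _)) H // subrr.
Qed.

Lemma pow_homog a : linf a ^+ d \is d.-homog.
Proof. by have := dhomogMn d (linf_homog a); rewrite mul1n. Qed.
Definition pow a : W := DHomog (pow_homog a).

Lemma Ds_linf_exp k a s : size s = k ->
  Ds s (linf a ^+ k) = (k`!%:R * \prod_(v <- s) dot v a)%:MP.
Proof.
elim: s k => [|v s IH] k <- /=.
  by rewrite expr0 fact0 big_nil mulr1 mpolyC1.
rewrite -Ds_dual_act.
have -> : dual_act v (linf a ^+ (size s).+1)
        = ((size s).+1%:R * dot v a) *: linf a ^+ size s.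
  elim: (size s) => [|e IHk].
    by rewrite expr1 expr0 dual_act_linf mul1r -mul_mpolyC mulr1.
  rewrite exprS dual_actM IHk dual_act_linf mul_mpolyC -scalerAr -exprS.
  by rewrite -scalerDl; congr (_ *: _); rewrite [e.+2%:R]mulrS; ring.
rewrite linearZ /= IH // -mul_mpolyC -mpolyCM; congr (_%:MP).
by rewrite big_cons factS natrM; ring.
Qed.

Lemma polar_pow a s : size s = d -> polar s (pow a) = \prod_(v <- s) dot v a.
Proof.
move=> sd; rewrite /polar /= (Ds_linf_exp a sd) mcoeffC eqxx mulr1.
by rewrite mulrC mulKf // fact_neq0.
Qed.

End Polar.

Section MatrixForm.
Variables (F : numFieldType) (n d k : nat).
Local Notation P := {mpoly F[n.+1]}.
Local Notation W := (Defs.form F n d).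
Variables (rho : 'rV[F]_k.+1) (kappa : 'cV[F]_k.+1) (M : 'I_n.+1 -> 'M[F]_k.+1).

Definition genmx : 'M[P]_k.+1 :=
  \matrix_(i, j) linf (\row_l M l i j).

Definition matval (v : 'rV[F]_n.+1) : 'M[F]_k.+1 := \sum_l v 0 l *: M l.

Let Cmx m m' (A : 'M[F]_(m, m')) : 'M[P]_(m, m') := map_mx (@mpolyC n.+1 F) A.

Definition mformp e : P := (Cmx rho *m genmx ^+ e *m Cmx kappa) 0 0.

Lemma genmx_homog e i j : (genmx ^+ e) i j \is e.-homog.
Proof.
elim: e i j => [|e IH] i j.
  by rewrite expr0 mxE; case: eqP => _; rewrite ?rpred0 ?dhomog1.
rewrite exprS mxE; apply: rpred_sum => l _.
have h1 : genmx i l \is 1.-homog by rewrite mxE linf_homog.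
exact: (dhomogM h1 (IH l j)).
Qed.

Lemma mform_homog : mformp d \is d.-homog.
Proof.
rewrite /mformp mxE; apply: rpred_sum => i _.
rewrite [X in _ * X]mxE mulrC mul_mpolyC; apply: dhomogZ.
rewrite mxE; apply: rpred_sum => j _; rewrite mxE mul_mpolyC.
by apply: dhomogZ; apply: genmx_homog.
Qed.

(* The form rho (x_0 M_0 + ... + x_n M_n)^d kappa. *)
Definition mform : W := DHomog mform_homog.

Hypothesis Mcomm : forall i j, M i * M j = M j * M i.

Let Dmx v m m' (A : 'M[P]_(m, m')) : 'M[P]_(m, m') :=
  map_mx (@dual_act F n v) A.

Let Dmx_mul v m m' m'' (A : 'M[P]_(m, m')) (B : 'M[P]_(m', m'')) :
  Dmx v (A *m B) = Dmx v A *m B + A *m Dmx v B.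
Proof.
apply/matrixP => i j; rewrite !mxE raddf_sum -big_split /=.
by apply: eq_bigr => l _; rewrite dual_actM !mxE.
Qed.

Let DmxC v m m' (A : 'M[F]_(m, m')) : Dmx v (Cmx A) = 0.
Proof. by apply/matrixP => i j; rewrite !mxE dual_actC. Qed.

Let Dmx_genmx v : Dmx v genmx = Cmx (matval v).
Proof.
apply/matrixP => i j; rewrite !mxE dual_act_linf; congr (_%:MP).
by rewrite summxE; apply: eq_bigr => l _; rewrite !mxE.
Qed.

Let genmx_comm v : genmx * Cmx (matval v) = Cmx (matval v) * genmx.
Proof.
have E : genmx = \sum_l ('X_l)%:M *m Cmx (M l).
  apply/matrixP => i j; rewrite mxE summxE; apply: eq_bigr => l _.
  by rewrite mul_scalar_mx !mxE mulrC mul_mpolyC.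
rewrite E mulr_suml mulr_sumr; apply: eq_bigr => l _.
rewrite -!mulmxE -mulmxA [RHS]mulmxA [X in _ = X *m _]scalar_mxC -[RHS]mulmxA.
congr (_ *m _).
rewrite -!map_mxM /=; congr (map_mx _ _).
rewrite /matval mulmx_sumr mulmx_suml; apply: eq_bigr => j _.
by rewrite -scalemxAl -scalemxAr !mulmxE Mcomm.
Qed.

Let Dmx_exp v e : Dmx v (genmx ^+ e.+1) = (e.+1)%:R *: (Cmx (matval v) * genmx ^+ e).
Proof.
elim: e => [|e IH]; first by rewrite expr1 expr0 mulr1 scale1r Dmx_genmx.
rewrite exprS -mulmxE Dmx_mul IH Dmx_genmx mulmxE.
rewrite -scalerAr mulrA genmx_comm -mulrA -exprS.
by rewrite [e.+2%:R]mulrS scalerDl scale1r.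
Qed.

Let Dsmx s m m' (A : 'M[P]_(m, m')) : 'M[P]_(m, m') := map_mx (Ds s) A.

Let Ds_mx s e N : size s = e -> Dsmx s (Cmx N * genmx ^+ e) =
  Cmx ((e`!)%:R *: (N * \prod_(v <- s) matval v)).
Proof.
elim: s e N => [|v s IH] e N <- /=.
  rewrite expr0 mulr1 big_nil mulr1 fact0 scale1r.
  by apply/matrixP => i j; rewrite !mxE.
have -> : Dsmx (v :: s) (Cmx N * genmx ^+ (size s).+1)
        = Dsmx s (Dmx v (Cmx N * genmx ^+ (size s).+1)).
  by apply/matrixP => i j; rewrite !mxE /= Ds_dual_act.
rewrite -mulmxE Dmx_mul DmxC mul0mx add0r Dmx_exp -scalemxAr mulmxE mulrA.
have -> : Cmx N * Cmx (matval v) = Cmx (N * matval v) by rewrite /Cmx -!mulmxE map_mxM.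
have -> (A : 'M[P]_k.+1) : Dsmx s (((size s).+1)%:R *: A) = ((size s).+1)%:R *: Dsmx s A.
  apply/matrixP => i j; rewrite !mxE -mpolyC_nat !mul_mpolyC.
  by rewrite linearZ.
rewrite IH // big_cons mulrA -mpolyC_nat.
by apply/matrixP => i j; rewrite !mxE -mpolyCM factS natrM mulrA.
Qed.

Lemma polar_mform s : size s = d ->
  polar s mform = (rho *m (\prod_(v <- s) matval v) *m kappa) 0 0.
Proof.
move=> sd; rewrite /polar /= /mformp.
have -> : Ds s ((Cmx rho *m genmx ^+ d *m Cmx kappa) 0 0)
  = (Cmx rho *m Dsmx s (genmx ^+ d) *m Cmx kappa) 0 0.
  rewrite !mxE (linear_sum (Ds s)); apply: eq_bigr => j _; rewrite !mxE mulrC mul_mpolyC.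
  rewrite linearZ /= -mul_mpolyC mulrC; congr (_ * _).
  rewrite (linear_sum (Ds s)); apply: eq_bigr => i _; rewrite !mxE !mul_mpolyC.
  by rewrite linearZ.
have := Ds_mx 1 sd; rewrite mul1r.
have -> : Cmx 1 = 1 :> 'M[P]_k.+1 by rewrite -[1]/(1%:M) [LHS]map_scalar_mx.
rewrite mul1r => ->.
rewrite -!map_mxM mxE mcoeffC eqxx mulr1 -scalemxAr -scalemxAl mxE.
by rewrite mulrC mulKf // fact_neq0.
Qed.

End MatrixForm.

Section PowerSums.
Variables (F : numClosedFieldType) (n d : nat).
Hypothesis d_gt0 : (0 < d)%N.
Local Notation W := (Defs.form F n d).
Implicit Types (f : W) (a v : 'rV[F]_n.+1) (s : seq 'rV[F]_n.+1) (e : seq 'I_n.+1).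

Definition powsum k (A : 'M[F]_(k, n.+1)) : W := \sum_i pow d (row i A).

Lemma polar_powsum k (A : 'M[F]_(k, n.+1)) s : size s = d ->
  polar s (powsum A) = \sum_i \prod_(v <- s) dot v (row i A).
Proof.
move=> sd; rewrite /powsum (lform_sum (polar_lform s)).
by apply: eq_bigr => i _; rewrite polar_pow.
Qed.

(* Coordinates on forms: the polarization along words in a basis. *)
Definition tup_polar (u : 'M[F]_n.+1) (e : d.-tuple 'I_n.+1) : W -> F :=
  polar (word u e).

Lemma tup_polar_sep u : u \in unitmx ->
  forall f, (forall e : d.-tuple _, tup_polar u e f = 0) -> f = 0.
Proof.
move=> uu f H; apply: (polar_sep uu) => e /eqP ed; exact: (H (Tuple ed)).
Qed.

Lemma size_word (u : 'M[F]_n.+1) e : size (word u e) = size e.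
Proof. exact: size_map. Qed.

Lemma rp_polar (X : Type) (S : (X -> F) -> Prop) (Psi : X -> W) u :
  u \in unitmx -> ringpred S ->
  (forall e, size e = d -> S (fun x => polar (word u e) (Psi x))) ->
  forall b, lform b -> S (fun x => b (Psi x)).
Proof.
move=> uu HS H; apply: (@rp_separating _ _ _ (tup_polar u)) => //.
- by move=> e; apply: polar_lform.
- exact: tup_polar_sep.
- by move=> e; apply: H; rewrite size_tuple.
Qed.

Lemma powsum_poly k b : lform b -> polyfn (fun A : 'M[F]_(k, n.+1) => b (powsum A)).
Proof.
apply: (rp_polar (unitmx1 _ _)); first exact: polyfn_ring.
move=> e ed; have HR := polyfn_ring ('M[F]_(k, n.+1)).
rewrite (_ : (fun A => _) = fun A : 'M[F]_(k, n.+1) =>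
    \sum_i \prod_(v <- word 1%:M e) dot v (row i A)); last first.
  by apply: funext => A; rewrite polar_powsum ?size_word.
apply: (rp_sum HR) => i _; apply: (rp_prod HR) => v _; apply: polyfn_lin.
move=> c A B; rewrite /dot mulr_sumr -big_split; apply: eq_bigr => j _ /=.
by rewrite !mxE; ring.
Qed.

Lemma powZ c a : pow d (c *: a) = c ^+ d *: pow d a.
Proof.
apply: val_inj => /=; rewrite -[c *: a]addr0 linfP.
by rewrite /linf [X in _ + X]big1 ?addr0 ?exprZn // => i _; rewrite mxE scale0r.
Qed.

Lemma pow0 : pow d (0 : 'rV[F]_n.+1) = 0.
Proof. by rewrite -(scale0r 0) powZ expr0n eqn0Ngt d_gt0 scale0r. Qed.

(* Over an algebraically closed field coefficients are absorbed by the powers. *)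
Lemma powsum_coef k (c : 'I_k -> F) (a : 'I_k -> 'rV[F]_n.+1) :
  exists A : 'M_(k, n.+1), powsum A = \sum_i c i *: pow d (a i).
Proof.
exists (\matrix_i (d.-root (c i) *: a i)); apply: eq_bigr => i _.
by rewrite rowK powZ rootCK.
Qed.

Lemma powsum_cone k c (A : 'M[F]_(k, n.+1)) :
  exists A' : 'M_(k, n.+1), powsum A' = c *: powsum A.
Proof.
have [A' EA] := powsum_coef (fun=> c) (fun i => row i A).
by exists A'; rewrite EA /powsum scaler_sumr.
Qed.

Lemma powsum_neq0 k : exists A : 'M[F]_(k.+1, n.+1), powsum A != 0.
Proof.
pose e0 : 'rV[F]_n.+1 := delta_mx 0 0.
have [A EA] := powsum_coef (fun i : 'I_k.+1 => (i == 0)%:R) (fun=> e0).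
exists A; rewrite EA (bigD1 0) //= scale1r big1 => [|i /negbTE ->]; last first.
  by rewrite scale0r.
rewrite addr0; apply/eqP => H.
have := polar_pow e0 (size_nseq d e0); rewrite H (lform0 (polar_lform _)).
have dot1 : dot e0 e0 = 1.
  rewrite /dot (bigD1 0) //= big1 ?mxE ?eqxx ?mulr1 ?addr0 // => i i0.
  by rewrite !mxE (negbTE i0) andbF mul0r.
rewrite big1_seq => [/eqP|v /andP [_ /nseqP[-> _]] //].
by rewrite eq_sym oner_eq0.
Qed.

(* The vector of V with prescribed values on a basis u of the dual space. *)
Definition dual_vec (u : 'M[F]_n.+1) (x : 'rV[F]_n.+1) : 'rV[F]_n.+1 :=
  x *m (invmx u)^T.

Lemma dot_mx v a : dot v a = (v *m a^T) 0 0.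
Proof. by rewrite mxE; apply: eq_bigr => i _; rewrite !mxE. Qed.

Lemma dot_dual_vec u x j : u \in unitmx -> dot (row j u) (dual_vec u x) = x 0 j.
Proof.
move=> uu; rewrite dot_mx /dual_vec trmx_mul trmxK mulmxA -row_mul.
by rewrite mulmxV // row1 -rowE !mxE.
Qed.

Lemma powsum_prescribed k u (c : 'I_k -> F) (x : 'I_k -> 'I_n.+1 -> F) :
  u \in unitmx -> exists A : 'M_(k, n.+1), forall e, size e = d ->
    polar (word u e) (powsum A) = \sum_i c i * \prod_(j <- e) x i j.
Proof.
move=> uu; have [A EA] := powsum_coef c (fun i => dual_vec u (\row_j x i j)).
exists A => e ed; rewrite EA (lform_sum (polar_lform _)).
apply: eq_bigr => i _; rewrite (lformZ (polar_lform _)) polar_pow ?size_word //.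
congr (_ * _); rewrite big_map; apply: eq_bigr => j _.
by rewrite dot_dual_vec // mxE.
Qed.

Lemma veroneseP f : veronese F n d f <->
  exists c a, [/\ a != 0, c != 0 & f = c *: pow d a].
Proof.
split=> [[l [c [l0 c0 E]]]|[c [a [a0 c0 ->]]]].
  exists c, (\row_i (mpoly_of_dhomog l)@_U_(i)).
  have El := homog1_linf (dhomog_is_dhomog l).
  split=> //; last by apply: val_inj; rewrite /= -El.
  apply: contraNneq l0 => H; apply/eqP/val_inj; rewrite /= El H.
  by rewrite /linf big1 // => i _; rewrite mxE scale0r.
exists (DHomog (linf_homog a)), c; split=> //.
apply: contraNneq a0 => /(congr1 val) /= H; apply/eqP/rowP => i.
have := congr1 (mcoeff U_(i)%MM) H; rewrite mcoeff0 /linf raddf_sum /= mxE.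
rewrite (bigD1 i) //= big1 ?addr0 => [|j ji]; rewrite mcoeffZ mcoeffXU.
  by rewrite eqxx mulr1.
by rewrite (negbTE ji) mulr0.
Qed.

Lemma secant_powsum k : secant k.+1 (veronese F n d) = pcone (@powsum k.+1).
Proof.
have cone := @powsum_cone k.+1; have nz := powsum_neq0 k.
apply/seteqP; split.
  apply: zclosure_sub; last exact: zclosed_pcone.
  move=> w [w0 [xs [Hxs /coord_span Ew]]]; split=> // P HP.
  have H i : {ca : F * 'rV[F]_n.+1 | tnth xs i = ca.1 *: pow d ca.2}.
    by apply: cid; have /veroneseP[c [a [_ _ ->]]] := Hxs i; exists (c, a).
  have [A EA] := powsum_coef
    (fun i => coord xs i w * (sval (H i)).1) (fun i => (sval (H i)).2).
  rewrite Ew (eq_bigr (fun i => (coord xs i w * (sval (H i)).1)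
     *: pow d (sval (H i)).2)) -?EA // => i _.
  by rewrite -(tnth_nth 0 xs i) -scalerA; congr (_ *: _); case: (H i).
move=> w [w0 Hw]; split=> // P [hP HP]; apply: Hw.
apply: (vanish_neq0 cone nz) => A A0; apply: HP; split=> //.
pose b (i : 'I_k.+1) : 'rV[F]_n.+1 := if row i A == 0 then delta_mx 0 0 else row i A.
exists [tuple pow d (b i) | i < k.+1]; split=> [i|].
  rewrite tnth_mktuple; apply/veroneseP; exists 1, (b i).
  rewrite scale1r oner_neq0; split=> //; rewrite /b; case: ifP => [_|/negbT //].
  by apply/eqP => /rowP/(_ 0)/eqP; rewrite !mxE oner_eq0.
apply: rpred_sum => i _.
have [Ai|/negbTE Ai] := eqVneq (row i A) 0; first by rewrite Ai pow0 rpred0.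
by apply: memv_span; apply/mapP; exists i; rewrite ?mem_enum // /b Ai.
Qed.

Lemma pcone_powsumS k : pcone (@powsum k) `<=` pcone (@powsum k.+1).
Proof.
move=> w [w0 Hw]; split=> // P HP; apply: Hw => A.
have [B EB] := powsum_coef (fun i => if unlift ord_max i is Some _ then 1 else 0)
   (fun i : 'I_k.+1 => if unlift ord_max i is Some j then row j A else 0).
suff -> : powsum A = powsum B by apply: HP.
rewrite EB big_ord_recr /= unlift_none scale0r addr0; apply: eq_bigr => i _.
have -> : widen_ord (leqnSn k) i = lift ord_max i.
  by apply: val_inj; rewrite /= /bump leqNgt ltn_ord.
by rewrite liftK scale1r.
Qed.

End PowerSums.

Section Theta.
Variables (F : numClosedFieldType) (n d k : nat).
Hypothesis d_gt0 : (0 < d)%N.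
Local Notation W := (Defs.form F n d).
Variable u : 'M[F]_n.+1.
Hypothesis uu : u \in unitmx.
Implicit Types (N : 'M[F]_k.+1) (a : 'I_n.+1 -> 'I_k.+1 -> F).

(* An element of the algebra generated by N. *)
Definition alg_elt N (c : 'I_k.+1 -> F) : 'M[F]_k.+1 := \sum_l c l *: N ^+ l.

Lemma alg_elt_comm N c c' : alg_elt N c * alg_elt N c' = alg_elt N c' * alg_elt N c.
Proof.
apply: commr_sum => i _; apply: commr_sym; apply: commr_sum => j _.
rewrite /GRing.comm -!scalerAl -!scalerAr !scalerA mulrC -!exprD addnC.
by rewrite [X in X *: _]mulrC.
Qed.

(* The form rho (sum_j x_j a_j(N))^d kappa, the x_j being dual to the rows of u. *)
Definition alg_form (rho : 'rV[F]_k.+1) (kappa : 'cV[F]_k.+1) N a : W :=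
  mform d rho kappa (fun i => \sum_j invmx u i j *: alg_elt N (a j)).

Lemma polar_alg_form rho kappa N a e : size e = d ->
  polar (word u e) (alg_form rho kappa N a)
  = (rho *m (\prod_(j <- e) alg_elt N (a j)) *m kappa) 0 0.
Proof.
move=> ed; rewrite polar_mform ?size_word //.
  rewrite big_map; congr ((_ *m _ *m _) 0 0); apply: eq_bigr => j _.
  rewrite /matval (eq_bigr (fun l => \sum_i (u j l * invmx u l i) *: alg_elt N (a i))).
    rewrite exchange_big (eq_bigr (fun i => (j == i)%:R *: alg_elt N (a i))) /=.
      rewrite (bigD1 j) //= eqxx scale1r big1 ?addr0 // => i /negbTE.
      by rewrite eq_sym => ->; rewrite scale0r.
    move=> i _; rewrite -scaler_suml (_ : \sum_l _ = (u *m invmx u) j i).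
      by rewrite mulmxV // mxE.
    by rewrite mxE.
  by move=> l _; rewrite mxE scaler_sumr; apply: eq_bigr => i _; rewrite scalerA.
move=> i j; rewrite -!/(GRing.comm _ _).
apply: commr_sum => l _; apply: commr_sym; apply: commr_sum => m _.
by rewrite /GRing.comm -!scalerAl -!scalerAr alg_elt_comm !scalerA mulrC.
Qed.

Lemma alg_elt_diag (V : 'M[F]_k.+1) N (mu : 'rV[F]_k.+1) c :
  V *m N = diag_mx mu *m V ->
  V *m alg_elt N c = diag_mx (\row_i \sum_l c l * mu 0 i ^+ l) *m V.
Proof.
move=> VN.
have VNl l : V *m N ^+ l = diag_mx (\row_i mu 0 i ^+ l) *m V.
  elim: l => [|l IH].
    rewrite expr0 mulmx1 (_ : \row_i _ = const_mx 1) ?diag_const_mx ?mul1mx //.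
    by apply/rowP => i; rewrite !mxE expr0.
  rewrite exprS -mulmxE mulmxA VN -mulmxA IH mulmxA mulmx_diag; congr (diag_mx _ *m _).
  by apply/rowP => i; rewrite !mxE exprS.
rewrite /alg_elt mulmx_sumr (eq_bigr (fun l => c l *: (diag_mx (\row_i mu 0 i ^+ l) *m V))).
  apply/matrixP => i j; rewrite summxE mul_diag_mx !mxE mulr_suml.
  by apply: eq_bigr => l _; rewrite mul_diag_mx !mxE mulrA.
by move=> l _; rewrite -scalemxAr VNl.
Qed.

(* When N is diagonalized by V, the algebra form is a sum of powers. *)
Lemma polar_alg_form_diag (V : 'M[F]_k.+1) N (mu : 'rV[F]_k.+1) rho kappa a e :
  V \in unitmx -> V *m N = diag_mx mu *m V -> size e = d ->
  polar (word u e) (alg_form rho kappa N a)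
  = \sum_i ((rho *m invmx V) 0 i * (V *m kappa) i 0) *
      \prod_(j <- e) \sum_l a j l * mu 0 i ^+ l.
Proof.
move=> Vu VN ed; rewrite polar_alg_form //.
have E s : V *m \prod_(j <- s) alg_elt N (a j)
   = diag_mx (\row_i \prod_(j <- s) \sum_l a j l * mu 0 i ^+ l) *m V.
  elim: s => [|j s IH].
    rewrite big_nil mulmx1 (_ : \row_i _ = const_mx 1) ?diag_const_mx ?mul1mx //.
    by apply/rowP => i; rewrite !mxE big_nil.
  rewrite big_cons -mulmxE mulmxA (alg_elt_diag _ VN) -mulmxA IH mulmxA mulmx_diag.
  by congr (diag_mx _ *m _); apply/rowP => i; rewrite !mxE big_cons.
rewrite -(mulKmx Vu (\prod_(j <- e) _)) E -!mulmxA mulmxA mxE.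
apply: eq_bigr => i _; rewrite mul_diag_mx !mxE; ring.
Qed.

Lemma rp_alg_form (X : Type) (S : (X -> F) -> Prop) (rho : X -> 'rV[F]_k.+1)
    (kappa : X -> 'cV[F]_k.+1) (N : X -> 'M[F]_k.+1)
    (a : X -> 'I_n.+1 -> 'I_k.+1 -> F) :
  ringpred S -> (forall i j, S (fun x => rho x i j)) ->
  (forall i j, S (fun x => kappa x i j)) -> (forall i j, S (fun x => N x i j)) ->
  (forall j l, S (fun x => a x j l)) ->
  forall b, lform b -> S (fun x => b (alg_form (rho x) (kappa x) (N x) (a x))).
Proof.
move=> HS Srho Skappa SN Sa; apply: (rp_polar uu HS) => e ed.
rewrite (_ : (fun x => _) = fun x => (rho x *m
   (\prod_(j <- e) alg_elt (N x) (a x j)) *m kappa x) 0 0); last first.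
  by apply: funext => x; rewrite polar_alg_form.
apply: (rp_mulmx HS) => //; apply: (rp_mulmx HS) => //.
have S1 i j : S (fun=> (1 : 'M[F]_k.+1) i j) by apply: (rp_cst HS).
have SX l i j : S (fun x => (N x ^+ l) i j).
  elim: l i j => [|l IH] i j; first exact: S1.
  rewrite (_ : (fun x => _) = fun x => (N x *m N x ^+ l) i j).
    exact: (rp_mulmx HS).
  by apply: funext => x; rewrite exprS.
elim: (e) => [|j s IH] p q.
  by rewrite (_ : (fun x => _) = fun=> (1 : 'M[F]_k.+1) p q) //;
    apply: funext => x; rewrite big_nil.
rewrite (_ : (fun x => _) = fun x => (alg_elt (N x) (a x j) *m
   \prod_(j <- s) alg_elt (N x) (a x j)) p q).
  apply: (rp_mulmx HS) => // p' q'.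
  rewrite (_ : (fun x => _) = fun x => \sum_l a x j l * (N x ^+ l) p' q').
    by apply: (rp_sum HS) => l _; apply: (rp_mul HS).
  by apply: funext => x; rewrite summxE; apply: eq_bigr => l _; rewrite mxE.
by apply: funext => x; rewrite big_cons.
Qed.

Definition rootpoly (r : 'I_k.+1 -> F) : {poly F} := \prod_i ('X - (r i)%:P).

(* The companion matrix of the polynomial with roots r: it sends e_l to e_(l+1). *)
Definition companion (r : 'I_k.+1 -> F) : 'M[F]_k.+1 :=
  \matrix_(i, l) if l == ord_max then - (rootpoly r)`_i else (i == l.+1 :> nat)%:R.

Lemma companion_diag r : (\matrix_(i, j) r i ^+ j) *m companion r
  = diag_mx (\row_i r i) *m (\matrix_(i, j) r i ^+ j) :> 'M[F]_k.+1.
Proof.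
apply/matrixP => i l; rewrite mul_diag_mx !mxE -exprS.
have [->|lk] := eqVneq l ord_max.
  have sz : size (rootpoly r) = k.+2.
    by rewrite size_prod_XsubC /index_enum -enumT size_enum_ord.
  have lc : (rootpoly r)`_k.+1 = 1.
    by have /monicP := monic_prod_XsubC (index_enum 'I_k.+1) predT r;
      rewrite lead_coefE sz.
  have : (rootpoly r).[r i] = 0.
    rewrite horner_prod (bigD1 i) //= hornerXsubC subrr mul0r //.
  rewrite horner_coef sz big_ord_recr /= lc mul1r => /eqP.
  rewrite addr_eq0 => /eqP H; rewrite -[RHS]opprK -H -sumrN; apply: eq_bigr => j _.
  by rewrite !mxE eqxx mulrN mulrC.
have lk' : (l.+1 < k.+1)%N.
  by rewrite ltn_neqAle ltn_ord andbT; apply: contraNneq lk => -[lk];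
    apply/eqP/val_inj.
rewrite (bigD1 (Ordinal lk')) //= big1 ?addr0 ?mxE ?(negbTE lk) /= ?eqxx ?mulr1 //.
move=> j jl; rewrite !mxE (negbTE lk); case: eqP => [jE|_]; last by rewrite mulr0.
by case/eqP: jl; apply: val_inj.
Qed.

Lemma rootpoly_coef_poly (r : 'I_k.+1 -> F -> F) i : (forall j, is_poly (r j)) ->
  is_poly (fun t => (rootpoly (fun j => r j t))`_i).
Proof.
have HR := is_poly_ring F; move=> Hr; rewrite /rootpoly.
elim: (index_enum _) i => [|j s IH] i.
  rewrite (_ : (fun t => _) = fun=> (1 : {poly F})`_i); first exact: (rp_cst HR).
  by apply: funext => t; rewrite big_nil.
rewrite (_ : (fun t => _) = fun t =>
   (if i is i'.+1 then (\prod_(j <- s) ('X - (r j t)%:P))`_i' else 0) -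
   r j t * (\prod_(j <- s) ('X - (r j t)%:P))`_i).
  apply: (rp_sub HR); last exact: (rp_mul HR).
  by case: (i) => [|i']; [apply: (rp_cst HR) | apply: IH].
by apply: funext => t; rewrite big_cons mulrBl coefB coefXM coefCM; case: (i).
Qed.

(* Algebra forms over F[X]/(q) are limits of sums of k+1 powers: they are such
   sums when q has distinct roots, and the roots can be moved apart. *)
Lemma alg_form_vanish r rho kappa a P : vanish (@powsum F n d k.+1) P ->
  peval P (alg_form rho kappa (companion r) a) = 0.
Proof.
move=> HP; have HR := is_poly_ring F.
pose rt (i : 'I_k.+1) (t : F) : F := (1 - t) * r i + t * (i : nat)%:R.
have rtP i : is_poly (rt i).
  apply: (rp_add HR); apply: (rp_mul HR); try exact: (rp_cst HR).
    by apply: (rp_sub HR); [exact: (rp_cst HR) | exact: is_poly_id].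
  exact: is_poly_id.
pose V t : 'M[F]_k.+1 := \matrix_(i, j) rt i t ^+ j.
have := @is_poly_density _
  (fun t => peval P (alg_form rho kappa (companion (rt^~ t)) a))
  (fun t => \det (V t)) 1 _ _ _ _ 0.
rewrite (_ : rt^~ 0 = r); last first.
  by apply: funext => i; rewrite /rt subr0 mul1r mul0r addr0.
apply.
- apply: (rp_comp HR _ (peval_polyfn P)); apply: rp_alg_form => //;
    try by move=> *; apply: (rp_cst HR).
  move=> i j; rewrite (_ : (fun t => _) = fun t => if j == ord_max
     then - (rootpoly (rt^~ t))`_i else (i == j.+1 :> nat)%:R).
    case: (j == _); last exact: (rp_cst HR).
    by apply: (rp_opp HR); apply: rootpoly_coef_poly.
  by apply: funext => t; rewrite mxE.
- apply: (rp_det HR) => i j.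
  rewrite (_ : (fun t => _) = fun t => rt i t ^+ j); first exact: (rp_exp HR).
  by apply: funext => t; rewrite mxE.
- have -> : V 1 = (Vandermonde k.+1 (\row_i (i : nat)%:R))^T.
    by apply/matrixP => i j; rewrite !mxE /rt subrr mul0r mul1r add0r.
  rewrite det_tr det_Vandermonde prodf_seq_neq0; apply/allP => i _ /=.
  rewrite prodf_seq_neq0; apply/allP => j _; apply/implyP => ij.
  by rewrite !mxE subr_eq0 eqr_nat gtn_eqF.
move=> t Vt; have Vu : V t \in unitmx by rewrite unitmxE unitfE.
have Vd := companion_diag (rt^~ t).
have [A EA] := powsum_prescribed d_gt0 (fun i : 'I_k.+1 =>
    (rho *m invmx (V t)) 0 i * (V t *m kappa) i 0)
  (fun i j => \sum_l a j l * rt i t ^+ l) uu.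
rewrite -(HP A); congr (peval P _); apply: (polar_ext uu) => e ed.
rewrite EA // (polar_alg_form_diag _ _ _ Vu Vd ed); apply: eq_bigr => i _.
by congr (_ * _); apply: eq_bigr => j _; apply: eq_bigr => l _; rewrite mxE.
Qed.

End Theta.

Lemma companion_roots (F : closedFieldType) k (c : 'I_k.+1 -> F) :
  exists r : 'I_k.+1 -> F, forall i : 'I_k.+1, - (\prod_i ('X - (r i)%:P))`_i = c i.
Proof.
pose g : {poly F} := \poly_(i < k.+1) (if insub i is Some j then c j else 0).
pose p : {poly F} := 'X^(k.+1) - g.
have sp : (size (- g) < size ('X^(k.+1) : {poly F}))%N.
  by rewrite size_polyN size_polyXn ltnS size_poly.
have p1 : lead_coef p = 1 by rewrite lead_coefDl // lead_coefXn.
have [rs Ers] := closed_field_poly_normal p.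
move: Ers; rewrite p1 scale1r => Ers.
have srs : size rs = k.+1.
  have : size p = k.+2 by rewrite size_polyDl // size_polyXn.
  by rewrite Ers size_prod_XsubC => -[].
exists (fun i => rs`_i) => i.
have -> : \prod_(i < k.+1) ('X - (rs`_i)%:P) = p.
  by rewrite Ers [RHS](big_nth 0) srs big_mkord.
rewrite coefB coefXn (ltn_eqF (ltn_ord i)) coef_poly ltn_ord valK.
by rewrite sub0r opprK.
Qed.

Lemma pred_subnK d k : (k < d)%N -> (d.-1 - k + k).+1 = d.
Proof. lia. Qed.

Lemma card_chart (F : fieldType) (q : nat) :
  #|{: 'I_6 + 'I_3 * 'I_q}| = \dim {: 'M[F]_(3, q.+2)}.
Proof. rewrite dimvf card_sum card_prod !card_ord /dim /=; lia. Qed.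

Section MomentForm.
Variables (F : numClosedFieldType) (q d : nat).
Hypothesis d_gt0 : (0 < d)%N.
Local Notation W := (Defs.form F q.+1 d).
Variable u : 'M[F]_q.+2.
Hypothesis uu : u \in unitmx.

Definition i0 : 'I_q.+2 := ord0.
Definition i1 : 'I_q.+2 := lift ord0 ord0.
Definition ix (j : 'I_q) : 'I_q.+2 := lift ord0 (lift ord0 j).

Variant idx_spec : 'I_q.+2 -> Type :=
| Idx0 : idx_spec i0 | Idx1 : idx_spec i1 | IdxX j : idx_spec (ix j).

Lemma idxP j : idx_spec j.
Proof.
case: (unliftP ord0 j) => [j' ->|->]; last exact: Idx0.
case: (unliftP ord0 j') => [j'' ->|->]; [exact: IdxX | exact: Idx1].
Qed.

Definition idx_rec (T : Type) (x0 x1 : T) (x : 'I_q -> T) (j : 'I_q.+2) : T :=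
  if unlift ord0 j is Some j' then
    if unlift ord0 j' is Some j'' then x j'' else x1
  else x0.

Lemma idx_rec0 T x0 x1 x : @idx_rec T x0 x1 x i0 = x0.
Proof. by rewrite /idx_rec unlift_none. Qed.
Lemma idx_rec1 T x0 x1 x : @idx_rec T x0 x1 x i1 = x1.
Proof. by rewrite /idx_rec /i1 liftK unlift_none. Qed.
Lemma idx_recx T x0 x1 x j : @idx_rec T x0 x1 x (ix j) = x j.
Proof. by rewrite /idx_rec /ix !liftK. Qed.

Local Notation I := ('I_6 + 'I_3 * 'I_q)%type.
Local Notation V := {ffun I -> F^o}.
Implicit Types v : V.

Definition hv v k : F := v (inl (inord k)).
Definition mv v k j : F := v (inr (inord k, j)).

Definition Hmx v : 'M[F]_3 := \matrix_(i, j) hv v (i + j).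
Definition H1mx v : 'M[F]_3 := \matrix_(i, j) hv v (i + j).+1.
Definition mcol v j : 'cV[F]_3 := \col_k mv v k j.
Definition Nmx v : 'M[F]_3 := invmx (Hmx v) *m H1mx v.
Definition acoef v (j : 'I_q.+2) (l : 'I_3) : F :=
  idx_rec (l == 0 :> nat)%:R (l == 1 :> nat)%:R
    (fun j => (invmx (Hmx v) *m mcol v j) l 0) j.

Definition moment_form v : W :=
  alg_form d u (row 0 (Hmx v)) (delta_mx 0 0) (Nmx v) (acoef v).

Section Moments.
Variables (v : V) (c : 'I_3 -> F) (tau : 'I_3 -> 'I_q.+2 -> F).
Hypothesis tau0 : forall i, tau i i0 = 1.
Let s i := tau i i1.
Hypothesis hvE : forall k, (k <= 5)%N -> hv v k = \sum_i c i * s i ^+ k.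
Hypothesis mvE : forall k j, (k <= 2)%N ->
  mv v k j = \sum_i c i * (s i ^+ k * tau i (ix j)).
Hypothesis Hu : Hmx v \in unitmx.

Let Vm : 'M[F]_3 := \matrix_(i, j) s i ^+ j.
Let VD : 'M[F]_3 := Vm^T *m diag_mx (\row_i c i).

Let leq2 (i : 'I_3) : (i <= 2)%N. Proof. by rewrite -ltnS. Qed.

Let HE : Hmx v = VD *m Vm.
Proof.
apply/matrixP => i j; rewrite /VD mul_mx_diag !mxE hvE.
  by apply: eq_bigr => l _; rewrite !mxE exprD; ring.
by have := (leq2 i, leq2 j) => -[]; lia.
Qed.

Let VDu : VD \in unitmx /\ Vm \in unitmx.
Proof. by move: Hu; rewrite HE unitmx_mul => /andP []. Qed.

Lemma polar_moment_form e : size e = d ->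
  polar (word u e) (moment_form v) = \sum_i c i * \prod_(j <- e) tau i j.
Proof.
move=> ed; have [VDu' Vu] := VDu.
have VN : Vm *m Nmx v = diag_mx (\row_i s i) *m Vm.
  apply: (can_inj (mulKmx VDu')).
  rewrite mulmxA -HE /Nmx mulKVmx //; apply/matrixP => i j.
  rewrite /VD mul_mx_diag !mxE hvE; last first.
    by have := (leq2 i, leq2 j) => -[]; lia.
  apply: eq_bigr => l _; rewrite mul_diag_mx !mxE exprS exprD; ring.
rewrite (polar_alg_form_diag uu _ _ _ Vu VN ed); apply: eq_bigr => i _.
have -> : row 0 (Hmx v) *m invmx Vm = row 0 VD by rewrite HE row_mul mulmxK.
have -> : (Vm *m (delta_mx 0 0 : 'cV_3)) i 0 = 1 by rewrite -colE !mxE.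
rewrite mulr1; congr (_ * _); first by rewrite /VD mul_mx_diag !mxE mul1r.
apply: eq_bigr => j _; transitivity ((Vm *m \col_l acoef v j l) i 0).
  by rewrite [RHS]mxE; apply: eq_bigr => l _; rewrite !mxE mulrC.
case: (idxP j) => [||{}j].
- rewrite tau0 (_ : \col_l _ = delta_mx 0 0) -?colE ?mxE //.
  by apply/colP => l; rewrite !mxE /acoef idx_rec0 andbT.
- rewrite (_ : \col_l _ = delta_mx 1 0) -?colE ?mxE //.
  by apply/colP => l; rewrite !mxE /acoef idx_rec1 andbT.
have -> : \col_l acoef v (ix j) l = invmx (Hmx v) *m mcol v j.
  by apply/colP => l; rewrite mxE /acoef idx_recx.
suff -> : Vm *m (invmx (Hmx v) *m mcol v j) = \col_i tau i (ix j) by rewrite mxE.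
apply: (can_inj (mulKmx VDu')); rewrite mulmxA -HE mulKVmx //.
apply/colP => k; rewrite /VD mul_mx_diag !mxE mvE //.
by apply: eq_bigr => l _; rewrite !mxE; ring.
Qed.

End Moments.

Section Values.
Variable v : V.
Hypothesis Hu : Hmx v \in unitmx.

Definition lam (X : 'M[F]_3) : F := (row 0 (Hmx v) *m X *m (delta_mx 0 0 : 'cV_3)) 0 0.

Let HN : Hmx v *m Nmx v = H1mx v.
Proof. by rewrite /Nmx mulKVmx. Qed.

(* Multiplication by N shifts the rows of the Hankel matrix. *)
Let rowHN (i j : 'I_3) : j = i.+1 :> nat ->
  row i (Hmx v) *m Nmx v = row j (Hmx v).
Proof.
by move=> ij; rewrite -row_mul HN; apply/rowP => l; rewrite !mxE ij addSn.
Qed.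

Lemma row0_N (k : 'I_3) : row 0 (Hmx v) *m Nmx v ^+ k = row k (Hmx v).
Proof.
have H1 : row 0 (Hmx v) *m Nmx v = row 1 (Hmx v) by apply: rowHN.
have H2 : row 1 (Hmx v) *m Nmx v = row (inord 2) (Hmx v).
  by apply: rowHN; rewrite inordK.
case: k => -[|[|[|//]]] lk /=.
- by rewrite expr0 mulmx1; congr (row _ _); apply: val_inj.
- by rewrite expr1 H1; congr (row _ _); apply: val_inj.
- rewrite expr2 -mulmxE mulmxA H1 H2; congr (row _ _); apply: val_inj.
  by rewrite /= inordK.
Qed.

Definition acol (c : 'I_3 -> F) : 'cV[F]_3 := \col_l c l.

Lemma lam_alg_elt (c : 'I_3 -> F) X :
  lam (alg_elt (Nmx v) c * X) = ((acol c)^T *m Hmx v *m X *m (delta_mx 0 0 : 'cV_3)) 0 0.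
Proof.
rewrite /lam -mulmxE !mulmxA; congr ((_ *m X *m _) 0 0).
rewrite /alg_elt mulmx_sumr (eq_bigr (fun l => c l *: row l (Hmx v))).
  rewrite [RHS]mulmx_sum_row; apply: eq_bigr => l _.
  by rewrite !mxE.
by move=> l _; rewrite -scalemxAr row0_N.
Qed.

(* N maps e_0 to e_1 and e_1 to e_2. *)
Lemma N_delta (k : 'I_3) : Nmx v ^+ k *m (delta_mx 0 0 : 'cV[F]_3) = delta_mx k 0.
Proof.
have step (i j : 'I_3) : j = i.+1 :> nat ->
    Nmx v *m (delta_mx i 0 : 'cV[F]_3) = delta_mx j 0.
  move=> ij; apply: (can_inj (mulKmx Hu)); rewrite mulmxA HN -!colE.
  by apply/colP => l; rewrite !mxE ij addnS.
have H1 : Nmx v *m (delta_mx 0 0 : 'cV[F]_3) = delta_mx 1 0 by apply: step.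
have H2 : Nmx v *m (delta_mx 1 0 : 'cV[F]_3) = delta_mx (inord 2) 0.
  by apply: step; rewrite inordK.
case: k => -[|[|[|//]]] lk /=.
- by rewrite expr0 mul1mx; congr delta_mx; apply: val_inj.
- by rewrite expr1 H1; congr delta_mx; apply: val_inj.
- rewrite expr2 -mulmxE -mulmxA H1 H2; congr delta_mx; apply: val_inj.
  by rewrite /= inordK.
Qed.

Lemma alg_elt_delta (c : 'I_3 -> F) :
  alg_elt (Nmx v) c *m (delta_mx 0 0 : 'cV[F]_3) = acol c.
Proof.
rewrite /alg_elt mulmx_suml (eq_bigr (fun l => c l *: delta_mx l 0)).
  apply/colP => i; rewrite summxE (bigD1 i) //= big1 ?addr0 ?mxE.
    by rewrite !eqxx mulr1.
  by move=> j ji; rewrite !mxE eq_sym (negbTE ji) mulr0.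
by move=> l _; rewrite -scalemxAl N_delta.
Qed.

Lemma lam2 c c' : lam (alg_elt (Nmx v) c * alg_elt (Nmx v) c')
  = ((acol c)^T *m Hmx v *m acol c') 0 0.
Proof. by rewrite lam_alg_elt -mulmxA alg_elt_delta. Qed.

Lemma lam3 c c' : lam (alg_elt (Nmx v) c * (Nmx v * alg_elt (Nmx v) c'))
  = ((acol c)^T *m H1mx v *m acol c') 0 0.
Proof.
by rewrite lam_alg_elt -mulmxE -!mulmxA alg_elt_delta mulKVmx.
Qed.

Lemma alg_elt_acoef0 : alg_elt (Nmx v) (acoef v i0) = 1.
Proof.
rewrite /alg_elt (bigD1 0) //= big1 ?addr0 /acoef ?idx_rec0 ?scale1r ?expr0 //.
by move=> l /negbTE l0; rewrite idx_rec0 -(val_eqE l 0) /= in l0 *; rewrite l0 scale0r.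
Qed.

Lemma alg_elt_acoef1 : alg_elt (Nmx v) (acoef v i1) = Nmx v.
Proof.
rewrite /alg_elt (bigD1 1) //= big1 ?addr0 /acoef ?idx_rec1 ?scale1r ?expr1 //.
by move=> l /negbTE l0; rewrite idx_rec1 -(val_eqE l 1) /= in l0 *; rewrite l0 scale0r.
Qed.

Lemma polar_moment_form_lam e : size e = d -> polar (word u e) (moment_form v)
  = lam (\prod_(j <- e) alg_elt (Nmx v) (acoef v j)).
Proof. exact: polar_alg_form. Qed.

Lemma prod_nseq_i0 k : \prod_(j <- nseq k i0) alg_elt (Nmx v) (acoef v j) = 1.
Proof. by rewrite big1_seq // => j /andP [_ /nseqP[-> _]]; exact: alg_elt_acoef0. Qed.

Lemma prod_nseq_i1 k : \prod_(j <- nseq k i1) alg_elt (Nmx v) (acoef v j) = Nmx v ^+ k.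
Proof.
elim: k => [|k IH]; first by rewrite big_nil.
by rewrite /= big_cons IH exprS alg_elt_acoef1.
Qed.

Lemma lam_N k : (k <= 5)%N -> lam (Nmx v ^+ k) = hv v k.
Proof.
have E (i j : 'I_3) : lam (Nmx v ^+ i * Nmx v ^+ j) = hv v (i + j).
  rewrite /lam -mulmxE mulmxA row0_N -mulmxA N_delta -colE.
  by rewrite !mxE.
have E1 (i j : 'I_3) : lam (Nmx v ^+ i * (Nmx v * Nmx v ^+ j)) = hv v (i + j).+1.
  have R m (X : 'M_(3, m)) : row i (Hmx v) *m (Nmx v *m X) = row i (H1mx v) *m X.
    by rewrite mulmxA -row_mul HN.
  rewrite /lam -!mulmxE (mulmxA (row 0 _)) row0_N R -mulmxA N_delta -colE.
  by rewrite !mxE.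
case: k => [|[|[|[|[|[|//]]]]]] _.
- by have := E 0 0; rewrite mulr1.
- by have := E 0 1; rewrite mul1r.
- by have := E 1 1; rewrite -exprD.
- by have := E1 1 1; rewrite -exprS -exprD.
- by have := E (inord 2) (inord 2); rewrite -exprD inordK.
- by have := E1 (inord 2) (inord 2); rewrite -exprS -exprD inordK.
Qed.

Lemma lam_mv k j : (k <= 2)%N ->
  lam (alg_elt (Nmx v) (acoef v (ix j)) * Nmx v ^+ k) = mv v k j.
Proof.
rewrite -ltnS => k3; rewrite lam_alg_elt -mulmxA (N_delta (Ordinal k3)) -colE mxE.
have -> : acol (acoef v (ix j)) = invmx (Hmx v) *m mcol v j.
  by apply/colP => l; rewrite mxE /acoef idx_recx.
have HT : (Hmx v)^T = Hmx v by apply/matrixP => i l; rewrite !mxE addnC.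
by rewrite trmx_mul trmx_inv HT mulmxKV // !mxE.
Qed.

Lemma moment_form_vanish P : vanish (@powsum F q.+1 d 3) P ->
  peval P (moment_form v) = 0.
Proof.
move=> HP; have [r Hr] := companion_roots (fun i => Nmx v i (inord 2)).
rewrite /moment_form (_ : Nmx v = companion r); first exact: (alg_form_vanish d_gt0).
apply/matrixP => i j; rewrite [RHS]mxE.
have [->|j2] := eqVneq j ord_max; first by rewrite Hr; congr (_ _ _); apply: val_inj; rewrite /= inordK.
have j3 : (j.+1 < 3)%N.
  by rewrite ltn_neqAle ltn_ord andbT; apply: contraNneq j2 => -[j2];
    apply/eqP/val_inj.
have j2' : (j < 3)%N by apply: ltn_ord.
have : col j (Nmx v) = delta_mx (Ordinal j3) 0.
  by rewrite colE -(N_delta (Ordinal j3)) /= exprS -mulmxE -mulmxA (N_delta j).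
by move/colP/(_ i); rewrite [LHS]mxE [RHS]mxE andbT => ->.
Qed.

End Values.

Lemma ratfn_moment_form (T : lmodType F) (delta : T -> F) (chi : T -> V) :
  polyfn delta -> (forall i, ratfn delta (fun x => chi x i : F)) ->
  (forall x, delta x != 0 -> \det (Hmx (chi x)) != 0) ->
  ratfn delta (fun x => (\det (Hmx (chi x)))^-1) ->
  forall b, lform b -> ratfn delta (fun x => b (moment_form (chi x))).
Proof.
move=> Pd Rchi dH RdH; have HS := ratfn_ring Pd.
have RH i j : ratfn delta (fun x => Hmx (chi x) i j).
  by rewrite (_ : (fun x => _) = fun x => hv (chi x) (i + j));
    [exact: Rchi | apply: funext => x; rewrite mxE].
have RHV : forall i j, ratfn delta (fun x => invmx (Hmx (chi x)) i j).
  exact: ratfn_invmx.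
apply: (rp_alg_form uu HS).
- move=> i j; rewrite (_ : (fun x => _) = fun x => Hmx (chi x) 0 j) //.
  by apply: funext => x; rewrite mxE.
- by move=> i j; apply: (rp_cst HS).
- apply: (rp_mulmx HS) => // i j.
  by rewrite (_ : (fun x => _) = fun x => hv (chi x) (i + j).+1);
    [exact: Rchi | apply: funext => x; rewrite mxE].
move=> j l; case: (idxP j) => [||{}j].
- rewrite (_ : (fun x => _) = fun=> (l == 0 :> nat)%:R); first exact: (rp_cst HS).
  by apply: funext => x; rewrite /acoef idx_rec0.
- rewrite (_ : (fun x => _) = fun=> (l == 1 :> nat)%:R); first exact: (rp_cst HS).
  by apply: funext => x; rewrite /acoef idx_rec1.
rewrite (_ : (fun x => _) = fun x => (invmx (Hmx (chi x)) *m mcol (chi x) j) l 0).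
  apply: (rp_mulmx HS) => // i i'.
  by rewrite (_ : (fun x => _) = fun x => mv (chi x) i j);
    [exact: Rchi | apply: funext => x; rewrite mxE].
by apply: funext => x; rewrite /acoef idx_recx.
Qed.

(* Generic sums of three powers, normalized at the first basis vector. *)
Definition xcoord (A : 'M[F]_(3, q.+2)) i j : F := dot (row j u) (row i A).
Definition x0prod (A : 'M[F]_(3, q.+2)) : F := \prod_i xcoord A i i0.

Lemma xcoord_lform i j : lform (fun A => xcoord A i j).
Proof.
move=> c A B; rewrite /xcoord /dot mulr_sumr -big_split; apply: eq_bigr => l _ /=.
by rewrite !mxE; ring.
Qed.

Lemma x0prod_poly : polyfn x0prod.
Proof.
by apply: (rp_prod (polyfn_ring _)) => i _; apply/polyfn_lin/xcoord_lform.
Qed.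

Lemma x0prod_neq0 : exists A, x0prod A != 0.
Proof.
exists (\matrix_i dual_vec u (const_mx 1)); apply/prodf_neq0 => i _.
by rewrite /xcoord rowK dot_dual_vec // mxE oner_neq0.
Qed.

Lemma polar_powsum_xcoord A e : size e = d ->
  polar (word u e) (powsum d A) = \sum_i \prod_(j <- e) xcoord A i j.
Proof.
move=> ed; rewrite polar_powsum ?size_word //; apply: eq_bigr => i _.
by rewrite big_map.
Qed.

Lemma polar_powsum_normalized A e : x0prod A != 0 -> size e = d ->
  polar (word u e) (powsum d A)
  = \sum_i xcoord A i i0 ^+ d * \prod_(j <- e) (xcoord A i j / xcoord A i i0).
Proof.
move=> /prodf_neq0 nz ed; rewrite polar_powsum_xcoord //; apply: eq_bigr => i _.
rewrite -ed; elim: (e) => [|j s IH]; first by rewrite !big_nil mulr1.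
rewrite !big_cons IH /= exprS; have x0 := nz i isT.
by rewrite [RHS]mulrACA [xcoord A i i0 * (_ / _)]mulrC divfK.
Qed.

(* The words along which the Hankel and the mixed moments are read. *)
Definition hw k : seq 'I_q.+2 := nseq (d - k) i0 ++ nseq k i1.
Definition mw k j : seq 'I_q.+2 := ix j :: nseq (d.-1 - k) i0 ++ nseq k i1.

Lemma size_hw k : (k <= d)%N -> size (hw k) = d.
Proof. by move=> kd; rewrite size_cat !size_nseq subnK. Qed.

Lemma size_mw k j : (k < d)%N -> size (mw k j) = d.
Proof. by move=> kd; rewrite /= size_cat !size_nseq pred_subnK. Qed.

Lemma prod_nseq (R : pzRingType) (g : 'I_q.+2 -> R) k x :
  \prod_(j <- nseq k x) g j = g x ^+ k.
Proof. by elim: k => [|k IH]; rewrite ?big_nil // exprS -IH /= big_cons. Qed.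

Lemma prod_hw (g : 'I_q.+2 -> F) k : g i0 = 1 ->
  \prod_(j <- hw k) g j = g i1 ^+ k.
Proof. by move=> g0; rewrite big_cat !prod_nseq /= g0 expr1n mul1r. Qed.

Lemma prod_mw (g : 'I_q.+2 -> F) k j : g i0 = 1 ->
  \prod_(j <- mw k j) g j = g i1 ^+ k * g (ix j).
Proof.
by move=> g0; rewrite big_cons big_cat !prod_nseq /= g0 expr1n mul1r mulrC.
Qed.

Lemma polar_moment_hw v k : Hmx v \in unitmx -> (k <= 5)%N -> (k <= d)%N ->
  polar (word u (hw k)) (moment_form v) = hv v k.
Proof.
move=> Hu k5 kd; rewrite polar_moment_form_lam ?size_hw //.
by rewrite big_cat /= prod_nseq_i0 prod_nseq_i1 mul1r lam_N.
Qed.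

Lemma polar_moment_mw v k j : Hmx v \in unitmx -> (k <= 2)%N -> (k < d)%N ->
  polar (word u (mw k j)) (moment_form v) = mv v k j.
Proof.
move=> Hu k5 kd; rewrite polar_moment_form_lam ?size_mw //.
by rewrite big_cons big_cat /= prod_nseq_i0 prod_nseq_i1 mul1r lam_mv.
Qed.

(* The Hankel determinant of a form along the first two basis vectors. *)
Definition hankel (w : W) : 'M[F]_3 := \matrix_(i, j) polar (word u (hw (i + j))) w.

Lemma coord_lform (J : finType) i : lform (fun v : {ffun J -> F^o} => v i : F).
Proof. by move=> a x y; rewrite !ffunE. Qed.

Lemma hv_poly k : polyfn (fun v => hv v k).
Proof. exact/polyfn_lin/coord_lform. Qed.

Lemma Hmx_poly i j : polyfn (fun v => Hmx v i j).
Proof.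
by rewrite (_ : (fun v => _) = fun v => hv v (i + j)); [exact: hv_poly |
   apply: funext => v; rewrite mxE].
Qed.

Section HankelChart.
Hypothesis d_ge5 : (5 <= d)%N.

Let pi (w : W) : V := [ffun i : I => match i with
  | inl k => polar (word u (hw k)) w
  | inr kj => polar (word u (mw kj.1 kj.2)) w end].

Lemma hankel_smooth w : pcone (@powsum F q.+1 d 3) w ->
  \det (hankel w) != 0 -> smooth_at (pcone (@powsum F q.+1 d 3)) w.
Proof.
move=> Zw Hw; have pi_lin i : lform (fun w => pi w i : F).
  by move=> a x y; rewrite !ffunE; case: i => [k|kj]; rewrite polar_lform.
have hvpi x k : (k <= 5)%N -> hv (pi x) k = polar (word u (hw k)) x.
  by move=> k5; rewrite /hv ffunE inordK.
have mvpi x k j : (k <= 2)%N -> mv (pi x) k j = polar (word u (mw k j)) x.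
  by move=> k5; rewrite /mv ffunE /= inordK.
have leq2 (i : 'I_3) : (i <= 2)%N by rewrite -ltnS.
have Hpi x : Hmx (pi x) = hankel x.
  apply/matrixP => i j; rewrite !mxE hvpi //.
  by have := (leq2 i, leq2 j) => -[]; lia.
have HR := polyfn_ring V.
have dP : polyfn (fun v => \det (Hmx v)) by apply: (rp_det HR); apply: Hmx_poly.
have [A0 hA0] := x0prod_neq0.
have unitH v : \det (Hmx v) != 0 -> Hmx v \in unitmx by rewrite unitmxE unitfE.
apply: (@chart_smooth _ _ _ (@powsum F q.+1 d 3) _ _ _ _ pi
   (fun v => \det (Hmx v)) moment_form _ _ _ _ _ _ _ x0prod A0) => //.
- by move=> b; apply: powsum_poly.
- exact: powsum_cone.
- exact: powsum_neq0.
- exact: card_chart.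
- rewrite (_ : Hmx 0 = 0) ?det0 //.
  by apply/matrixP => i j; rewrite !mxE /hv ffunE.
- apply: (ratfn_moment_form (chi := id)) => //.
    by move=> i; apply/ratfn_poly/polyfn_lin/coord_lform.
  apply: (@ratfn_divides _ _ _ _ (fun=> 1)); first exact: polyfn_cst.
  by move=> v dv; rewrite mulfV.
- move=> v /unitH Hu; apply/ffunP => -[k|[k j]]; rewrite ffunE /=.
    have k5 : (k <= 5)%N by rewrite -ltnS.
    by rewrite polar_moment_hw // ?(leq_trans k5) // /hv inord_val.
  rewrite polar_moment_mw // ?/mv ?inord_val //.
  by apply: leq_trans d_ge5; rewrite ltnS (leq_trans (leq2 k)).
- by move=> v P /unitH Hu; apply: moment_form_vanish.
- exact: x0prod_poly.
- move=> A hA /unitH Hu; apply: (polar_ext uu) => e ed.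
  have nz i : xcoord A i i0 != 0 by move/prodf_neq0: hA; apply.
  rewrite (@polar_moment_form _ (fun i => xcoord A i i0 ^+ d)
     (fun i j => xcoord A i j / xcoord A i i0)) //.
  + by rewrite polar_powsum_normalized.
  + by move=> i; rewrite mulfV.
  + move=> k k5; have kd : (k <= d)%N by apply: leq_trans d_ge5.
    rewrite hvpi // polar_powsum_normalized ?size_hw //.
    by apply: eq_bigr => i _; rewrite prod_hw // mulfV.
  + move=> k j k5; have kd : (k < d)%N by lia.
    rewrite mvpi // polar_powsum_normalized ?size_mw //.
    by apply: eq_bigr => i _; rewrite prod_mw // mulfV.
- by rewrite Hpi.
Qed.

End HankelChart.
End MomentForm.

Section ConciseChart.
Variables (F : numClosedFieldType) (p d : nat).
Hypothesis d_ge3 : (3 <= d)%N.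
Local Notation q := p.+1.
Local Notation W := (Defs.form F q.+1 d).
Variable u : 'M[F]_q.+2.
Hypothesis uu : u \in unitmx.
Local Notation I := ('I_6 + 'I_3 * 'I_q)%type.
Local Notation V := {ffun I -> F^o}.
Implicit Types v : V.

Let d_gt0 : (0 < d)%N. Proof. exact: leq_trans d_ge3. Qed.
Let t : 'I_q := ord0.

Definition wd (a : nat) (l : seq 'I_q) : seq 'I_q.+2 :=
  [seq ix j | j <- l] ++ (nseq (d - a - size l) (i0 q) ++ nseq a (i1 q)).

Lemma size_wd a l : (a + size l <= d)%N -> size (wd a l) = d.
Proof. by move=> H; rewrite /wd !size_cat size_map !size_nseq; lia. Qed.

(* The exponent of the second variable and the further variables for each of the
   chart coordinates: 1, s, s^2, s^3, t^2, s t^2; t, s t, s^2 t; w, s w, t w. *)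
Definition chart_word (i : I) : nat * seq 'I_q :=
  match i with
  | inl k => nth (0%N, [::]) [:: (0%N, [::]); (1%N, [::]); (2, [::]); (3, [::]);
                                 (0%N, [:: t; t]); (1%N, [:: t; t])] k
  | inr (k, j) => if k == 2 :> nat then
                    if j == t then (2, [:: t]) else (0%N, [:: j; t])
                  else (k : nat, [:: j])
  end.

Definition gram v : 'M[F]_3 := \matrix_(i, j)
  nth 0 (nth [::] [:: [:: hv v 0; hv v 1; mv v 0 t];
                      [:: hv v 1; hv v 2; mv v 1 t];
                      [:: mv v 0 t; mv v 1 t; hv v 4]] i) j.
Definition gram_s v : 'M[F]_3 := \matrix_(i, j)
  nth 0 (nth [::] [:: [:: hv v 1; hv v 2; mv v 1 t];
                      [:: hv v 2; hv v 3; mv v 2 t];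
                      [:: mv v 1 t; mv v 2 t; hv v 5]] i) j.
Definition gram_rhs v : 'cV[F]_3 := \col_i nth 0 [:: hv v 2; hv v 3; mv v 2 t] i.
Definition sigma v : 'cV[F]_3 := invmx (gram v) *m gram_rhs v.
Definition omega v j : 'cV[F]_3 := \col_k mv v k j.

(* The Hankel moments of the algebra, computed in the basis 1, s, t. *)
Definition chi v : V := [ffun i : I => match i with
  | inl k => if k == 4 :> nat then ((gram_rhs v)^T *m sigma v) 0 0
             else if k == 5 :> nat then ((sigma v)^T *m gram_s v *m sigma v) 0 0
             else hv v k
  | inr (k, j) => if (k == 2 :> nat) && (j != t) then ((omega v j)^T *m sigma v) 0 0
                  else mv v k j
  end].

Definition basis_change v : 'M[F]_3 :=
  \matrix_(i, j) if j == 2 :> nat then sigma v i 0 else (i == j)%:R.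

Lemma chi_h v k : (k <= 3)%N -> hv (chi v) k = hv v k.
Proof.
move=> k3; rewrite {1}/hv ffunE inordK; last lia.
by rewrite !ifN // neq_ltn; apply/orP; left; lia.
Qed.
Lemma chi_h4 v : hv (chi v) 4 = ((gram_rhs v)^T *m sigma v) 0 0.
Proof. by rewrite /hv ffunE inordK. Qed.
Lemma chi_h5 v : hv (chi v) 5 = ((sigma v)^T *m gram_s v *m sigma v) 0 0.
Proof. by rewrite /hv ffunE inordK. Qed.
Lemma chi_m v k j : (k <= 1)%N -> mv (chi v) k j = mv v k j.
Proof.
move=> k1; rewrite /mv ffunE inordK; last lia.
by rewrite ifN //; apply/nandP; left; rewrite neq_ltn; apply/orP; left; lia.
Qed.
Lemma chi_mt v k : mv (chi v) k t = mv v k t.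
Proof. by rewrite /mv ffunE eqxx andbF /mv inord_val. Qed.
Lemma chi_m2 v j : j != t -> mv (chi v) 2 j = ((omega v j)^T *m sigma v) 0 0.
Proof. by move=> jt; rewrite {1}/mv ffunE inordK //= jt. Qed.

Lemma ord3P (P : 'I_3 -> Prop) : P 0 -> P 1 -> P (inord 2) -> forall i, P i.
Proof.
move=> P0 P1 P2 [[|[|[|//]]] lt].
- by rewrite (_ : Ordinal lt = 0) //; apply: val_inj.
- by rewrite (_ : Ordinal lt = 1) //; apply: val_inj.
- by rewrite (_ : Ordinal lt = inord 2) //; apply: val_inj; rewrite /= inordK.
Qed.

Lemma sum3 (g : 'I_3 -> F) : \sum_i g i = g 0 + g 1 + g (inord 2).
Proof.
rewrite !big_ord_recl big_ord0 addr0 addrA; congr (_ + g _ + g _); apply: val_inj => //=.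
by rewrite inordK.
Qed.

Lemma chart_word_size i : ((chart_word i).1 + size (chart_word i).2 <= d)%N.
Proof.
case: i => [[[|[|[|[|[|[|//]]]]]] lk]|[[[|[|[|//]]] lk] j]] /=; try lia.
by case: eqP => /= _; lia.
Qed.

Section Algebra.
Variable v : V.
Hypothesis Gu : gram v \in unitmx.

Let Gsig : gram v *m sigma v = gram_rhs v. Proof. by rewrite /sigma mulKVmx. Qed.

Let delta i : 'cV[F]_3 := delta_mx i 0.
Let two : 'I_3 := inord 2.

Let colB0 : col 0 (basis_change v) = delta 0.
Proof. by apply/colP => i; rewrite !mxE andbT. Qed.
Let colB1 : col 1 (basis_change v) = delta 1.
Proof. by apply/colP => i; rewrite !mxE andbT. Qed.
Let colB2 : col two (basis_change v) = sigma v.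
Proof. by apply/colP => i; rewrite 2!mxE /two inordK. Qed.

Let entry (X : 'M[F]_3) i j : ((basis_change v)^T *m X *m basis_change v) i j
  = ((col i (basis_change v))^T *m X *m col j (basis_change v)) 0 0.
Proof.
transitivity (((delta_mx 0 i : 'rV_3) *m ((basis_change v)^T *m X *m basis_change v)
  *m (delta_mx j 0 : 'cV_3)) 0 0).
  by rewrite -rowE -colE [RHS]mxE [RHS]mxE.
by rewrite !colE trmx_mul trmx_delta !mulmxA.
Qed.

Let entry_dd (X : 'M[F]_3) i j : ((delta i)^T *m X *m delta j) 0 0 = X i j.
Proof. by rewrite /delta trmx_delta -rowE -colE !mxE. Qed.
Let entry_dS (X : 'M[F]_3) i : ((delta i)^T *m X *m sigma v) 0 0 = (X *m sigma v) i 0.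
Proof. by rewrite /delta trmx_delta -mulmxA -rowE mxE. Qed.
Let entry_Sd (X : 'M[F]_3) j :
  ((sigma v)^T *m X *m delta j) 0 0 = (X^T *m sigma v) j 0.
Proof.
have -> : X^T *m sigma v = ((sigma v)^T *m X)^T by rewrite trmx_mul trmxK.
by rewrite -colE !mxE.
Qed.

Let gramT : (gram v)^T = gram v.
Proof. by apply/matrixP; apply: ord3P; apply: ord3P; rewrite !mxE /= ?inordK. Qed.
Let gram_sT : (gram_s v)^T = gram_s v.
Proof. by apply/matrixP; apply: ord3P; apply: ord3P; rewrite !mxE /= ?inordK. Qed.

Let gram_s0 : (gram_s v *m sigma v) 0 0 = gram_rhs v 1 0.
Proof.
rewrite -Gsig; move: (sigma v) => S; rewrite [LHS]mxE [RHS]mxE.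
by apply: eq_bigr => i _; congr (_ * _); move: i; apply: ord3P; rewrite !mxE /= ?inordK.
Qed.
Let gram_s1 : (gram_s v *m sigma v) 1 0 = hv (chi v) 4.
Proof.
rewrite chi_h4; move: (sigma v) => S; rewrite [LHS]mxE [RHS]mxE.
by apply: eq_bigr => i _; congr (_ * _); move: i; apply: ord3P; rewrite !mxE /= ?inordK.
Qed.

Lemma hankel_gram : Hmx (chi v) = (basis_change v)^T *m gram v *m basis_change v.
Proof.
apply/matrixP; apply: ord3P; apply: ord3P;
  rewrite entry ?colB0 ?colB1 ?colB2 ?entry_dd ?entry_dS ?entry_Sd ?gramT ?Gsig mxE
    ?inordK ?add0n ?addn0 //; try (rewrite chi_h; [|by []]);
  try by rewrite !mxE /= ?inordK.
have -> : (sigma v)^T *m gram v *m sigma v = ((gram_rhs v)^T *m sigma v)^T.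
  by move: (sigma v) Gsig => S GS; rewrite -mulmxA GS trmx_mul trmxK.
by rewrite [RHS]mxE -chi_h4.
Qed.

Lemma hankel1_gram :
  H1mx (chi v) = (basis_change v)^T *m gram_s v *m basis_change v.
Proof.
apply/matrixP; apply: ord3P; apply: ord3P;
  rewrite entry ?colB0 ?colB1 ?colB2 ?entry_dd ?entry_dS ?entry_Sd ?gram_sT
    ?gram_s0 ?gram_s1 mxE ?inordK ?add0n ?addn0 //; try (rewrite chi_h; [|by []]);
  try by rewrite !mxE /= ?inordK.
by rewrite chi_h5.
Qed.

Hypothesis s2 : sigma v (inord 2) 0 != 0.

Lemma det_basis_change : \det (basis_change v) = sigma v two 0.
Proof.
rewrite -det_tr det_trig; last first.
  apply/is_trig_mxP; apply: ord3P; apply: ord3P; rewrite ?inordK //= => _;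
    by rewrite mxE [LHS]mxE /= ?inordK // -val_eqE /= ?inordK.
rewrite (bigD1 two) //= big1 ?mulr1 ?mxE ?[in LHS]mxE ?/two ?inordK //.
apply: ord3P; rewrite -?val_eqE /= ?inordK ?eqxx //= => _;
  by rewrite mxE [LHS]mxE /= -?val_eqE.
Qed.

Let Bu : basis_change v \in unitmx.
Proof. by rewrite unitmxE det_basis_change unitfE. Qed.

Lemma det_hankel_chi : \det (Hmx (chi v)) = sigma v two 0 ^+ 2 * \det (gram v).
Proof. by rewrite hankel_gram !det_mulmx det_tr det_basis_change; ring. Qed.

Lemma hankel_chi_unit : Hmx (chi v) \in unitmx.
Proof.
rewrite unitmxE det_hankel_chi unitfE mulf_neq0 ?expf_neq0 //.
by move: Gu; rewrite unitmxE unitfE.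
Qed.

Let tau := invmx (Hmx (chi v)) *m mcol (chi v) t.

(* The vector t is the third element of the basis 1, s, t. *)
Let Btau : basis_change v *m tau = delta two.
Proof.
have BGu : (basis_change v)^T *m gram v \in unitmx by rewrite unitmx_mul unitmx_tr Bu.
apply: (can_inj (mulKmx BGu)); rewrite mulmxA -hankel_gram /tau.
rewrite mulKVmx ?hankel_chi_unit //; apply/colP.
have E i : ((basis_change v)^T *m gram v *m delta two) i 0 =
    ((col i (basis_change v))^T *m gram v *m delta two) 0 0.
  transitivity (((delta_mx 0 i : 'rV_3) *m ((basis_change v)^T *m gram v *m delta two)) 0 0).
    by rewrite -rowE [RHS]mxE.
  by rewrite colE trmx_mul trmx_delta !mulmxA.
apply: ord3P; rewrite mxE E ?colB0 ?colB1 ?colB2 ?entry_dd ?entry_Sd ?gramT ?Gsig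
  chi_mt mxE /= /two ?inordK //.
Qed.

Let acol_ix j : acol (acoef (chi v) (ix j)) = invmx (Hmx (chi v)) *m mcol (chi v) j.
Proof. by apply/colP => l; rewrite mxE /acoef idx_recx. Qed.

Let lam_tt : lam (chi v) (alg_elt (Nmx (chi v)) (acoef (chi v) (ix t)) *
  alg_elt (Nmx (chi v)) (acoef (chi v) (ix t))) = hv v 4.
Proof.
rewrite (lam2 hankel_chi_unit) !acol_ix -/tau hankel_gram.
rewrite -!mulmxA Btau mulmxA -trmx_mul Btau mulmxA entry_dd mxE /two inordK //.
Qed.

Let lam_tst : lam (chi v) (alg_elt (Nmx (chi v)) (acoef (chi v) (ix t)) *
  (Nmx (chi v) * alg_elt (Nmx (chi v)) (acoef (chi v) (ix t)))) = hv v 5.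
Proof.
rewrite (lam3 hankel_chi_unit) !acol_ix -/tau hankel1_gram.
rewrite -!mulmxA Btau mulmxA -trmx_mul Btau mulmxA entry_dd mxE /two inordK //.
Qed.

Let lam_jt j : j != t -> lam (chi v) (alg_elt (Nmx (chi v)) (acoef (chi v) (ix j)) *
  alg_elt (Nmx (chi v)) (acoef (chi v) (ix t))) = mv v 2 j.
Proof.
move=> jt; rewrite (lam2 hankel_chi_unit) !acol_ix -/tau.
have -> : mcol (chi v) j = (basis_change v)^T *m omega v j.
  apply/colP => i.
  have -> : ((basis_change v)^T *m omega v j) i 0
          = ((omega v j)^T *m col i (basis_change v)) 0 0.
    have -> : (basis_change v)^T *m omega v j
      = ((omega v j)^T *m basis_change v)^T by rewrite trmx_mul trmxK.
    by rewrite [LHS]mxE colE mulmxA -colE [RHS]mxE.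
  move: i; apply: ord3P; rewrite mxE ?colB0 ?colB1 ?colB2 /delta -?colE ?[in RHS]mxE.
  - by rewrite chi_m // !mxE.
  - by rewrite chi_m // !mxE.
  - by rewrite inordK // chi_m2 // mxE.
have HT : (Hmx (chi v))^T = Hmx (chi v) by apply/matrixP => i l; rewrite !mxE addnC.
rewrite trmx_mul trmx_inv HT mulmxKV ?hankel_chi_unit // trmx_mul trmxK -mulmxA Btau.
by rewrite /delta -colE !mxE /two inordK.
Qed.

Lemma polar_chi (i : I) :
  polar (word u (wd (chart_word i).1 (chart_word i).2)) (moment_form d u (chi v)) = v i.
Proof.
pose N := Nmx (chi v); pose a j := alg_elt N (acoef (chi v) (ix j)).
have E k l : (k + size l <= d)%N ->
    polar (word u (wd k l)) (moment_form d u (chi v))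
    = lam (chi v) (\prod_(j <- l) a j * N ^+ k).
  move=> kl; rewrite (polar_moment_form_lam uu) ?size_wd // big_cat big_map /=.
  by rewrite big_cat /= prod_nseq_i0 prod_nseq_i1 mul1r.
have Hu := hankel_chi_unit.
have aN j : a j * N = N * a j.
  have := alg_elt_comm N (acoef (chi v) (ix j)) (acoef (chi v) (i1 q)).
  by rewrite alg_elt_acoef1.
have hvi (k : 'I_6) : v (inl k) = hv v k by rewrite /hv inord_val.
rewrite E ?chart_word_size //; case: i => [k|[k j]].
  rewrite hvi; case: k => -[|[|[|[|[|[|//]]]]]] lk /=.
  all: rewrite ?big_cons ?big_nil ?mulr1 ?mul1r ?(lam_N Hu) ?chi_h //.
  - by rewrite -(expr0 N) (lam_N Hu) // chi_h.
  - by rewrite expr1 -mulrA aN; exact: lam_tst.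
have mvi : v (inr (k, j)) = mv v k j by rewrite /mv inord_val.
rewrite mvi; case: k {mvi} => -[|[|[|//]]] lk /=; last case: eqP => [->|/eqP jt];
  rewrite ?big_cons ?big_nil ?mulr1.
- by have := lam_mv Hu j (isT : 0 <= 2)%N; rewrite mulr1 chi_m.
- by rewrite (lam_mv Hu) // chi_m.
- by rewrite (lam_mv Hu) // chi_mt.
- exact: lam_jt.
Qed.

End Algebra.
Definition chart_pi (w : W) : V :=
  [ffun i : I => polar (word u (wd (chart_word i).1 (chart_word i).2)) w].

Section Generic.
Variable A : 'M[F]_(3, q.+2).
Hypothesis A0 : x0prod u A != 0.
Let v := chart_pi (powsum d A).
Hypothesis Gu : gram v \in unitmx.

Let c i := xcoord u A i (i0 q) ^+ d.
Let tau i j := xcoord u A i j / xcoord u A i (i0 q).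
Let s i := tau i (i1 q).

Let tau0 i : tau i (i0 q) = 1.
Proof. by rewrite /tau mulfV //; move/prodf_neq0: A0; apply. Qed.

Let vE (i : I) : v i = \sum_k c k *
  (\prod_(j <- (chart_word i).2) tau k (ix j) * s k ^+ (chart_word i).1).
Proof.
rewrite /v /chart_pi ffunE (polar_powsum_normalized A0) ?size_wd ?chart_word_size //.
apply: eq_bigr => k _; rewrite -/(c k); congr (_ * _).
by rewrite !big_cat big_map !prod_nseq /= -/(tau k (i0 q)) tau0 expr1n mul1r.
Qed.

Let h k : (k <= 3)%N -> hv v k = \sum_i c i * s i ^+ k.
Proof.
case: k => [|[|[|[|//]]]] _; rewrite /hv vE /= inordK //=;
  by apply: eq_bigr => i _; rewrite big_nil mul1r.
Qed.
Let h4 : hv v 4 = \sum_i c i * (tau i (ix t) * tau i (ix t)).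
Proof.
rewrite /hv vE /= inordK //=.
by apply: eq_bigr => i _; rewrite !big_cons big_nil !mulr1.
Qed.
Let h5 : hv v 5 = \sum_i c i * (tau i (ix t) * tau i (ix t) * s i).
Proof.
rewrite /hv vE /= inordK //=.
by apply: eq_bigr => i _; rewrite !big_cons big_nil mulr1 expr1.
Qed.
Let m0 j : mv v 0 j = \sum_i c i * tau i (ix j).
Proof.
rewrite /mv vE /= inordK //=.
by apply: eq_bigr => i _; rewrite big_cons big_nil !mulr1.
Qed.
Let m1 j : mv v 1 j = \sum_i c i * (tau i (ix j) * s i).
Proof.
rewrite /mv vE /= inordK //=.
by apply: eq_bigr => i _; rewrite big_cons big_nil !mulr1.
Qed.
Let m2t : mv v 2 t = \sum_i c i * (tau i (ix t) * s i ^+ 2).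
Proof.
rewrite /mv vE /= inordK //=.
by apply: eq_bigr => i _; rewrite big_cons big_nil !mulr1.
Qed.
Let m2 j : j != t -> mv v 2 j = \sum_i c i * (tau i (ix j) * tau i (ix t)).
Proof.
move=> /negbTE jt; rewrite /mv vE /= inordK //= jt.
by apply: eq_bigr => i _; rewrite !big_cons big_nil !mulr1.
Qed.

(* The values of the basis 1, s, t of the algebra at the three points. *)
Let bas i : seq F := [:: 1; s i; tau i (ix t)].
Let Vm : 'M[F]_3 := \matrix_(i, j) (bas i)`_j.
Let VD : 'M[F]_3 := Vm^T *m diag_mx (\row_i c i).

Let VDmx m (X : 'M[F]_(3, m)) i j : (VD *m X) i j = \sum_k c k * ((bas k)`_i * X k j).
Proof.
rewrite mxE; apply: eq_bigr => k _; rewrite /VD mul_mx_diag !mxE; ring.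
Qed.

Let gramE : gram v = VD *m Vm.
Proof.
apply/matrixP; apply: ord3P; apply: ord3P; rewrite VDmx [LHS]mxE ?inordK //=
  ?(@h 0 isT) ?(@h 1 isT) ?(@h 2 isT) ?(@h 3 isT)
    ?h4 ?m0 ?m1 //; apply: eq_bigr => i _; rewrite !mxE ?inordK //=; ring.
Qed.

Let gram_sE : gram_s v = VD *m diag_mx (\row_i s i) *m Vm.
Proof.
apply/matrixP; apply: ord3P; apply: ord3P; rewrite -mulmxA VDmx [LHS]mxE ?inordK //=
  ?(@h 0 isT) ?(@h 1 isT) ?(@h 2 isT) ?(@h 3 isT)
    ?h5 ?m0 ?m1 ?m2t //; apply: eq_bigr => i _; rewrite mul_diag_mx !mxE ?inordK //=;
  ring.
Qed.

Let etaE : gram_rhs v = VD *m \col_i s i ^+ 2.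
Proof.
apply/colP; apply: ord3P; rewrite VDmx [LHS]mxE ?inordK //= ?(@h 0 isT) ?(@h 1 isT) ?(@h 2 isT) ?(@h 3 isT)
    ?m2t //;
  apply: eq_bigr => i _; rewrite !mxE ?inordK //=; ring.
Qed.

Let omegaE j : j != t -> omega v j = VD *m \col_i tau i (ix j).
Proof.
move=> jt; apply/colP; apply: ord3P; rewrite VDmx [LHS]mxE ?inordK //= ?m0 ?m1 ?m2 //;
  apply: eq_bigr => i _; rewrite !mxE ?inordK //=; ring.
Qed.

Let VDu : VD \in unitmx.
Proof. by move: Gu; rewrite gramE unitmx_mul => /andP []. Qed.

Let Vsigma : Vm *m sigma v = \col_i s i ^+ 2.
Proof.
apply: (can_inj (mulKmx VDu)).
by rewrite mulmxA -gramE /sigma mulKVmx // etaE.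
Qed.

Let dual (x y : 'cV[F]_3) :
  ((VD *m x)^T *m y) 0 0 = \sum_i c i * (x i 0 * (Vm *m y) i 0).
Proof.
rewrite /VD !trmx_mul tr_diag_mx trmxK -!mulmxA mxE; apply: eq_bigr => i _.
by rewrite mul_diag_mx !mxE; ring.
Qed.

Hypothesis s2 : sigma v (inord 2) 0 != 0.

Lemma chi_generic : moment_form d u (chi v) = powsum d A.
Proof.
apply: (polar_ext uu) => e ed.
rewrite (polar_moment_form d_gt0 uu (c := c) (tau := tau)) ?hankel_chi_unit //.
- by rewrite (polar_powsum_normalized A0).
- case=> [|[|[|[|[|[|//]]]]]] _; try by rewrite chi_h // h.
  + rewrite chi_h4 etaE dual; apply: eq_bigr => i _; rewrite Vsigma !mxE -/(s i); ring.
  + have sym (x y : 'cV[F]_3) : (x^T *m y) 0 0 = (y^T *m x) 0 0.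
      by rewrite !mxE; apply: eq_bigr => i _; rewrite !mxE mulrC.
    have E : gram_s v *m sigma v = VD *m (diag_mx (\row_i s i) *m (Vm *m sigma v)).
      by rewrite gram_sE !mulmxA.
    rewrite chi_h5 -mulmxA sym E dual Vsigma.
    by apply: eq_bigr => i _; rewrite mul_diag_mx !mxE -/(s i); ring.
move=> k j; case: k => [|[|[|//]]] _.
- by rewrite chi_m // m0; apply: eq_bigr => i _; rewrite expr0 mul1r.
- by rewrite chi_m // m1; apply: eq_bigr => i _; rewrite expr1 mulrC [tau _ _ * _]mulrC mulrC.
- have [->|jt] := eqVneq j t.
    by rewrite chi_mt m2t; apply: eq_bigr => i _; rewrite [tau _ _ * _]mulrC.
  rewrite chi_m2 // omegaE // dual; apply: eq_bigr => i _.
  by rewrite Vsigma !mxE [tau _ _ * _]mulrC.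
Qed.

End Generic.
Lemma coord_mv k j : polyfn (fun v => mv v k j).
Proof. exact/polyfn_lin/coord_lform. Qed.

(* Off the zeros of delta, both the Gram matrix is invertible and 1, s, s^2 is a
   basis of the algebra. *)
Let num v : F := (\adj (gram v) *m gram_rhs v) (inord 2) 0.
Let delta v : F := \det (gram v) * num v.

Let table_poly (f : V -> seq (seq F)) :
  (forall i j, polyfn (fun v => nth 0 (nth [::] (f v) i) j)) ->
  forall i j, polyfn (fun v => (\matrix_(i < 3, j < 3) nth 0 (nth [::] (f v) i) j) i j).
Proof.
move=> H i j; rewrite (_ : (fun v => _) = fun v => nth 0 (nth [::] (f v) i) j) //.
by apply: funext => v; rewrite mxE.
Qed.

Let gram_poly i j : polyfn (fun v => gram v i j).
Proof.
apply: table_poly => {}i {}j.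
case: i => [|[|[|i]]]; case: j => [|[|[|j]]] //=; rewrite ?nth_nil;
  try exact: hv_poly; try exact: coord_mv; exact: polyfn_cst.
Qed.

Let gram_s_poly i j : polyfn (fun v => gram_s v i j).
Proof.
apply: table_poly => {}i {}j.
case: i => [|[|[|i]]]; case: j => [|[|[|j]]] //=; rewrite ?nth_nil;
  try exact: hv_poly; try exact: coord_mv; exact: polyfn_cst.
Qed.

Let eta_poly i j : polyfn (fun v => gram_rhs v i j).
Proof.
rewrite (_ : (fun v => _) = fun v => nth 0 [:: hv v 2; hv v 3; mv v 2 t] i).
  by case: i => -[|[|[|i]]] //= _; [exact: hv_poly | exact: hv_poly | exact: coord_mv].
by apply: funext => v; rewrite mxE.
Qed.

Let num_poly : polyfn num.
Proof.
have HR := polyfn_ring V; apply: (rp_mulmx HR) => //; exact: (rp_adj HR).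
Qed.

Let det_poly : polyfn (fun v => \det (gram v)).
Proof. by apply: (rp_det (polyfn_ring V)). Qed.

Let delta_poly : polyfn delta. Proof. exact: polyfn_mul. Qed.

Let delta_gram v : delta v != 0 -> gram v \in unitmx.
Proof. by rewrite mulf_eq0 negb_or unitmxE unitfE => /andP []. Qed.

Let sigma2E v : gram v \in unitmx -> sigma v (inord 2) 0 = num v / \det (gram v).
Proof. by move=> Gu; rewrite /sigma /invmx Gu -scalemxAl mxE mulrC. Qed.

Let delta_sigma v : delta v != 0 -> sigma v (inord 2) 0 != 0.
Proof.
move=> dv; rewrite sigma2E ?delta_gram //; move: dv.
by rewrite mulf_eq0 negb_or => /andP [dG nv]; rewrite mulf_neq0 ?invr_eq0.
Qed.

Let rat_detV : ratfn delta (fun v => (\det (gram v))^-1).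
Proof.
apply: (ratfn_divides num_poly) => v; rewrite /delta mulf_eq0 negb_or => /andP [dG _].
by rewrite mulrAC divff // mul1r.
Qed.

Let sigma_rat i j : ratfn delta (fun v => sigma v i j).
Proof.
have HS := ratfn_ring delta_poly.
apply: (rp_mulmx HS); last by move=> k l; apply: ratfn_poly; apply: eta_poly.
apply: ratfn_invmx => // [k l|v /delta_gram]; first exact/ratfn_poly/gram_poly.
by rewrite unitmxE unitfE.
Qed.

Let chi_rat (i : I) : ratfn delta (fun v => chi v i : F).
Proof.
have HS := ratfn_ring delta_poly.
have RT m (X : V -> 'cV[F]_m) : (forall i j, ratfn delta (fun v => X v i j)) ->
    forall i j, ratfn delta (fun v => (X v)^T i j).
  move=> RX k l; rewrite (_ : (fun v => _) = fun v => X v l k) //.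
  by apply: funext => v; rewrite mxE.
have Reta k l : ratfn delta (fun v => gram_rhs v k l) by apply: ratfn_poly; apply: eta_poly.
have Rgs k l : ratfn delta (fun v => gram_s v k l).
  by apply: ratfn_poly; apply: gram_s_poly.
have Rom j k l : ratfn delta (fun v => omega v j k l).
  rewrite (_ : (fun v => _) = fun v => mv v k j).
    by apply: ratfn_poly; apply: coord_mv.
  by apply: funext => v; rewrite mxE.
case: i => [k|[k j]].
  have [k4|k4] := eqVneq (k : nat) 4%N.
    rewrite (_ : (fun v => _) = fun v => ((gram_rhs v)^T *m sigma v) 0 0).
      by apply: (rp_mulmx HS) => //; apply: RT.
    by apply: funext => v; rewrite ffunE k4.
  have [k5|k5] := eqVneq (k : nat) 5%N.
    rewrite (_ : (fun v => _) =
       fun v => ((sigma v)^T *m gram_s v *m sigma v) 0 0).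
      by apply: (rp_mulmx HS) => //; apply: (rp_mulmx HS) => //; apply: RT.
    by apply: funext => v; rewrite ffunE k5.
  rewrite (_ : (fun v => _) = fun v => hv v k).
    by apply: ratfn_poly; apply: hv_poly.
  by apply: funext => v; rewrite ffunE (negbTE k4) (negbTE k5).
have [kj|kj] := boolP ((k == 2 :> nat) && (j != t)).
  rewrite (_ : (fun v => _) = fun v => ((omega v j)^T *m sigma v) 0 0).
    by apply: (rp_mulmx HS) => //; apply: RT.
  by apply: funext => v; rewrite ffunE kj.
rewrite (_ : (fun v => _) = fun v => mv v k j).
  by apply: ratfn_poly; apply: coord_mv.
by apply: funext => v; rewrite ffunE (negbTE kj).
Qed.

Lemma concise_smooth w : pcone (@powsum F q.+1 d 3) w ->
  gram (chart_pi w) \in unitmx -> sigma (chart_pi w) (inord 2) 0 != 0 ->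
  smooth_at (pcone (@powsum F q.+1 d 3)) w.
Proof.
move=> Zw Gw sw; have [A0 hA0] := x0prod_neq0 uu.
have Hchi v : delta v != 0 -> Hmx (chi v) \in unitmx.
  by move=> dv; apply: hankel_chi_unit; [exact: delta_gram | exact: delta_sigma].
apply: (@chart_smooth _ _ _ (@powsum F q.+1 d 3) _ _ _ _ chart_pi
   delta (fun v => moment_form d u (chi v)) _ _ _ _ _ _ _ (x0prod u) A0) => //.
- by move=> b; apply: powsum_poly.
- exact: powsum_cone.
- exact: powsum_neq0.
- exact: card_chart.
- by move=> i a x y; rewrite !ffunE polar_lform.
- rewrite /delta (_ : gram 0 = 0) ?det0 ?mul0r //.
  apply/matrixP => i j; rewrite !mxE /hv /mv !ffunE.
  by case: i => -[|[|[|i]]] //= _; case: j => -[|[|[|j]]].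
- apply: (ratfn_moment_form uu delta_poly chi_rat).
    by move=> v /Hchi; rewrite unitmxE unitfE.
  exists 2, (fun v => \det (gram v) ^+ 3); split.
    by apply: (rp_exp (polyfn_ring V)).
  move=> v dv; have Gu := delta_gram dv.
  rewrite det_hankel_chi ?delta_sigma // sigma2E //.
  move: dv; rewrite /delta mulf_eq0 negb_or => /andP [dG nv].
  by field; rewrite dG nv.
- move=> v dv; apply/ffunP => i; rewrite ffunE polar_chi //; first exact: delta_gram.
  exact: delta_sigma.
- by move=> v P /Hchi Hu; apply: moment_form_vanish.
- exact: x0prod_poly.
- move=> A hA dA; apply: chi_generic => //; first exact: delta_gram.
  exact: delta_sigma.
rewrite /delta mulf_neq0 //; first by move: Gw; rewrite unitmxE unitfE.
by apply: contraNneq sw => n0; rewrite sigma2E // n0 mul0r.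
Qed.

End ConciseChart.

Section SymmetricForm.
Variables (F : numClosedFieldType) (n : nat) (u : 'M[F]_n.+1).
Hypothesis uu : u \in unitmx.

(* The form with prescribed symmetric polarization c on the basis u. *)
Fixpoint sympoly d (c : seq 'I_n.+1 -> F) : {mpoly F[n.+1]} :=
  if d is d'.+1
  then \sum_j linf (dual_vec u (delta_mx 0 j)) * sympoly d' (fun s => c (j :: s))
  else (c [::])%:MP.

Lemma sympoly_homog d c : sympoly d c \is d.-homog.
Proof.
elim: d c => [|d IH] c /=.
  by rewrite -[_%:MP]mulr1 mul_mpolyC; apply/dhomogZ/dhomog1.
by apply: rpred_sum => j _; apply: (dhomogM (linf_homog _) (IH _)).
Qed.

Definition symform d c : Defs.form F n d := DHomog (sympoly_homog d c).

Lemma dual_act_sympoly d (c : seq 'I_n.+1 -> F) i :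
  (forall s s', perm_eq s s' -> c s = c s') ->
  dual_act (row i u) (sympoly d.+1 c) = d.+1%:R *: sympoly d (fun s => c (i :: s)).
Proof.
elim: d c i => [|d IH] c i Hc.
  rewrite /= (linear_sum (@dual_act F n (row i u))) (bigD1 i) //= big1 ?addr0 => [|j ji];
    rewrite dual_actM dual_act_linf dual_actC mulr0 addr0 dot_dual_vec // mxE eqxx.
    by rewrite eqxx mpolyC1 mul1r scale1r.
  by rewrite eq_sym (negbTE ji) mpolyC0 mul0r.
have Hci j s s' : perm_eq s s' -> c (j :: s) = c (j :: s').
  by move=> ss'; apply: Hc; rewrite perm_cons.
have E e (f : seq 'I_n.+1 -> F) : sympoly e.+1 f = \sum_j
    linf (dual_vec u (delta_mx 0 j)) * sympoly e (fun s => f (j :: s)) by [].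
rewrite E (linear_sum (@dual_act F n (row i u))).
rewrite (eq_bigr (fun j => (i == j)%:R *: sympoly d.+1 (fun s => c (j :: s)) +
   d.+1%:R *: (linf (dual_vec u (delta_mx 0 j)) *
     sympoly d (fun s => c (i :: j :: s))))); last first.
  move=> j _; rewrite [LHS]dual_actM dual_act_linf dot_dual_vec // mxE eqxx andTb.
  rewrite mul_mpolyC; rewrite [i == j]eq_sym; congr (_ + _).
  rewrite (IH (fun s => c (j :: s))) //; last exact: Hci.
  rewrite -scalerAr; congr (_ *: (_ * sympoly _ _)); apply: funext => s.
  by apply: Hc; exact: (permEl (perm_catCA [:: j] [:: i] s)).
have H1 : \sum_j (i == j)%:R *: sympoly d.+1 (fun s => c (j :: s))
    = sympoly d.+1 (fun s => c (i :: s)).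
  rewrite (bigD1 i) // eqxx scale1r big1 => [|j /negbTE ji]; first exact: addr0.
  by rewrite eq_sym ji scale0r.
rewrite big_split H1 -scaler_sumr [d.+2%:R]mulrS scalerDl scale1r E.
by [].
Qed.

Lemma polar_symform d (c : seq 'I_n.+1 -> F) e :
  (forall s s', perm_eq s s' -> c s = c s') -> size e = d ->
  polar (word u e) (symform d c) = c e.
Proof.
move=> Hc ed.
suff E : Ds (word u e) (sympoly d c) = (d`!%:R * c e)%:MP.
  by rewrite /polar /= E mcoeffC eqxx mulr1 mulrC mulKf // fact_neq0.
elim: e d c Hc ed => [|i e IH] d c Hc <- /=; first by rewrite fact0 mul1r.
rewrite -Ds_dual_act (dual_act_sympoly _ _ Hc) linearZ /=.
rewrite (IH _ (fun s => c (i :: s))) //; last first.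
  by move=> s s' ss'; apply: Hc; rewrite perm_cons.
by rewrite -mul_mpolyC -mpolyCM factS natrM mulrA.
Qed.

End SymmetricForm.

Section QuarticChart.
Variable F : numClosedFieldType.
Local Notation W := (Defs.form F 2 4).
Variable u : 'M[F]_3.
Hypothesis uu : u \in unitmx.
Local Notation I := ('I_5 + 'I_4)%type.
Local Notation V := {ffun I -> F^o}.
Implicit Types v : V.
Local Notation i0 := (i0 1).
Local Notation i1 := (i1 1).
Local Notation it := (@ix 1 ord0).

Definition qh v k : F := v (inl (inord k)).
Definition qg v k : F := v (inr (inord k)).
Definition qH v : 'M[F]_3 := \matrix_(i, j) qh v (i + j).
Definition qgcol v a : 'cV[F]_3 := \col_k qg v (a + k).
Definition qform (K : 'M[F]_3) (x y : 'cV[F]_3) : F := (x^T *m K *m y) 0 0.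
Definition qp v a : F := nth 0 [:: qform (invmx (qH v)) (qgcol v 0) (qgcol v 0);
  qform (invmx (qH v)) (qgcol v 0) (qgcol v 1);
  qform (invmx (qH v)) (qgcol v 1) (qgcol v 1)] a.
Definition qpcol v : 'cV[F]_3 := \col_k qp v k.

(* The moment of s^a t^b; those with b >= 2 are forced by the Hankel matrix. *)
Definition qmoment v a b : F :=
  match b with
  | 0 => qh v a
  | 1 => qg v a
  | 2 => qp v a
  | 3 => qform (invmx (qH v)) (qgcol v a) (qpcol v)
  | _ => qform (invmx (qH v)) (qpcol v) (qpcol v)
  end.

Definition quartic_form v : W :=
  symform u 4 (fun e => qmoment v (count_mem i1 e) (count_mem it e)).

Lemma polar_quartic_form v e : size e = 4%N ->
  polar (word u e) (quartic_form v) = qmoment v (count_mem i1 e) (count_mem it e).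
Proof.
by move=> e4; rewrite polar_symform // => s s' /permP H; rewrite !H.
Qed.

Lemma count_words (e : seq 'I_3) : (count_mem i1 e + count_mem it e <= size e)%N.
Proof.
elim: e => //= j e IH.
have : ((j == i1) + (j == it) <= 1)%N by case: eqP => [->|_]; case: eqP.
lia.
Qed.

Lemma moment_ind (P : nat -> nat -> Prop) :
  P 0 0 -> P 1 0 -> P 2 0 -> P 3 0 -> P 4 0 -> P 0 1 -> P 1 1 -> P 2 1 -> P 3 1 ->
  P 0 2 -> P 1 2 -> P 2 2 -> P 0 3 -> P 1 3 -> P 0 4 ->
  forall a b, (a + b <= 4)%N -> P a b.
Proof.
do 15!move=> ?; move=> [|[|[|[|[|a]]]]] [|[|[|[|[|b]]]]] //;
  by move=> H; exfalso; move: H; lia.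
Qed.

Section QuarticGeneric.
Variables (v : V) (c s tau : 'I_3 -> F).
Hypothesis Hu : qH v \in unitmx.
Hypothesis hE : forall k, (k <= 4)%N -> qh v k = \sum_i c i * s i ^+ k.
Hypothesis gE : forall k, (k <= 3)%N -> qg v k = \sum_i c i * (s i ^+ k * tau i).

Let Vm : 'M[F]_3 := \matrix_(i, j) s i ^+ j.
Let VD : 'M[F]_3 := Vm^T *m diag_mx (\row_i c i).
Let leq2 (i : 'I_3) : (i <= 2)%N. Proof. by rewrite -ltnS. Qed.

Let HE : qH v = VD *m Vm.
Proof.
apply/matrixP => i j; rewrite /VD mul_mx_diag !mxE hE.
  by apply: eq_bigr => l _; rewrite !mxE exprD; ring.
by have := (leq2 i, leq2 j) => -[]; lia.
Qed.

Let VDu : VD \in unitmx. Proof. by move: Hu; rewrite HE unitmx_mul => /andP []. Qed.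

Let qformE (x y : 'cV[F]_3) :
  qform (invmx (qH v)) (VD *m x) (VD *m y) = \sum_i c i * (x i 0 * y i 0).
Proof.
have Vu : Vm \in unitmx by move: Hu; rewrite HE unitmx_mul => /andP [].
have E : invmx (qH v) *m (VD *m y) = invmx Vm *m y.
  by apply: (can_inj (mulKmx Hu)); rewrite mulKVmx // HE -(mulmxA VD) mulKVmx.
rewrite /qform -mulmxA E /VD !trmx_mul tr_diag_mx trmxK -!mulmxA mulKVmx // mxE.
by apply: eq_bigr => i _; rewrite mul_diag_mx !mxE; ring.
Qed.

Let VDmx m (X : 'M[F]_(3, m)) i j : (VD *m X) i j = \sum_k c k * (s k ^+ i * X k j).
Proof.
rewrite mxE; apply: eq_bigr => k _; rewrite /VD mul_mx_diag !mxE; ring.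
Qed.

Let gcolE a : (a <= 1)%N -> qgcol v a = VD *m \col_i (s i ^+ a * tau i).
Proof.
move=> a1; apply/colP => k; rewrite VDmx mxE gE; last by have := leq2 k; lia.
by apply: eq_bigr => i _; rewrite mxE exprD; ring.
Qed.

Let pE a : (a <= 2)%N -> qp v a = \sum_i c i * (s i ^+ a * tau i ^+ 2).
Proof.
case: a => [|[|[|//]]] _; rewrite /qp /= !gcolE // qformE;
  by apply: eq_bigr => i _; rewrite !mxE; ring.
Qed.

Let pcolE : qpcol v = VD *m \col_i tau i ^+ 2.
Proof.
apply/colP => k; rewrite VDmx mxE pE //.
by apply: eq_bigr => i _; rewrite mxE.
Qed.

Lemma qmoment_generic a b : (a + b <= 4)%N ->
  qmoment v a b = \sum_i c i * (s i ^+ a * tau i ^+ b).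
Proof.
move: a b; apply: moment_ind;
  rewrite /qmoment /= ?hE // ?gE // ?pE // ?pcolE ?gcolE // ?qformE;
  by apply: eq_bigr => i _; rewrite ?mxE; ring.
Qed.

Lemma polar_quartic_generic e : size e = 4%N ->
  polar (word u e) (quartic_form v)
  = \sum_i c i * \prod_(j <- e) idx_rec 1 (s i) (fun=> tau i) j.
Proof.
move=> e4; rewrite polar_quartic_form // qmoment_generic; last first.
  by rewrite -e4 count_words.
apply: eq_bigr => i _; congr (_ * _); elim: (e) => [|j l IH].
  by rewrite big_nil mulr1.
rewrite big_cons -IH /=; case: (idxP j) => [||j'].
- by rewrite idx_rec0 mul1r.
- by rewrite idx_rec1 exprS mulrA.
- by rewrite idx_recx ord1 eqxx exprS; ring.
Qed.

End QuarticGeneric.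

(* Where t has a nonzero s^2-component, a fifth Hankel moment turns the data into
   a point of the algebra chart. *)
Section QuarticAlgebra.
Variable v : V.
Hypothesis Hu : qH v \in unitmx.
Let al : 'cV[F]_3 := invmx (qH v) *m qgcol v 0.
Hypothesis al2 : al (inord 2) 0 != 0.

Let h5 : F := (qg v 3 - al 0 0 * qh v 3 - al 1 0 * qh v 4) / al (inord 2) 0.
Let w : {ffun 'I_6 + 'I_3 * 'I_1 -> F^o} := [ffun i : 'I_6 + 'I_3 * 'I_1 => match i with
  | inl k => if (k < 5)%N then qh v k else h5
  | inr (k, _) => qg v k end].

Let wh k : (k <= 4)%N -> hv w k = qh v k.
Proof. by move=> k4; rewrite /hv ffunE inordK ?ltnS ?k4 // ltnW. Qed.
Let wh5 : hv w 5 = h5. Proof. by rewrite /hv ffunE inordK. Qed.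
Let wg k j : (k <= 2)%N -> mv w k j = qg v k.
Proof. by move=> k2; rewrite /mv ffunE inordK. Qed.

Let leq2 (i : 'I_3) : (i <= 2)%N. Proof. by rewrite -ltnS. Qed.

Let HwE : Hmx w = qH v.
Proof.
by apply/matrixP => i j; rewrite !mxE wh //; have := (leq2 i, leq2 j) => -[]; lia.
Qed.
Let Hwu : Hmx w \in unitmx. Proof. by rewrite HwE. Qed.

Let N := Nmx w.
Let A := alg_elt N (acoef w it).
Let e0 : 'cV[F]_3 := delta_mx 0 0.

Let AN : A * N = N * A.
Proof.
have := alg_elt_comm N (acoef w it) (acoef w i1).
by rewrite alg_elt_acoef1.
Qed.

Let Ae0 : A *m e0 = al.
Proof.
rewrite /A /N (alg_elt_delta Hwu) /al -HwE.
have -> : qgcol v 0 = mcol w ord0.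
  by apply/colP => k; rewrite !mxE wg.
by apply/colP => l; rewrite mxE /acoef idx_recx.
Qed.

Let HN : Hmx w *m N = H1mx w. Proof. by rewrite /N /Nmx mulKVmx. Qed.

Let NAe0 : N * A *m e0 = invmx (qH v) *m qgcol v 1.
Proof.
apply: (can_inj (mulKmx Hu)); rewrite mulKVmx // -HwE -mulmxE -mulmxA Ae0 mulmxA HN.
have Hal : qH v *m al = qgcol v 0 by rewrite /al mulKVmx.
apply/colP; apply: ord3P.
- move/colP/(_ 1): Hal; rewrite !mxE => <-; apply: eq_bigr => i _.
  by rewrite !mxE wh ?add0n ?add1n //; have := leq2 i; lia.
- move/colP/(_ (inord 2)): Hal; rewrite !mxE => H.
  transitivity (qg v (0 + @inord 2 2)); last by rewrite inordK.
  rewrite -H; apply: eq_bigr => i _.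
  by rewrite !mxE wh ?inordK ?add1n //; have := leq2 i; lia.
- have E (i : 'I_3) : H1mx w (inord 2) i = hv w (2 + i).+1 by rewrite mxE inordK.
  rewrite [LHS]mxE [RHS]mxE sum3 !E !inordK // wh // wh // [hv w _]wh5 /h5.
  by field.
Qed.

Let HT : (Hmx w)^T = Hmx w.
Proof. by apply/matrixP => i j; rewrite !mxE addnC. Qed.

Let selfadj (X : 'M[F]_3) := X^T *m Hmx w = Hmx w *m X.

Let selfN : selfadj N.
Proof.
rewrite /selfadj -[in LHS]HT -trmx_mul HN; apply/matrixP => i j.
by rewrite !mxE addnC.
Qed.

Let self1 : selfadj 1. Proof. by rewrite /selfadj trmx1 mul1mx mulmx1. Qed.

Let selfM X Y : selfadj X -> selfadj Y -> X * Y = Y * X -> selfadj (X * Y).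
Proof.
rewrite /selfadj => sX sY XY; rewrite {1}XY -!mulmxE trmx_mul.
by rewrite -mulmxA sY !mulmxA sX.
Qed.

Let selfX l : selfadj (N ^+ l).
Proof.
elim: l => [|l IH]; first exact: self1.
by rewrite exprS; apply: selfM => //; rewrite -exprS exprSr.
Qed.

Let selfA : selfadj A.
Proof.
rewrite /selfadj /A /alg_elt linear_sum /= mulmx_suml mulmx_sumr.
by apply: eq_bigr => l _; rewrite linearZ /= -scalemxAl selfX scalemxAr.
Qed.

Let lam_bil X Y : selfadj X -> lam w (X * Y) = ((X *m e0)^T *m Hmx w *m (Y *m e0)) 0 0.
Proof.
move=> sX; rewrite /lam -mulmxE trmx_mul -(mulmxA e0^T) sX /e0 trmx_delta.
by rewrite [row 0 _]rowE !mulmxA.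
Qed.

Let lam_qform X Y x y : selfadj X -> X *m e0 = invmx (qH v) *m x ->
  Y *m e0 = invmx (qH v) *m y -> lam w (X * Y) = qform (invmx (qH v)) x y.
Proof.
move=> sX EX EY; rewrite lam_bil // EX EY -HwE /qform trmx_mul trmx_inv HT.
by rewrite -(mulmxA x^T) mulVmx // mulmx1 mulmxA.
Qed.

Let A0 : A *m e0 = invmx (qH v) *m qgcol v 0. Proof. exact: Ae0. Qed.

Let lam02 : lam w (A * A) = qp v 0. Proof. exact: lam_qform. Qed.
Let lam12 : lam w (A * (N * A)) = qp v 1. Proof. exact: lam_qform. Qed.
Let selfNA : selfadj (N * A). Proof. by apply: selfM. Qed.
Let lam22 : lam w ((N * A) * (N * A)) = qp v 2. Proof. exact: lam_qform. Qed.

Let AAe0 : A * A *m e0 = invmx (qH v) *m qpcol v.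
Proof.
apply: (can_inj (mulKmx Hu)); rewrite mulKVmx //; apply/colP.
have E k : (qH v *m (A * A *m e0)) k 0 = lam w (N ^+ k * (A * A)).
  rewrite lam_bil; last exact: selfX.
  by rewrite (N_delta Hwu) trmx_delta -mulmxA -rowE HwE [RHS]mxE.
apply: ord3P; rewrite E mxE ?inordK //=.
- by rewrite mul1r lam02.
- by rewrite expr1 mulrA -AN -mulrA lam12.
- by rewrite expr2 -mulrA [N * (A * A)]mulrA -AN -mulrA mulrA lam22.
Qed.

Let lam_moment a b : (a + b <= 4)%N -> lam w (N ^+ a * A ^+ b) = qmoment v a b.
Proof.
have Nk (k : nat) : A * N ^+ k = N ^+ k * A.
  by apply: commrX; exact: AN.
have lA k : (k <= 2)%N -> lam w (N ^+ k * A) = qg v k.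
  by move=> k2; rewrite -Nk (lam_mv Hwu) // wg.
have lh k : (k <= 4)%N -> lam w (N ^+ k) = qh v k.
  by move=> k4; rewrite (lam_N Hwu) ?wh // ltnW.
move: a b; apply: moment_ind; rewrite /qmoment ?expr0 ?mulr1 ?mul1r ?expr1.
- by rewrite -(expr0 N) lh.
- by rewrite -(expr1 N) lh.
- exact: lh.
- exact: lh.
- exact: lh.
- by have := lA 0 isT; rewrite mul1r.
- exact: (lA 1 isT).
- exact: lA.
- have N2 : N ^+ 2 *m e0 = delta_mx (inord 2) 0 by rewrite -(N_delta Hwu) inordK.
  rewrite exprSr -mulrA lam_bil; last exact: selfX.
  rewrite NAe0 N2 -mulmxA HwE mulKVmx // trmx_delta -rowE !mxE inordK //.
- by rewrite expr2 lam02.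
- by rewrite expr2 mulrA -AN -mulrA lam12.
- by rewrite !expr2 -mulrA [N * (A * A)]mulrA -AN -mulrA mulrA lam22.
- by rewrite exprS expr2; apply: lam_qform.
- by rewrite exprS expr2 mulrA; apply: lam_qform.
- rewrite (exprD A 2 2) expr2; apply: lam_qform => //.
  by apply: selfM.
Qed.

Lemma quartic_form_vanish_generic P : vanish (@powsum F 2 4 3) P ->
  peval P (quartic_form v) = 0.
Proof.
move=> HP; rewrite -(moment_form_vanish (isT : (0 < 4)%N) uu Hwu HP).
congr (peval P _); apply: (polar_ext uu) => e e4.
rewrite polar_quartic_form // (polar_moment_form_lam uu) // -lam_moment; last first.
  by rewrite -e4 count_words.
congr (lam w _); elim: (e) => [|j l IH]; first by rewrite big_nil mulr1.
rewrite big_cons -IH /=; case: (idxP j) => [||j'].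
- by rewrite (alg_elt_acoef0 w) mul1r.
- by rewrite (alg_elt_acoef1 w) exprS mulrA.
- rewrite ord1 eqxx add0n add1n exprS -/N -/A !mulrA; congr (_ * _).
  by apply/esym; apply: commrX; exact: AN.
Qed.

End QuarticAlgebra.

Let qh_poly k : polyfn (fun v => qh v k). Proof. exact/polyfn_lin/coord_lform. Qed.
Let qg_poly k : polyfn (fun v => qg v k). Proof. exact/polyfn_lin/coord_lform. Qed.
Let qH_poly i j : polyfn (fun v => qH v i j).
Proof.
by rewrite (_ : (fun v => _) = fun v => qh v (i + j)) //; apply: funext => v; rewrite mxE.
Qed.
Let qgcol_poly a i j : polyfn (fun v => qgcol v a i j).
Proof.
by rewrite (_ : (fun v => _) = fun v => qg v (a + i)) //; apply: funext => v; rewrite mxE.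
Qed.

Let delta v : F := \det (qH v).
Let delta_poly : polyfn delta. Proof. by apply: (rp_det (polyfn_ring V)). Qed.
Let delta_unit v : delta v != 0 -> qH v \in unitmx.
Proof. by rewrite unitmxE unitfE. Qed.

Let HS := ratfn_ring delta_poly.

Let K_rat i j : ratfn delta (fun v => invmx (qH v) i j).
Proof.
apply: ratfn_invmx => // [k l|]; first exact/ratfn_poly/qH_poly.
by apply: (@ratfn_divides _ _ _ _ (fun=> 1)) => [|v dv];
  [exact: polyfn_cst | rewrite mulfV].
Qed.

Let qform_rat (x y : V -> 'cV[F]_3) :
  (forall i j, ratfn delta (fun v => x v i j)) ->
  (forall i j, ratfn delta (fun v => y v i j)) ->
  ratfn delta (fun v => qform (invmx (qH v)) (x v) (y v)).
Proof.
move=> Rx Ry; apply: (rp_mulmx HS) => // i j; apply: (rp_mulmx HS) => // k l.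
rewrite (_ : (fun v => _) = fun v => x v l k) //.
by apply: funext => v; rewrite mxE.
Qed.

Let qgcol_rat a i j : ratfn delta (fun v => qgcol v a i j).
Proof. exact/ratfn_poly/qgcol_poly. Qed.

Let qpcol_rat i j : ratfn delta (fun v => qpcol v i j).
Proof.
rewrite (_ : (fun v => _) = fun v => qp v i); last by apply: funext => v; rewrite mxE.
by rewrite /qp; case: i => -[|[|[|i]]] //= _; apply: qform_rat.
Qed.

Let qmoment_rat a b : (a + b <= 4)%N -> ratfn delta (fun v => qmoment v a b).
Proof.
move: a b; apply: moment_ind; rewrite /qmoment /qp /=;
  by [apply: ratfn_poly | apply: qform_rat].
Qed.

Let quartic_rat b : lform b -> ratfn delta (fun v => b (quartic_form v)).
Proof.
apply: (rp_polar uu HS) => e e4.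
rewrite (_ : (fun v => _) = fun v => qmoment v (count_mem i1 e) (count_mem it e)).
  by apply: qmoment_rat; rewrite -e4 count_words.
by apply: funext => v; rewrite polar_quartic_form.
Qed.

Lemma quartic_form_vanish v P : qH v \in unitmx -> vanish (@powsum F 2 4 3) P ->
  peval P (quartic_form v) = 0.
Proof.
move=> Hu HP.
have [M [k [Pk Hk]]] := rp_comp HS quartic_rat (peval_polyfn P).
pose al v := (\adj (qH v) *m qgcol v 0) (inord 2) 0.
have al_poly : polyfn al.
  have HR := polyfn_ring V; apply: (rp_mulmx HR) => //; exact: (rp_adj HR).
have alE x : qH x \in unitmx ->
    (invmx (qH x) *m qgcol x 0) (inord 2) 0 = (delta x)^-1 * al x.
  by move=> Hx; rewrite /invmx Hx -scalemxAl mxE.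
pose x0 : V := [ffun i : I => match i with
   | inl k => (k == 2 :> nat)%:R : F | inr k => (k == 0 :> nat)%:R : F end].
have H0 : qH x0 *m qH x0 = 1%:M.
  have E i j : qH x0 i j = ((i + j)%N == 2)%:R.
    rewrite mxE /qh ffunE inordK //.
    have l2 (l : 'I_3) : (l <= 2)%N by rewrite -ltnS.
    by have := (l2 i, l2 j) => -[]; lia.
  apply/matrixP; apply: ord3P; apply: ord3P; rewrite mxE sum3 !E mxE ?inordK //=;
    rewrite -?val_eqE /= ?inordK //=; by rewrite ?mul0r ?mulr0 ?mulr1 ?addr0 ?add0r.
have [Hx0 _] := mulmx1_unit H0.
have d0 : delta x0 != 0 by move: Hx0; rewrite unitmxE unitfE.
have al0 : al x0 != 0.
  apply/eqP => H; have := alE x0 Hx0; rewrite H mulr0.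
  have -> : invmx (qH x0) *m qgcol x0 0 = qH x0 *m qgcol x0 0.
    by apply: (can_inj (mulKmx Hx0)); rewrite mulKVmx // mulmxA H0 mul1mx.
  rewrite mxE sum3 !mxE /qh /qg !ffunE !inordK //= !mul0r mul1r !addr0 => /eqP.
  by rewrite oner_eq0.
have H x : delta x * k x = 0.
  have nz : delta x0 * al x0 != 0 by rewrite mulf_neq0.
  apply: (polyfn_density (polyfn_mul delta_poly Pk) (polyfn_mul delta_poly al_poly) nz).
  move=> {}x; rewrite mulf_eq0 negb_or => /andP [dx ax].
  have Hx := delta_unit dx.
  rewrite -Hk // (quartic_form_vanish_generic Hx) ?mulr0 //.
  by rewrite alE // mulf_neq0 // invr_eq0.
have dv : delta v != 0 by move: Hu; rewrite unitmxE unitfE.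
have /eqP := H v; rewrite -Hk // !mulf_eq0 expf_eq0 (negbTE dv) andbF /=.
by move/eqP.
Qed.

Lemma quartic_smooth w : pcone (@powsum F 2 4 3) w ->
  \det (hankel u w) != 0 -> smooth_at (pcone (@powsum F 2 4 3)) w.
Proof.
move=> Zw Hw; pose pi (w : W) : V := [ffun i : I => match i with
  | inl k => polar (word u (hw 1 4 k)) w
  | inr k => polar (word u (mw 4 k ord0)) w end].
have hpi x k : (k <= 4)%N -> qh (pi x) k = polar (word u (hw 1 4 k)) x.
  by move=> k5; rewrite /qh ffunE inordK.
have gpi x k : (k <= 3)%N -> qg (pi x) k = polar (word u (mw 4 k ord0)) x.
  by move=> k5; rewrite /qg ffunE inordK.
have leq2 (i : 'I_3) : (i <= 2)%N by rewrite -ltnS.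
have Hpi x : qH (pi x) = hankel u x.
  apply/matrixP => i j; rewrite !mxE hpi //.
  by have := (leq2 i, leq2 j) => -[]; lia.
have [A0 hA0] := x0prod_neq0 uu.
have cnt a b : count_mem a (nseq b i0) = ((i0 == a) * b)%N.
  by rewrite count_nseq.
have cnt1 a b : count_mem a (nseq b i1) = ((i1 == a) * b)%N.
  by rewrite count_nseq.
apply: (@chart_smooth _ _ _ (@powsum F 2 4 3) _ _ _ _ pi
   delta quartic_form _ _ _ _ _ _ _ (x0prod u) A0) => //.
- by move=> b; apply: powsum_poly.
- exact: powsum_cone.
- exact: powsum_neq0.
- by rewrite dimvf card_sum !card_ord.
- by move=> i a x y; rewrite !ffunE; case: i => k; rewrite polar_lform.
- rewrite /delta (_ : qH 0 = 0) ?det0 //.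
  by apply/matrixP => i j; rewrite !mxE /qh ffunE.
- move=> v /delta_unit Hu; apply/ffunP => -[k|k]; rewrite ffunE /=.
    have k5 : (k <= 4)%N by rewrite -ltnS.
    rewrite polar_quartic_form ?size_hw // !count_cat !cnt !cnt1 /=.
    by rewrite !mul0n mul1n /= /qh inord_val.
  have k5 : (k <= 3)%N by rewrite -ltnS.
  have := polar_quartic_form v (@size_mw 1 4 k ord0 k5); rewrite /= => ->.
  rewrite !count_cat !cnt !cnt1 /=.
  by rewrite !mul0n mul1n /= /qg inord_val.
- by move=> v P /delta_unit Hu; apply: quartic_form_vanish.
- exact: x0prod_poly.
- move=> A hA /delta_unit Hu; apply: (polar_ext uu) => e e4.
  have nz i : xcoord u A i i0 != 0 by move/prodf_neq0: hA; apply.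
  pose c i := xcoord u A i i0 ^+ 4; pose tau i j := xcoord u A i j / xcoord u A i i0.
  have tau0 i : tau i i0 = 1 by rewrite /tau mulfV.
  rewrite (@polar_quartic_generic _ c (tau^~ i1) (tau^~ it)) //.
  + rewrite (polar_powsum_normalized hA) //; apply: eq_bigr => i _; congr (_ * _).
    apply: eq_bigr => j _; case: (idxP j) => [||j'].
    * by rewrite idx_rec0 -/(tau i i0) tau0.
    * by rewrite idx_rec1 /tau.
    * by rewrite idx_recx (ord1 j') /tau.
  + move=> k k5; rewrite hpi // (polar_powsum_normalized hA) ?size_hw //.
    by apply: eq_bigr => i _; rewrite prod_hw // mulfV.
  + move=> k k5; rewrite gpi // (polar_powsum_normalized hA) ?size_mw //.
    by apply: eq_bigr => i _; rewrite prod_mw // mulfV.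
- by rewrite /delta Hpi.
Qed.

End QuarticChart.

Section Flattening.
Variables (F : numClosedFieldType) (n d : nat).
Hypothesis d_gt0 : (0 < d)%N.
Local Notation W := (Defs.form F n d).
Implicit Types (f : W) (a : 'rV[F]_n.+1).

Definition kills a f : Prop := dual_act a (mpoly_of_dhomog f) = 0.

Lemma kills_lin c a b f : kills a f -> kills b f -> kills (c *: a + b) f.
Proof. by rewrite /kills dual_actDl => -> ->; rewrite scaler0 addr0. Qed.

Lemma kills0 f : kills 0 f.
Proof. by rewrite /kills /dual_act big1 // => i _; rewrite mxE scale0r. Qed.

(* A derivation kills f as soon as the polarization does along basis words. *)
Lemma kills_sep (u : 'M[F]_n.+1) a f : u \in unitmx ->
  (forall e, size e = d.-1 -> polar (a :: word u e) f = 0) -> kills a f.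
Proof.
move=> uu H; apply: (Ds_sep uu (k := d.-1)).
  by apply: dual_act_homog; rewrite prednK //; apply: dhomog_is_dhomog.
move=> e ed; have /eqP := H e ed; rewrite /polar /= mulf_eq0 invr_eq0.
by rewrite (negbTE (fact_neq0 F d)) orbF -Ds_dual_act => /eqP.
Qed.

Lemma polar_kills a s f : kills a f -> a \in s -> polar s f = 0.
Proof. exact: polar_dual_act0. Qed.

Local Notation N := #|{: d.-1.-tuple 'I_n.+1}|.
Definition flattening f : 'M[F]_(n.+1, N) :=
  \matrix_(i, e) polar (row i (1%:M : 'M[F]_n.+1) :: word 1%:M (enum_val e : d.-1.-tuple 'I_n.+1)) f.

Lemma mul_flattening a f e :
  (a *m flattening f) 0 e = polar (a :: word 1%:M (enum_val e : d.-1.-tuple 'I_n.+1)) f.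
Proof.
have E : a = \sum_i a 0 i *: row i (1%:M : 'M[F]_n.+1).
  by rewrite [LHS]row_sum_delta; apply: eq_bigr => i _; rewrite row1.
rewrite mxE [in RHS]E polar_suml.
by apply: eq_bigr => i _; rewrite mxE.
Qed.

Lemma killsE a f : kills a f <-> a *m flattening f = 0.
Proof.
split=> H.
  apply/rowP => e; rewrite mul_flattening mxE; apply: (polar_kills H).
  exact: mem_head.
apply: (kills_sep (unitmx1 _ _)) => e /eqP ed.
move/rowP/(_ (enum_rank (Tuple ed))): H.
by rewrite mul_flattening enum_rankK mxE.
Qed.

(* A basis of the dual space adapted to the kernel of the flattening. *)
Lemma adapted_basis f : exists2 u : 'M[F]_n.+1, u \in unitmx &
  forall a, kills (a *m u) f <-> forall j : 'I_n.+1, (j < \rank (flattening f))%N -> a 0 j = 0.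
Proof.
set L := flattening f; exists (invmx (col_ebase L)); first by rewrite unitmx_inv col_ebase_unit.
move=> a.
have E0 (C : 'M[F]_n.+1) (M X : 'M[F]_(n.+1, N)) : C \in unitmx -> M = C *m X ->
    a *m invmx C *m M = a *m X.
  by move=> uC ->; rewrite mulmxA mulmxKV.
rewrite killsE -/L (E0 _ L (pid_mx (\rank L) *m row_ebase L)) ?col_ebase_unit //; last first.
  by rewrite mulmxA mulmx_ebase.
rewrite mulmxA.
have E : (a *m pid_mx (\rank L) *m row_ebase L == 0) = (a *m pid_mx (\rank L) == 0 :> 'rV_N).
  apply/eqP/eqP => [H|->]; last by rewrite mul0mx.
  by rewrite -(mulmxK (row_ebase_unit L) (a *m _)) H mul0mx.
have rk := rank_leq_col L.
split=> [/eqP|H].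
  rewrite E => /eqP H j jr; move/rowP/(_ (Ordinal (leq_trans jr rk))): H.
  rewrite !mxE (bigD1 j) //= big1 ?addr0 ?mxE ?eqxx ?jr ?mulr1 // => i ij.
  rewrite mxE /= (_ : (i == j :> nat) = false) ?mulr0 //.
  by apply/negbTE; apply: contraNneq ij => ij; apply/eqP/val_inj.
apply/eqP; rewrite E; apply/eqP/rowP => i; rewrite !mxE big1 // => j _.
rewrite mxE; case: ltnP => [jr|]; first by rewrite H ?mul0r.
by rewrite andbF mulr0.
Qed.

Lemma flattening_rank f : pcone (@powsum F n d 3) f -> (\rank (flattening f) <= 3)%N.
Proof.
apply: (@rank_pcone _ _ _ (@powsum F n d 3) _ _ _ flattening 3 (fun=> 1) 0) => //.
- by move=> b; apply: powsum_poly.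
- by move=> i j c x y; rewrite !mxE polar_lform.
- exact: polyfn_cst.
- exact: oner_neq0.
move=> A _; have -> : flattening (powsum d A) = A^T *m
    (\matrix_(k, e) \prod_(v <- word (1%:M : 'M[F]_n.+1) (enum_val e : d.-1.-tuple 'I_n.+1))
      dot v (row k A) : 'M_(3, N)).
  apply/matrixP => i e; rewrite !mxE polar_powsum; last first.
    by rewrite /= size_map size_tuple prednK.
  apply: eq_bigr => k _; rewrite big_cons !mxE; congr (_ * _).
  by rewrite dot_mx row1 -rowE !mxE.
by apply: leq_trans (mxrankM_maxl _ _) (rank_leq_col _).
Qed.

End Flattening.

Section Transvection.
Variables (F : fieldType) (q : nat) (u : 'M[F]_q.+2) (c : F).
Hypothesis uu : u \in unitmx.

(* The basis in which the first vector is modified by a multiple of the second. *)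
Definition transvect : 'M[F]_q.+2 := u - c *: (delta_mx (i0 q) (i1 q) *m u).

Lemma row_delta_mul (i j k : 'I_q.+2) :
  row k (delta_mx i j *m u) = (k == i)%:R *: row j u.
Proof.
apply/rowP => l; rewrite !mxE (bigD1 j) //= big1 ?addr0 ?mxE ?eqxx ?andbT //.
by move=> m mj; rewrite mxE (negbTE mj) andbF mul0r.
Qed.

Lemma row_transvect0 : row (i0 q) transvect = row (i0 q) u - c *: row (i1 q) u.
Proof. by rewrite /transvect linearB linearZ /= row_delta_mul eqxx scale1r. Qed.

Lemma row_transvect j : j != i0 q -> row j transvect = row j u.
Proof.
by move=> /negbTE j0; rewrite /transvect linearB linearZ /= row_delta_mul j0 scale0r scaler0 subr0.
Qed.

Lemma transvect_unit : transvect \in unitmx.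
Proof.
have E : transvect = (1%:M - c *: delta_mx (i0 q) (i1 q)) *m u.
  by rewrite mulmxBl mul1mx -scalemxAl.
rewrite E unitmx_mul uu andbT.
have H : (1%:M - c *: delta_mx (i0 q) (i1 q)) *m (1%:M + c *: delta_mx (i0 q) (i1 q))
   = 1%:M :> 'M[F]_q.+2.
  rewrite mulmxBl mul1mx mulmxDr mulmx1 -scalemxAl -scalemxAr mul_delta_mx_0 //.
  by rewrite !scaler0 addr0 addrK.
by case: (mulmx1_unit H).
Qed.

End Transvection.

Section Binary.
Variables (F : numClosedFieldType) (q d : nat).
Hypothesis d_ge2 : (2 <= d)%N.
Local Notation W := (Defs.form F q.+1 d).
Local Notation i0 := (i0 q).
Local Notation i1 := (i1 q).
Implicit Types (f : W) (u : 'M[F]_q.+2).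

Let d_gt0 : (0 < d)%N. Proof. exact: leq_trans d_ge2. Qed.

Definition binary u f : Prop := forall j, kills (row (ix j) u) f.

Lemma binary_transvect u c f : binary u f -> binary (transvect u c) f.
Proof. by move=> H j; rewrite row_transvect. Qed.

Lemma word_binary e : (forall j, ix j \notin e) -> size e = d ->
  perm_eq e (hw q d (count_mem i1 e)).
Proof.
move=> He ed; apply/permP => P; rewrite count_cat !count_nseq.
have E : (count P e = P i0 * (size e - count_mem i1 e) + P i1 * count_mem i1 e)%N.
  elim: e He {ed} => [|j e IH] He; first by rewrite !muln0.
  have {}IH := IH (fun l => let: conj _ H := norP (He l) in H).
  have ce := count_size (pred1 i1) e.
  rewrite [count P _]/= IH /=; case: (idxP j) (He) => [||l Hl].
  - by rewrite /= add0n => _; rewrite subSn // mulnS addnA.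
  - by rewrite eqxx => _; rewrite add1n subSS mulnS; lia.
  - by have := Hl l; rewrite mem_head.
by rewrite E ed.
Qed.

(* A binary form is determined by its Hankel moments. *)
Lemma polar_binary u f e : binary u f -> size e = d ->
  polar (word u e) f = if has (fun j => (j != i0) && (j != i1)) e then 0
                       else polar (word u (hw q d (count_mem i1 e))) f.
Proof.
move=> Hf ed; case: ifP => [/hasP[j je jn]|/negbT/hasPn H].
  case: (idxP j) jn je => [||l]; rewrite ?eqxx ?andbF // => _ le.
  by apply: (polar_kills (Hf l)); apply: map_f.
apply: polar_perm; apply: perm_map; apply: word_binary => // j.
by apply/negP => /H; rewrite negb_and !negbK => /orP [] /eqP.
Qed.

Lemma binary_word_kills u f e : binary u f ->
  has (fun j => (j != i0) && (j != i1)) e -> polar (word u e) f = 0.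
Proof.
move=> Hf /hasP[j je jn]; case: (idxP j) jn je => [||l]; rewrite ?eqxx ?andbF // => _ le.
by apply: (polar_kills (Hf l)); apply: map_f.
Qed.

(* A binary form with a two-term recurrence on its moments is a limit of sums of
   two powers. *)
Lemma recurrence_sigma2 u f x y : u \in unitmx -> f != 0 -> binary u f ->
  (forall k, (k.+2 <= d)%N -> polar (word u (hw q d k.+2)) f =
     x * polar (word u (hw q d k)) f + y * polar (word u (hw q d k.+1)) f) ->
  pcone (@powsum F q.+1 d 2) f.
Proof.
move=> uu f0 Hf rec; split=> // P HP.
have [r Hr] := companion_roots (fun i : 'I_2 => if i == 0 :> nat then x else y).
pose h k := polar (word u (hw q d k)) f.
pose rho : 'rV[F]_2 := \row_i h i.
pose e0 : 'cV[F]_2 := delta_mx 0 0.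
pose N := companion r.
pose a (j : 'I_q.+2) (l : 'I_2) : F :=
  idx_rec (l == 0 :> nat)%:R (l == 1 :> nat)%:R (fun=> 0) j.
suff -> : f = alg_form d u rho e0 N a by apply: alg_form_vanish.
have Ne0 : N *m e0 = delta_mx 1 0.
  apply/colP => i; rewrite -colE !mxE; case: eqP => [/(congr1 val)|_] //.
  by rewrite andbT.
have Ne1 : N *m (N *m e0) = x *: e0 + y *: (N *m e0).
  rewrite Ne0 -colE; apply/colP => i; rewrite !mxE eqxx Hr.
  by case: i => -[|[|//]] lt /=; rewrite !mulr1 !mulr0 ?addr0 ?add0r.
have hN k : (k <= d)%N -> (rho *m N ^+ k *m e0) 0 0 = h k.
  have [m] := ubnP k; elim: m k => // m IH [|[|k]] km kd.
  - by rewrite expr0 mulmx1 -colE !mxE.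
  - by rewrite expr1 -mulmxA Ne0 -colE !mxE.
  rewrite !exprSr -!mulmxE -!mulmxA Ne1 mulmxDr -!scalemxAr mulmxDr -!scalemxAr.
  rewrite [LHS]mxE [X in X + _ = _]mxE [X in _ + X = _]mxE.
  rewrite (mulmxA rho) IH; [|by rewrite ltnW|by do 2!apply: ltnW].
  rewrite (mulmxA (N ^+ k)) (_ : N ^+ k *m N = N ^+ k.+1); last by rewrite exprSr.
  by rewrite mulmxA IH ?(ltnW kd) // /h rec.
have a0 : alg_elt N (a i0) = 1.
  by rewrite /alg_elt !big_ord_recl big_ord0 /a !idx_rec0 /= scale1r scale0r !addr0 expr0.
have a1 : alg_elt N (a i1) = N.
  by rewrite /alg_elt !big_ord_recl big_ord0 /a !idx_rec1 /= scale0r scale1r addr0 add0r expr1.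
have ax j : alg_elt N (a (ix j)) = 0.
  by rewrite /alg_elt big1 // => l _; rewrite /a idx_recx scale0r.
apply: (polar_ext uu) => e ed; rewrite (polar_alg_form uu) // (polar_binary Hf) //.
case: ifP => [/hasP[j je jn]|/negbT/hasPn H].
  suff -> : \prod_(j <- e) alg_elt N (a j) = 0 by rewrite mulmx0 mul0mx mxE.
  case: (idxP j) jn je => [||l]; rewrite ?eqxx ?andbF // => _ le.
  elim: (e) le => // j' e' IH; rewrite inE big_cons => /predU1P[<-|/IH ->].
    by rewrite ax mul0r.
  by rewrite mulr0.
have ce : (count_mem i1 e <= d)%N by rewrite -ed count_size.
rewrite -/(h _) -hN //; congr ((_ *m _ *m _) 0 0).
elim: (e) H => [|j l IH] H; first by rewrite big_nil.
rewrite big_cons -IH /=; last by move=> i il; apply: H; rewrite inE il orbT.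
have := H j (mem_head _ _); case: (idxP j) => [||j'].
- by rewrite a0 mul1r.
- by rewrite a1 eqxx exprS.
- by [].
Qed.

End Binary.

Section BinaryForms.
Variables (F : numClosedFieldType) (q d : nat).
Hypothesis d_ge2 : (2 <= d)%N.
Local Notation W := (Defs.form F q.+1 d).
Local Notation i0 := (i0 q).
Local Notation i1 := (i1 q).
Implicit Types (f : W) (u : 'M[F]_q.+2) (c : nat -> F).

Let d_gt0 : (0 < d)%N. Proof. exact: leq_trans d_ge2. Qed.

Definition moment u f k := polar (word u (hw q d k)) f.

(* The binary form of degree m with coefficients c in the first two derivations. *)
Definition binary_op m c u (p : {mpoly F[q.+2]}) :=
  \sum_(j < m.+1) c j *: Ds (word u (hw q m j)) p.

Lemma has_hw m j : has (fun j => (j != i0) && (j != i1)) (hw q m j) = false.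
Proof. by rewrite has_cat !has_nseq /= !andbF. Qed.

Lemma count_hw m j : count_mem i1 (hw q m j) = j.
Proof. by rewrite count_cat !count_nseq /= mul0n add0n mul1n. Qed.

Lemma polar_binary_cat u f m j e : binary u f -> (m <= d)%N -> (j <= m)%N ->
  size e = (d - m)%N ->
  polar (word u (e ++ hw q m j)) f =
    if has (fun j => (j != i0) && (j != i1)) e then 0 else moment u f (count_mem i1 e + j).
Proof.
move=> Hf md jm ed.
have s : size (e ++ hw q m j) = d by rewrite size_cat size_hw // ed subnK.
by rewrite (polar_binary d_ge2 Hf s) has_cat has_hw orbF /moment count_cat count_hw.
Qed.

Lemma Ds_binary_op u f m c s :
  (Ds s (binary_op m c u (mpoly_of_dhomog f)))@_0%MM / (d`!)%:R =
  \sum_(j < m.+1) c j * polar (s ++ word u (hw q m j)) f.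
Proof.
rewrite /binary_op (linear_sum (Ds s)) raddf_sum /= mulr_suml; apply: eq_bigr => j _.
by rewrite linearZ /= mcoeffZ -mulrA -Ds_cat.
Qed.

Lemma binary_op_moments u f m c : u \in unitmx -> binary u f -> (m <= d)%N ->
  binary_op m c u (mpoly_of_dhomog f) = 0 <->
  forall k, (k + m <= d)%N -> \sum_(j < m.+1) c j * moment u f (k + j) = 0.
Proof.
move=> uu Hf md; split=> [H k kd|H].
  have := Ds_binary_op u f m c (word u (hw q (d - m) k)).
  rewrite H linear0 mcoeff0 mul0r => /esym; apply: etrans.
  apply: eq_bigr => j _; congr (_ * _); rewrite -map_cat.
  have kdm : (k <= d - m)%N by rewrite leq_subRL // addnC.
  rewrite (@polar_binary_cat u f m j (hw q (d - m) k)) ?size_hw // -1?ltnS //.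
  by rewrite has_hw count_hw.
apply: (Ds_sep uu (k := (d - m)%N)).
  rewrite /binary_op; apply: rpred_sum => j _; apply: rpredZ; apply: Ds_homog.
  rewrite size_word size_hw -1?ltnS // addnC subnK //; exact: dhomog_is_dhomog.
move=> e ed; suff /eqP : \sum_(j < m.+1) c j * polar (word u e ++ word u (hw q m j)) f = 0.
  rewrite -Ds_binary_op mulf_eq0 invr_eq0 (negbTE (fact_neq0 F d)) orbF; exact: eqP.
have [He|He] := boolP (has (fun j => (j != i0) && (j != i1)) e).
  rewrite big1 // => j _.
  by rewrite -map_cat polar_binary_cat ?He ?mulr0 // -ltnS.
rewrite -[RHS](H (count_mem i1 e)); last first.
  by rewrite -(subnK md) leq_add2r -ed count_size.
apply: eq_bigr => j _.
by rewrite -map_cat polar_binary_cat ?(negbTE He) // -ltnS.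
Qed.

Section Transvected.
Variables (u : 'M[F]_q.+2) (t : F).
Local Notation u' := (transvect u t).

Lemma transvect_word a b : exists2 C : nat -> F, C (a + b)%N = t ^+ a &
  forall p, Ds (nseq a (row i0 u) ++ nseq b (row i1 u)) p =
    \sum_(i < (a + b).+1) C i *: Ds (word u' (hw q (a + b) i)) p.
Proof.
elim: a => [|a [C Ca HC]].
  exists (fun i => (i == b)%:R) => [|p]; first by rewrite eqxx.
  rewrite big_ord_recr /= eqxx scale1r big1 ?add0r => [|i _]; last first.
    by rewrite (ltn_eqF (ltn_ord i)) scale0r.
  by rewrite /hw add0n subnn /= /word map_nseq row_transvect.
exists (fun i => (i <= a + b)%:R * C i + t * ((0 < i)%:R * C i.-1)) => [|p].
  by rewrite addSn ltnn mul0r add0r mul1r Ca exprS.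
rewrite /= HC (_ : row i0 u = t *: row i1 u + row i0 u'); last first.
  by rewrite row_transvect0 addrC subrK.
rewrite dual_actDl addrC !(linear_sum (@dual_act F q.+1 _)) scaler_sumr.
transitivity (\sum_(i < (a + b).+2) ((i <= a + b)%:R * C i) *: Ds (word u' (hw q (a + b).+1 i)) p
  + \sum_(i < (a + b).+2) (t * ((0 < i)%:R * C i.-1)) *: Ds (word u' (hw q (a + b).+1 i)) p); last first.
  by rewrite -big_split /=; apply: eq_bigr => i _; rewrite scalerDl.
congr (_ + _).
  rewrite [RHS]big_ord_recr /= ltnn mul0r scale0r addr0; apply: eq_bigr => i _.
  rewrite leq_ord mul1r linearZ /=; congr (_ *: _).
  by rewrite /hw subSn ?leq_ord.
rewrite [RHS]big_ord_recl /= mul0r mulr0 scale0r add0r; apply: eq_bigr => i _.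
rewrite linearZ /= scalerA mul1r; congr (_ *: _).
rewrite /hw subSS /bump leq0n add1n.
rewrite -(row_transvect u t (j := i1)) //.
transitivity (Ds (word u' (i1 :: (nseq (a + b - i) i0 ++ nseq i i1))) p) => //.
apply/Ds_perm/perm_map.
by rewrite -cat1s perm_catCA.
Qed.

Lemma transvect_op m c : exists2 c', c' m = \sum_(j < m.+1) c j * t ^+ (m - j) &
  forall p, binary_op m c u p = binary_op m c' u' p.
Proof.
have H (j : 'I_m.+1) : exists C : nat -> F, C m = t ^+ (m - j) /\
    forall p, Ds (word u (hw q m j)) p = \sum_(i < m.+1) C i *: Ds (word u' (hw q m i)) p.
  have [C] := transvect_word (m - j) j; rewrite subnK -1?ltnS // => Cm HC.
  by exists C; split=> // p; rewrite -HC /word map_cat !map_nseq.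
have [C HC] := choice H.
exists (fun i => \sum_(j < m.+1) c j * C j i) => [|p].
  by apply: eq_bigr => j _; rewrite (HC j).1.
rewrite /binary_op.
under eq_bigr => j _ do rewrite (HC j).2 scaler_sumr.
rewrite exchange_big; apply: eq_bigr => i _; rewrite scaler_suml.
by apply: eq_bigr => j _; rewrite scalerA.
Qed.

End Transvected.

(* After a transvection an annihilating binary form involves the last power. *)
Lemma transvect_leading m c u p : (exists2 j : 'I_m.+1, c j != 0 & true) ->
  binary_op m c u p = 0 ->
  exists t c', c' m != 0 /\ binary_op m c' (transvect u t) p = 0.
Proof.
move=> [j0 cj0 _] Hc.
pose g : {poly F} := \poly_(i < m.+1) c (m - i)%N.
have [[t gt]|H] := pselect (exists t, g.[t] != 0); last first.
  have g0 : g = 0.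
    apply: horner_ext0 => t; apply/eqP; apply: contrapT => /negP gt.
    by apply: H; exists t.
  move/(congr1 (fun r : {poly F} => r`_(m - j0))): g0.
  rewrite coef_poly coef0 ltnS leq_subr subKn -1?ltnS // => E.
  by rewrite E eqxx in cj0.
have [c' c'm Hc'] := transvect_op u t m c.
exists t, c'; split; last by rewrite -Hc'.
rewrite c'm; move: gt; rewrite horner_poly (reindex_inj rev_ord_inj) /=.
by under eq_bigr => i _ do rewrite subSS subKn -1?ltnS //.
Qed.

Lemma quadric_sigma2 u f c : u \in unitmx -> f != 0 -> binary u f ->
  (exists2 j : 'I_3, c j != 0 & true) -> binary_op 2 c u (mpoly_of_dhomog f) = 0 ->
  pcone (@powsum F q.+1 d 2) f.
Proof.
move=> uu f0 Hf cn /(transvect_leading cn)[t [c' [c2 Hc]]].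
have uu' := transvect_unit t uu; have Hf' := binary_transvect t Hf.
have := binary_op_moments c' uu' Hf' d_ge2 => -[/(_ Hc) H _].
apply: (@recurrence_sigma2 _ _ _ d_ge2 _ f (- c' 0%N / c' 2) (- c' 1%N / c' 2) uu' f0 Hf') => k kd.
have := H k; rewrite addn2 => /(_ kd); rewrite !big_ord_recl big_ord0 /= /bump /=.
rewrite -/(moment _ _ _) -/(moment _ _ k) -/(moment _ _ k.+1) addn0 addn1 addn2 => E.
apply: (mulfI c2).
transitivity (- (c' 0%N * moment (transvect u t) f k) - c' 1%N * moment (transvect u t) f k.+1).
  by rewrite -[LHS]subr0 -E; ring.
by field.
Qed.

(* The cubic catalecticant of a form in the cone has rank at most three. *)
Lemma cubic_op u f : u \in unitmx -> (3 <= d)%N -> pcone (@powsum F q.+1 d 3) f ->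
  exists2 c : nat -> F, (exists2 j : 'I_4, c j != 0 & true) & binary_op 3 c u (mpoly_of_dhomog f) = 0.
Proof.
move=> uu d3 Zf; pose N := #|{: (d - 3).-tuple 'I_q.+2}|.
pose L (g : W) : 'M[F]_(4, N) := \matrix_(j, e)
  polar (word u (hw q 3 j) ++ word u (enum_val e : (d - 3).-tuple 'I_q.+2)) g.
have rk : (\rank (L f) <= 3)%N.
  apply: (@rank_pcone _ _ _ (@powsum F q.+1 d 3) _ _ _ L 3 (fun=> 1) 0) => //.
  - by move=> b; apply: powsum_poly.
  - by move=> i j c x y; rewrite !mxE polar_lform.
  - exact: polyfn_cst.
  - exact: oner_neq0.
  move=> A _; have -> : L (powsum d A) =
      (\matrix_(j < 4, k < 3) \prod_(v <- word u (hw q 3 j)) dot v (row k A)) *m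
      (\matrix_(k, e) \prod_(v <- word u (enum_val e : (d - 3).-tuple 'I_q.+2))
        dot v (row k A) : 'M_(3, N)).
    apply/matrixP => j e; rewrite !mxE polar_powsum //; last first.
      by rewrite size_cat !size_map size_tuple size_hw ?subnKC // -ltnS.
    by apply: eq_bigr => k _; rewrite big_cat !mxE.
  by apply: leq_trans (mxrankM_maxl _ _) (rank_leq_col _).
have /rowV0Pn[x /sub_kermxP xL x0] : kermx (L f) != 0.
  by rewrite kermx_eq0 /row_free neq_ltn ltnS rk.
have /existsP[j xj] : [exists j, x 0 j != 0].
  apply: contra_neqT x0 => /existsPn H; apply/rowP => j; rewrite mxE.
  by apply/eqP/negPn/H.
exists (fun j => x 0 (inord j)); first by exists j; rewrite ?inord_val.
apply: (Ds_sep uu (k := (d - 3)%N)).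
  rewrite /binary_op; apply: rpred_sum => l _; apply: rpredZ; apply: Ds_homog.
  rewrite size_word size_hw -1?ltnS // addnC subnK //; exact: dhomog_is_dhomog.
move=> e /eqP ed; have := Ds_binary_op u f 3 (fun j => x 0 (inord j)) (word u e).
have -> : \sum_(j < 4) x 0 (inord j) * polar (word u e ++ word u (hw q 3 j)) f
   = (x *m L f) 0 (enum_rank (Tuple ed)).
  rewrite mxE; apply: eq_bigr => l _; rewrite inord_val mxE enum_rankK.
  by congr (_ * _); apply: polar_perm; rewrite perm_catC.
by rewrite xL mxE => /eqP; rewrite mulf_eq0 invr_eq0 (negbTE (fact_neq0 F d)) orbF => /eqP.
Qed.

(* A binary form in the cone that is not a limit of sums of two powers has, after a
   transvection, a nonsingular Hankel matrix. *)
Lemma binary_hankel u f : u \in unitmx -> (4 <= d)%N -> binary u f ->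
  pcone (@powsum F q.+1 d 3) f -> ~ pcone (@powsum F q.+1 d 2) f ->
  exists t, \det (hankel (transvect u t) f) != 0.
Proof.
move=> uu d4 Hf Zf nZf; have d3 : (3 <= d)%N by apply: ltnW.
have [c cn /(transvect_leading cn)[t [c' [c3 Hc]]]] := cubic_op uu d3 Zf.
exists t; apply/negP => /det0P[x x0 xH]; apply: nZf.
have uu' := transvect_unit t uu; have Hf' := binary_transvect t Hf.
have := binary_op_moments c' uu' Hf' d3 => -[/(_ Hc) rec _].
pose h := moment (transvect u t) f.
have f0 : f != 0 by case: Zf.
pose b j := x 0 (inord j) : F.
apply: (@quadric_sigma2 (transvect u t) f b uu' f0 Hf').
  have /existsP[j xj] : [exists j, x 0 j != 0].
    apply: contra_neqT x0 => /existsPn H; apply/rowP => j; rewrite mxE.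
    by apply/eqP/negPn/H.
  by exists j; rewrite // /b inord_val.
apply/(binary_op_moments b uu' Hf' d_ge2).
have rec3 k : (k + 3 <= d)%N -> c' 3 * h k.+3 = - (c' 0%N * h k + c' 1%N * h k.+1 + c' 2 * h k.+2).
  move=> /rec; rewrite !big_ord_recr big_ord0 /= add0r addn0 addn1 addn2 addn3 -/h => /eqP.
  by rewrite addrC addr_eq0 => /eqP.
move=> k; have [m] := ubnP k; elim: m k => // m IH [|[|[|k]]] km kd.
1-3: set i := (X in (X + 2)%N) in kd *.
1-3: move/rowP/(_ (inord i)): (xH); rewrite !mxE => E; rewrite -[RHS]E; apply: eq_bigr => j _;
  by rewrite mxE /b inord_val inordK // addnC.
apply: (mulfI c3); rewrite mulr0 mulr_sumr.
transitivity (- (c' 0%N * (\sum_(j < 3) b j * h (k + j)) + c' 1%N * (\sum_(j < 3) b j * h (k.+1 + j))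
   + c' 2 * (\sum_(j < 3) b j * h (k.+2 + j)))); last first.
  by rewrite !IH ?mulr0 ?addr0 ?oppr0 //; lia.
rewrite !mulr_sumr -!big_split -sumrN; apply: eq_bigr => j _ /=.
have kj : (k + j + 3 <= d)%N by have := ltn_ord j; lia.
by rewrite mulrCA -/h !addSn rec3 //; ring.
Qed.

(* A binary cubic form is annihilated by a quadric. *)
Lemma binary_cubic_sigma2 u f : u \in unitmx -> d = 3%N -> f != 0 -> binary u f ->
  pcone (@powsum F q.+1 d 2) f.
Proof.
move=> uu d3 f0 Hf; pose M : 'M[F]_(3, 2) := \matrix_(i, j) moment u f (i + j).
have /rowV0Pn[x /sub_kermxP xM x0] : kermx M != 0.
  by rewrite kermx_eq0 /row_free neq_ltn ltnS rank_leq_col.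
have /existsP[j xj] : [exists j, x 0 j != 0].
  apply: contra_neqT x0 => /existsPn H; apply/rowP => j; rewrite mxE.
  by apply/eqP/negPn/H.
pose b j := x 0 (inord j) : F.
apply: (@quadric_sigma2 u f b uu f0 Hf); first by exists j; rewrite // /b inord_val.
apply/(binary_op_moments b uu Hf d_ge2) => k kd.
have k2 : (k < 2)%N by rewrite d3 addn2 in kd.
move/rowP/(_ (Ordinal k2)): xM; rewrite !mxE => E; rewrite -[RHS]E; apply: eq_bigr => l _.
by rewrite mxE /b inord_val addnC.
Qed.

End BinaryForms.

Section Rows.
Variable F : fieldType.

Definition rows3 n (a b c : 'rV[F]_n) : 'M[F]_(3, n) := \matrix_(i < 3) nth 0 [:: a; b; c] i.

Lemma mul_rows3 n (x : 'rV[F]_3) (a b c : 'rV[F]_n) :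
  x *m rows3 a b c = x 0 0 *: a + x 0 1 *: b + x 0 (inord 2) *: c.
Proof.
rewrite mulmx_sum_row !big_ord_recl big_ord0 addr0 !rowK /= addrA.
congr (_ + _ *: _ + _ *: _); first by congr (x 0 _); apply: val_inj.
by congr (x 0 _); apply: val_inj; rewrite /= inordK.
Qed.

Lemma mulmx_rows3 n m (a b c : 'rV[F]_n) (M : 'M_(n, m)) :
  rows3 a b c *m M = rows3 (a *m M) (b *m M) (c *m M).
Proof. by apply/row_matrixP => i; rewrite row_mul !rowK; case: i => -[|[|[|]]]. Qed.

Lemma rows3_unit (a b c : 'rV[F]_3) :
  (forall x y z, x *: a + y *: b + z *: c = 0 -> [/\ x = 0, y = 0 & z = 0]) ->
  rows3 a b c \in unitmx.
Proof.
move=> H; rewrite -row_free_unit -kermx_eq0; apply/rowV0P => v /sub_kermxP.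
rewrite mul_rows3 => /H[v0 v1 v2]; apply/rowP; apply: ord3P; by rewrite mxE.
Qed.

Lemma rows3_free (a b c : 'rV[F]_3) x y z : rows3 a b c \in unitmx ->
  x *: a + y *: b + z *: c = 0 -> [/\ x = 0, y = 0 & z = 0].
Proof.
move=> U E; pose v : 'rV[F]_3 := \row_i nth 0 [:: x; y; z] i.
have v0 : v = 0.
  rewrite -(mulmxK U v) mul_rows3 !mxE /= inordK //= E mul0mx //.
split; first by move/rowP/(_ 0): v0; rewrite !mxE.
  by move/rowP/(_ 1): v0; rewrite !mxE.
by move/rowP/(_ (inord 2)): v0; rewrite !mxE inordK.
Qed.

Lemma det3 (M : 'M[F]_3) : \det M =
  M 0 0 * (M 1 1 * M (inord 2) (inord 2) - M 1 (inord 2) * M (inord 2) 1)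
  - M 0 1 * (M 1 0 * M (inord 2) (inord 2) - M 1 (inord 2) * M (inord 2) 0)
  + M 0 (inord 2) * (M 1 0 * M (inord 2) 1 - M 1 1 * M (inord 2) 0).
Proof.
rewrite (expand_det_row M 0) !big_ord_recl big_ord0 addr0 /cofactor.
rewrite !(expand_det_row _ ord0) !big_ord_recl !big_ord0 /cofactor !det_mx11 !mxE.
have [m HM] : exists m : nat -> nat -> F, forall i j : 'I_3, M i j = m i j.
  by exists (fun i j => M (inord i) (inord j)) => i j; rewrite !inord_val.
rewrite !HM /= !inordK // /bump /= !add0n !expr0 expr1 sqrrN expr1n.
ring.
Qed.

End Rows.

Section Cyclic.
Variable F : numClosedFieldType.
Implicit Types (N P : 'M[F]_3).

Definition krylov N (x : 'rV[F]_3) := rows3 x (x *m N) (x *m N *m N).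
Definition cyclic_mx N := exists x, krylov N x \in unitmx.

Lemma cyclic_conj N P : P \in unitmx -> cyclic_mx (P *m N *m invmx P) -> cyclic_mx N.
Proof.
move=> Pu [x xu]; exists (x *m P); suff -> : krylov N (x *m P) = krylov (P *m N *m invmx P) x *m P.
  by rewrite unitmx_mul xu.
by rewrite /krylov mulmx_rows3 !mulmxA !(mulmxKV Pu).
Qed.

Lemma cyclic_shift N c : cyclic_mx (N - c%:M) -> cyclic_mx N.
Proof.
move=> [x xu]; exists x; apply: rows3_unit => a b e E.
set M := N - c%:M in xu; have EN : N = M + c%:M by rewrite /M subrK.
have xN y : y *m N = y *m M + c *: y by rewrite EN mulmxDr mul_mx_scalar.
have {E}[a0 b0 e0] : [/\ a + c * b + c ^+ 2 * e = 0, b + 2 * c * e = 0 & e = 0].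
  apply: (rows3_free xu); rewrite -[RHS]E !xN mulmxDl -scalemxAl.
  apply/rowP => j; rewrite !mxE; ring.
move: b0 a0; rewrite e0 !mulr0 !addr0 => b0; rewrite b0 mulr0 addr0 => a0.
by split.
Qed.

(* The determinant of the Krylov matrix of a matrix with zero first row is the product of
   a linear form and a binary quadratic form. *)
Lemma noncyclic_scalars (p1 p2 a b c e : F) :
  (forall x y z : F, ((y * (a * p1 + b * p2 - (a + e) * p1) + z * (c * p1 + e * p2 - (a + e) * p2))
     + (a * e - b * c) * x) * (y * (y * b + z * e) - z * (y * a + z * c)) = 0) ->
  [/\ b = 0, c = 0 & a = e] \/
  [/\ a * e - b * c = 0, a * p1 + b * p2 = (a + e) * p1 & c * p1 + e * p2 = (a + e) * p2].
Proof.
set l1 := a * p1 + b * p2 - _; set l2 := c * p1 + e * p2 - _; set D := a * e - b * c => H.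
have [D0|D0] := eqVneq D 0.
  have H2 y z : (y * l1 + z * l2) * (y * (y * b + z * e) - z * (y * a + z * c)) = 0.
    by have := H 0 y z; rewrite mulr0 addr0.
  have h1 : l1 * b = 0 by rewrite -(H2 1 0); ring.
  have h2 : l2 * c = 0 by apply/eqP; rewrite -oppr_eq0 -(H2 0 1); apply/eqP; ring.
  have h3 := H2 1 1; have h4 := H2 1 (-1).
  have h5 : l1 * (e - a) + l2 * b = 0.
    have : 2 * (l1 * (e - a) + l2 * b) = 0.
      transitivity ((1 * l1 + 1 * l2) * (1 * (1 * b + 1 * e) - 1 * (1 * a + 1 * c))
        - (1 * l1 + -1 * l2) * (1 * (1 * b + -1 * e) - -1 * (1 * a + -1 * c)) + 2 * (l2 * c)).
        by ring.
      by rewrite h3 h4 h2; ring.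
    by move/eqP; rewrite mulf_eq0 pnatr_eq0 => /eqP.
  have h6 : - (l1 * c) + l2 * (e - a) = 0.
    have : 2 * (- (l1 * c) + l2 * (e - a)) = 0.
      transitivity ((1 * l1 + 1 * l2) * (1 * (1 * b + 1 * e) - 1 * (1 * a + 1 * c))
        + (1 * l1 + -1 * l2) * (1 * (1 * b + -1 * e) - -1 * (1 * a + -1 * c)) - 2 * (l1 * b)).
        by ring.
      by rewrite h3 h4 h1; ring.
    by move/eqP; rewrite mulf_eq0 pnatr_eq0 => /eqP.
  have [l10|l10] := eqVneq l1 0; last first.
    have b0 : b = 0 by move/eqP: h1; rewrite mulf_eq0 (negbTE l10) => /eqP.
    have ea : e = a.
      move/eqP: h5; rewrite b0 mulr0 addr0 mulf_eq0 (negbTE l10) subr_eq0 => /eqP //.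
    move/eqP: h6; rewrite ea subrr mulr0 addr0 oppr_eq0 mulf_eq0 (negbTE l10) => /eqP c0.
    by left.
  have [l20|l20] := eqVneq l2 0; last first.
    have c0 : c = 0 by move/eqP: h2; rewrite mulf_eq0 (negbTE l20) => /eqP.
    have ea : e = a.
      move/eqP: h6; rewrite c0 mulr0 oppr0 add0r mulf_eq0 (negbTE l20) subr_eq0 => /eqP //.
    move/eqP: h5; rewrite ea subrr mulr0 add0r mulf_eq0 (negbTE l20) => /eqP b0.
    by left.
  by right; split=> //; apply/eqP; rewrite -subr_eq0; apply/eqP.
left; have {}H y z : y * (y * b + z * e) - z * (y * a + z * c) = 0.
  have := H ((1 - (y * l1 + z * l2)) / D) y z.
  by rewrite mulrCA mulfV // mulr1 addrC subrK mul1r.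
have b0 : b = 0 by rewrite -(H 1 0); ring.
have c0 : c = 0 by apply/eqP; rewrite -oppr_eq0 -(H 0 1); apply/eqP; ring.
split=> //; apply/eqP; rewrite eq_sym -subr_eq0 -(H 1 1) b0 c0; apply/eqP; ring.
Qed.

Lemma cyclic_or_quadratic N :
  cyclic_mx N \/ exists a b, N *m N = a *: N + b%:M.
Proof.
have [l /eigenvalueP[v vN v0]] := eigenvalue_closed N (isT : (0 < 3)%N).
pose P := row_ebase v; have Pu : P \in unitmx := row_ebase_unit v.
have [M EM] : exists M, M = P *m (N - l%:M) *m invmx P by exists (P *m (N - l%:M) *m invmx P).
have [cM|nM] := pselect (cyclic_mx M).
  by left; apply: (@cyclic_shift N l); apply: (cyclic_conj Pu); rewrite -EM.
right.
have M0 j : M 0 j = 0.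
  suff : row 0 P *m (N - l%:M) = 0.
    have -> : M 0 j = (row 0 M) 0 j by rewrite [RHS]mxE.
    by move=> E; rewrite EM !row_mul E mul0mx mxE.
  pose c := (col_ebase v *m (pid_mx (\rank v) : 'M_(1, 3))) 0 0.
  have vE : v = c *: row 0 P.
    rewrite -{1}(mulmx_ebase v) mulmx_sum_row (bigD1 0) //= big1 ?addr0 // => i i0.
    have rv : \rank v = 1%N by apply/eqP; rewrite eqn_leq rank_leq_row lt0n mxrank_eq0 v0.
    rewrite rv mxE big_ord1 mxE /= (_ : (0 == i :> nat) = false) ?mulr0 ?scale0r //.
    by apply/negbTE; rewrite eq_sym.
  have c0 : c != 0 by apply: contraNneq v0 => c0; rewrite vE c0 scale0r.
  apply: (scalerI c0); rewrite scaler0 scalemxAl -vE mulmxBr vN mul_mx_scalar subrr //.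
pose t : 'I_3 := inord 2.
suff [k Mk] : exists k, M *m M = k *: M.
  have E : (N - l%:M) *m (N - l%:M) = k *: (N - l%:M).
    have -> : N - l%:M = invmx P *m M *m P by rewrite EM !mulmxA mulVmx // mul1mx mulmxKV.
    rewrite !mulmxA mulmxK // -[_ *m M *m M]mulmxA Mk -scalemxAr -scalemxAl //.
  exists (k + 2 * l), (- (k * l) - l ^+ 2).
  move: E; rewrite mulmxBl !mulmxBr mul_mx_scalar mul_scalar_mx -scalar_mxM => E.
  apply/matrixP => i j; move/matrixP/(_ i j): E; rewrite !mxE => E.
  apply/eqP; rewrite -subr_eq0; move/eqP: E; rewrite -subr_eq0 => /eqP E.
  by apply/eqP; rewrite -[RHS]E; case: (i == j); rewrite ?mulr1n ?mulr0n; ring.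
have H (x y z : F) : ((y * (M 1 1 * M 1 0 + M 1 t * M t 0 - (M 1 1 + M t t) * M 1 0)
     + z * (M t 1 * M 1 0 + M t t * M t 0 - (M 1 1 + M t t) * M t 0))
     + (M 1 1 * M t t - M 1 t * M t 1) * x) *
     (y * (y * M 1 t + z * M t t) - z * (y * M 1 1 + z * M t 1)) = 0.
  pose X : 'rV[F]_3 := \row_i nth 0 [:: x; y; z] i.
  have /negP : ~ krylov M X \in unitmx by move=> u; apply: nM; exists X.
  rewrite unitmxE unitfE negbK => /eqP <-.
  have XM (Y : 'rV[F]_3) i : (Y *m M) 0 i = Y 0 1 * M 1 i + Y 0 t * M t i.
    by rewrite mxE sum3 M0 mulr0 add0r.
  rewrite det3 !mxE /= !inordK //= !XM !sum3 !M0 !mxE /= !inordK //= -/t; ring.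
have MM i j : (M *m M) i j = M i 1 * M 1 j + M i t * M t j.
  by rewrite mxE sum3 M0 mulr0 add0r.
case: (noncyclic_scalars H) => [[b0 c0 ae]|[D0 E1 E2]].
  exists (M 1 1); apply/matrixP; apply: ord3P => j; rewrite MM mxE ?M0 -/t ?b0 ?c0 -?ae; ring.
exists (M 1 1 + M t t).
apply/matrixP; apply: ord3P; apply: ord3P; rewrite MM mxE ?M0 -/t; try ring.
all: first [exact: E1 | exact: E2 | apply/eqP; rewrite -subr_eq0].
all: first [rewrite -oppr_eq0 -D0; apply/eqP; ring | rewrite -D0; apply/eqP; ring].
Qed.

End Cyclic.

Lemma commutator_sum (F : numFieldType) (G : 'M[F]_3) (v : 'rV[F]_(3 * 3)) i j :
  (vec_mx v *m G - G *m (vec_mx v)^T) i j =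
  \sum_k v 0 k * ((vec_mx (delta_mx 0 k) : 'M[F]_3) *m G
     - G *m (vec_mx (delta_mx 0 k))^T) i j.
Proof.
pose b (w : 'rV[F]_(3 * 3)) : F := (vec_mx w *m G - G *m (vec_mx w)^T) i j.
have Hb : lform b.
  move=> c x y; rewrite /b !mxE mulrBr !mulr_sumr -!sumrN -!big_split /=.
  by apply: eq_bigr => l _; rewrite !mxE; ring.
rewrite -/(b v) {1}[v]row_sum_delta (lform_sum Hb).
by apply: eq_bigr => k _; rewrite (lformZ Hb).
Qed.

Section Concise.
Variables (F : numClosedFieldType) (p d : nat).
Hypothesis d_ge3 : (3 <= d)%N.
Local Notation W := (Defs.form F p.+2 d).
Variables (u : 'M[F]_(p.+3)) (f : W).
Hypothesis uu : u \in unitmx.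
Hypothesis Hu : forall a, kills (a *m u) f <-> forall j : 'I_p.+3, (j < 3)%N -> a 0 j = 0.

Let d_gt0 : (0 < d)%N. Proof. exact: leq_trans d_ge3. Qed.

Definition em (x : 'rV[F]_3) : 'rV[F]_p.+3 := (row_mx x (0 : 'rV[F]_p) : 'rV_(3 + p)) *m u.

Definition base3 (B : 'M[F]_3) : 'M[F]_p.+3 :=
  (block_mx B 0 0 (1%:M : 'M[F]_p) : 'M_(3 + p)) *m u.

Lemma emP c x y : em (c *: x + y) = c *: em x + em y.
Proof. by rewrite /em scalemxAl -mulmxDl scale_row_mx add_row_mx scaler0 addr0. Qed.

Lemma base3_unit B : B \in unitmx -> base3 B \in unitmx.
Proof.
by move=> uB; rewrite unitmx_mul uu andbT unitmxE (@det_lblock _ 3 p) det1 mulr1 -unitmxE.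
Qed.

Lemma row_base3_lt B (i : 'I_p.+3) (k : 'I_3) : i = k :> nat -> row i (base3 B) = em (row k B).
Proof.
move=> ik; rewrite row_mul /em; congr (_ *m u).
have -> : i = lshift p k by apply: val_inj.
by rewrite (@rowKu _ 3 p (3 + p)) row_row_mx row0.
Qed.

Lemma row_base3_ge B (i : 'I_p.+3) : (3 <= i)%N -> kills (row i (base3 B)) f.
Proof.
move=> i3; rewrite row_mul; apply/Hu => j j3.
have ip : (i - 3 < p)%N by rewrite ltn_subLR.
have -> : i = rshift 3 (Ordinal ip) by apply: val_inj; rewrite /= subnKC.
have -> : j = lshift p (Ordinal j3) by apply: val_inj.
by rewrite mxE (@block_mxEdl _ 3 p 3 p) mxE.
Qed.

Lemma kills_em x : kills (em x) f -> x = 0.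
Proof.
move=> /Hu H; apply/rowP => k; rewrite mxE.
by have := H (lshift p k) (ltn_ord k); rewrite (@row_mxEl _ 1 3 p).
Qed.

(* A vector is determined by the polarizations along a basis of the essential part. *)
Lemma basis_sep B z : B \in unitmx ->
  (forall e : seq 'I_3, size e = d.-1 -> polar (em z :: [seq em (row i B) | i <- e]) f = 0) ->
  z = 0.
Proof.
move=> uB H; apply/kills_em/(kills_sep d_gt0 (base3_unit uB)) => e ed.
have [/hasP[i ie i3]|/hasPn e3] := boolP (has (fun i : 'I_p.+3 => 3 <= i)%N e).
  apply: (polar_kills (row_base3_ge B i3)); rewrite inE; apply/orP; right.
  exact: map_f.
rewrite -[RHS](H [seq inord (val i) | i <- e]) ?size_map // -map_comp.
congr (polar (_ :: _) f); apply/eq_in_map => i ie; apply: row_base3_lt.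
by rewrite inordK // ltnNge e3.
Qed.

Definition symmetric_mx N := forall x y,
  dual_act (em (x *m N)) (dual_act (em y) (mpoly_of_dhomog f)) =
  dual_act (em x) (dual_act (em (y *m N)) (mpoly_of_dhomog f)).

Lemma polar_symmetric N x y s : symmetric_mx N ->
  polar (em (x *m N) :: em y :: s) f = polar (em x :: em (y *m N) :: s) f.
Proof.
by move=> HN; rewrite /polar /= -!Ds_dual_act HN.
Qed.

Lemma polar_swap a b s : polar (a :: b :: s) f = polar (b :: a :: s) f.
Proof. by apply: polar_perm; rewrite (perm_catCA [:: a] [:: b]). Qed.

Lemma symmetric_lin c N N' : symmetric_mx N -> symmetric_mx N' -> symmetric_mx (c *: N + N').
Proof.
move=> H H' x y; rewrite !mulmxDr -!scalemxAr !emP.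
by rewrite dual_actDl [in RHS]dual_actDl linearP H H'.
Qed.

Lemma symmetric1 : symmetric_mx 1%:M.
Proof. by move=> x y; rewrite !mulmx1. Qed.

Lemma symmetric_commute N N' : symmetric_mx N -> symmetric_mx N' -> N *m N' = N' *m N.
Proof.
move=> H H'; apply/row_matrixP => i; rewrite !rowE; set x := delta_mx 0 i.
apply/eqP; rewrite -subr_eq0; apply/eqP; apply: (basis_sep (unitmx1 _ _)) => e.
case: e => [|j [|k e]] ed; [by move: ed => /=; lia|by move: ed => /=; lia|] => /=.
rewrite !row1; move: (delta_mx 0 j) (delta_mx 0 k) (map _ _) => y z s.
have -> : x *m (N *m N') - x *m (N' *m N) = (-1) *: (x *m N' *m N) + x *m N *m N'.
  by rewrite !mulmxA scaleN1r addrC.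
rewrite emP polarDl mulN1r addrC; apply/eqP; rewrite subr_eq0; apply/eqP.
have p3 a b c : polar (a :: b :: c :: s) f = polar (a :: c :: b :: s) f.
  by apply: polar_perm; rewrite perm_cons (perm_catCA [:: b] [:: c]).
rewrite (polar_symmetric _ _ _ H') p3 (polar_symmetric _ _ _ H) p3.
by rewrite -(polar_symmetric _ _ _ H') p3 -(polar_symmetric _ _ _ H) p3.
Qed.


Lemma em_mx x : em x = x *m ((row_mx 1%:M 0 : 'M_(3, 3 + p)) *m u).
Proof. by rewrite mulmxA (@mul_mx_row _ 1 3 3 p) mulmx1 mulmx0. Qed.

Let E : 'M[F]_(3, p.+3) := (row_mx 1%:M 0 : 'M_(3, 3 + p)) *m u.

(* Contractions of the form against a word, as bilinear forms on the essential part. *)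
Definition gram_e (e : (d - 2).-tuple 'I_p.+3) (g : W) : 'M[F]_3 := \matrix_(i, j)
  polar (em (delta_mx 0 i) :: em (delta_mx 0 j) :: word 1%:M e) g.

Lemma gram_eE e g x y :
  polar (em x :: em y :: word 1%:M (e : (d - 2).-tuple 'I_p.+3)) g = (x *m gram_e e g *m y^T) 0 0.
Proof.
have swap a b s : polar (a :: b :: s) g = polar (b :: a :: s) g.
  by apply: polar_perm; rewrite (perm_catCA [:: a] [:: b]).
have em_sum (z : 'rV[F]_3) : em z = \sum_i z 0 i *: em (delta_mx 0 i).
  rewrite {1}[z]row_sum_delta em_mx mulmx_suml; apply: eq_bigr => i _.
  by rewrite em_mx scalemxAl.
rewrite (em_sum x) polar_suml -mulmxA mxE; apply: eq_bigr => i _; congr (_ * _).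
rewrite swap (em_sum y) polar_suml mxE; apply: eq_bigr => j _.
by rewrite !mxE swap mulrC.
Qed.

Lemma gram_e_powsum e (A : 'M[F]_(3, p.+3)) : gram_e e (powsum d A) =
  (E *m A^T) *m diag_mx (\row_k \prod_(v <- word 1%:M e) dot v (row k A)) *m (E *m A^T)^T.
Proof.
apply/matrixP => i j; rewrite !mxE polar_powsum //; last first.
  by rewrite /= size_map size_tuple; lia.
apply: eq_bigr => k _; rewrite mul_mx_diag !mxE !big_cons.
have D (l : 'I_3) : dot (em (delta_mx 0 l)) (row k A) = (E *m A^T) l k.
  rewrite dot_mx em_mx -rowE [LHS]mxE [RHS]mxE; apply: eq_bigr => m _.
  by congr (_ * _); rewrite ?mxE ?[LHS]mxE.
by rewrite !D !mxE mulrCA mulrC -!mulrA.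
Qed.

Lemma symmetric_gram N : (forall e, N *m gram_e e f = gram_e e f *m N^T) -> symmetric_mx N.
Proof.
move=> H x y; apply/eqP; rewrite -subr_eq0; apply/eqP.
apply: (Ds_sep (unitmx1 _ _) (k := (d - 2)%N)).
  have Hd v w : dual_act v (dual_act w (mpoly_of_dhomog f)) \is (d - 2).-homog.
    apply: dual_act_homog; apply: dual_act_homog.
    by rewrite (_ : (d - 2).+2 = d); [apply: dhomog_is_dhomog|lia].
  rewrite rpredB; [by []|exact: Hd|exact: Hd].
move=> e /eqP ed; have := gram_eE (Tuple ed) f.
rewrite /polar /= => G; rewrite linearB /= mcoeffB.
have fi : (d`!)%:R^-1 != 0 :> F by rewrite invr_eq0 fact_neq0.
apply: (mulIf fi); rewrite mul0r mulrBl !Ds_dual_act !G.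
by rewrite trmx_mul !mulmxA -(mulmxA x) H !mulmxA subrr.
Qed.

Definition gap (g : W) : 'M[F]_(3 * 3, #|{: (d - 2).-tuple 'I_p.+3 * 'I_3 * 'I_3}|) :=
  \matrix_(k, c) let: (e, i, j) := enum_val c in
  let B := vec_mx (delta_mx 0 k) : 'M[F]_3 in (B *m gram_e e g - gram_e e g *m B^T) i j.

Lemma gapP v g : v *m gap g = 0 <->
  forall e, vec_mx v *m gram_e e g = gram_e e g *m (vec_mx v)^T.
Proof.
have G c : (v *m gap g) 0 c = let: (e, i, j) := enum_val c in
    (vec_mx v *m gram_e e g - gram_e e g *m (vec_mx v)^T) i j.
  rewrite mxE; under eq_bigr => k _ do rewrite mxE.
  by case: (enum_val c) => [[e i] j]; rewrite [RHS]commutator_sum.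
split=> [H e|H].
  apply/matrixP => i j; apply/eqP; rewrite -subr_eq0.
  have := G (enum_rank (e, i, j)); rewrite enum_rankK H mxE => ->.
  by rewrite !mxE.
apply/rowP => c; rewrite G; case: (enum_val c) => [[e i] j].
by rewrite H subrr !mxE.
Qed.

Lemma gap_lform k c : lform (fun g => gap g k c).
Proof.
case Ec: (enum_val c) => [[e i] j].
pose B : 'M[F]_3 := vec_mx (delta_mx 0 k).
pose ee (i : 'I_3) := em (delta_mx 0 i).
have G g : gap g k c = \sum_l (B i l * polar (ee l :: ee j :: word 1%:M e) g
    - B j l * polar (ee i :: ee l :: word 1%:M e) g).
  have -> : gap g k c = (B *m gram_e e g - gram_e e g *m B^T) i j by rewrite mxE Ec.
  move: B => B; rewrite mxE [X in X + _]mxE [X in _ + X]mxE [X in _ - X]mxE -sumrB.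
  by apply: eq_bigr => l _; rewrite !mxE [in X in _ - X]mulrC.
rewrite (funext G) => a g h; rewrite mulr_sumr -big_split.
apply: eq_bigr => l _.
have := polar_lform [:: ee l, ee j & word 1%:M e] a g h => ->.
have := polar_lform [:: ee i, ee l & word 1%:M e] a g h => ->.
move: (polar _ g) (polar _ h) (polar _ g) (polar _ h) => p1 p2 p3 p4 /=; ring.
Qed.

Lemma gap_rank : pcone (@powsum F p.+2 d 3) f -> (\rank (gap f) <= 6)%N.
Proof.
have [A0 hA0] : exists A0 : 'M[F]_(3, p.+3), \det (E *m A0^T) != 0.
  exists (lsubmx (invmx u : 'M_(p.+3, 3 + p)))^T.
  by rewrite trmxK mulmx_lsub /E mulmxK // row_mxKl det1 oner_eq0.
have HR := polyfn_ring ('M[F]_(3, p.+3)).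
apply: (@rank_pcone _ _ _ (@powsum F p.+2 d 3) _ _ _ gap 6 (fun A => \det (E *m A^T)) A0) => //.
- by move=> b; apply: powsum_poly.
- by move=> k c; apply: gap_lform.
- apply: (rp_det HR); apply: (rp_mulmx HR) => i j; first exact: (rp_cst HR).
  by apply: polyfn_lin => a A B; rewrite !mxE.
move=> A hA; have [X EX] : exists X, X = E *m A^T by exists (E *m A^T).
rewrite -EX in hA; have Xu : X \in unitmx by rewrite unitmxE unitfE.
pose Q : 'M[F]_(3, 3 * 3) := \matrix_k mxvec (X *m delta_mx k k *m invmx X).
have Q0 : Q *m gap (powsum d A) = 0.
  apply/row_matrixP => k; rewrite row_mul row0 rowK; apply/gapP => e.
  rewrite mxvecK gram_e_powsum -EX !trmx_mul; move: (\row_k0 _) => D.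
  rewrite !mulmxA mulmxKV // -[_ *m X^T *m _]mulmxA -trmx_mul mulVmx // trmx1 mulmx1.
  have C : delta_mx k k *m diag_mx D = diag_mx D *m (delta_mx k k)^T :> 'M[F]_3.
    apply/matrixP => i j; rewrite mul_diag_mx mul_mx_diag !mxE.
    by case: (eqVneq i k) => [->|]; case: (eqVneq j k) => [->|];
      rewrite ?mulr0 ?mul0r ?mulr1 ?mul1r.
  by rewrite -[X *m _ *m _]mulmxA C !mulmxA.
have rQ : \rank Q = 3%N.
  apply/eqP; rewrite -/(row_free Q) -kermx_eq0; apply/rowV0P => y /sub_kermxP yQ.
  have : mxvec (X *m diag_mx y *m invmx X) = 0.
    rewrite -yQ mulmx_sum_row diag_mx_sum_delta mulmx_sumr mulmx_suml linear_sum.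
    by apply: eq_bigr => k _; rewrite rowK -scalemxAr -scalemxAl linearZ.
  move/(congr1 vec_mx); rewrite mxvecK linear0 => H.
  have : diag_mx y = 0.
    by rewrite -[diag_mx y](mulKmx Xu) -[X *m _](mulmxKV Xu) H mul0mx mulmx0.
  by move/matrixP => D; apply/rowP => k; have := D k k; rewrite !mxE eqxx.
have := mulmx0_rank_max Q0; rewrite rQ => H; rewrite -(leq_add2l 3); exact: H.
Qed.

Hypothesis Zf : pcone (@powsum F p.+2 d 3) f.

Lemma symmetric_space : exists N1 N2, [/\ symmetric_mx N1, symmetric_mx N2 &
  forall a b c, a *: N1 + b *: N2 + c%:M = 0 -> [/\ a = 0, b = 0 & c = 0]].
Proof.
pose K := kermx (gap f); pose e1 : 'rV[F]_(3 * 3) := mxvec 1%:M.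
have Ksym v : (v <= K)%MS -> symmetric_mx (vec_mx v).
  by move=> /sub_kermxP/gapP; apply: symmetric_gram.
have rK : (3 <= \rank K)%N by rewrite mxrank_ker; have := gap_rank Zf; lia.
pose K' := (K :\: e1)%MS.
have rK' : (2 <= \rank K')%N.
  have := mxrank_cap_compl K e1; have := rank_leq_row e1.
  have := mxrankS (capmxSr K e1); rewrite -/K'; lia.
pose R : 'M[F]_(2, 3 * 3) := (pid_mx 2 : 'M_(2, \rank K')) *m row_base K'.
have RK : (R <= K')%MS by apply: submx_trans (submxMl _ _) _; rewrite eq_row_base.
have Rfree : row_free R.
  rewrite /row_free mxrankMfree ?row_base_free // rank_pid_mx //.
have rowK i : (row i R <= K)%MS.
  by apply: submx_trans (row_sub _ _) _; apply: submx_trans RK (diffmxSl _ _).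
exists (vec_mx (row 0 R)), (vec_mx (row 1 R)); split; [exact: Ksym|exact: Ksym|].
move=> a b c H.
pose y : 'rV[F]_2 := \row_i if i == 0 then a else b.
have yR : y *m R = - c *: e1.
  rewrite mulmx_sum_row !big_ord_recl big_ord0 addr0 !mxE /=.
  rewrite (_ : lift 0 0 = 1); last exact: val_inj.
  apply/eqP; rewrite scaleNr -addr_eq0; apply/eqP.
  have := congr1 mxvec H; rewrite !linearD !linearZ /= !vec_mxK linear0 => <-.
  by congr (_ + _); rewrite /e1 -linearZ /= scale_scalar_mx mulr1.
have c0 : c = 0.
  have : (y *m R <= K' :&: e1)%MS.
    rewrite sub_capmx (submx_trans (submxMl _ _) RK) yR scalemx_sub //.
  rewrite capmx_diff submx0 yR scaler_eq0 oppr_eq0 mxvec_eq0 => /orP[/eqP //|].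
  by rewrite -mxrank_eq0 mxrank1.
move: yR; rewrite c0 oppr0 scale0r => /eqP; rewrite mulmx_free_eq0 // => /eqP y0.
split=> //; first by move/rowP/(_ 0): y0; rewrite !mxE.
by move/rowP/(_ 1): y0; rewrite !mxE.
Qed.

End Concise.

Section ConciseCover.
Variables (F : numClosedFieldType) (p d : nat).
Hypothesis d_ge3 : (3 <= d)%N.
Local Notation W := (Defs.form F p.+2 d).
Variables (u : 'M[F]_(p.+3)) (f : W).
Hypothesis uu : u \in unitmx.
Hypothesis Hu : forall a, kills (a *m u) f <-> forall j : 'I_p.+3, (j < 3)%N -> a 0 j = 0.
Local Notation em := (em u).
Local Notation symmetric_mx := (symmetric_mx u f).

Lemma em0 : em 0 = 0.
Proof. by rewrite em_mx mul0mx. Qed.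

Lemma polar_em0 s : polar (em 0 :: s) f = 0.
Proof. by rewrite em0; apply: (polar_kills (kills0 f)); apply: mem_head. Qed.

Lemma polar_em0r a s : polar (a :: em 0 :: s) f = 0.
Proof. by rewrite polar_swap polar_em0. Qed.

Lemma polar_emZ c x s : polar (em (c *: x) :: s) f = c * polar (em x :: s) f.
Proof. by rewrite -[c *: x]addr0 emP polarDl polar_em0 addr0. Qed.

Lemma mem_perm_cons (a b : 'rV[F]_p.+3) s : b \in s ->
  polar (a :: s) f = polar (a :: b :: rem b s) f.
Proof. by move=> bs; apply: polar_perm; rewrite perm_cons perm_to_rem. Qed.

Section SquareZero.
Variables N1 N2 : 'M[F]_3.
Hypotheses (S1 : symmetric_mx N1) (S2 : symmetric_mx N2).
Hypotheses (N11 : N1 *m N1 = 0) (N12 : N1 *m N2 = 0).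
Hypotheses (N21 : N2 *m N1 = 0) (N22 : N2 *m N2 = 0).

Lemma square_zero_cyclic x : rows3 (x *m N1) (x *m N2) x \in unitmx -> False.
Proof.
move=> U; set a1 := x *m N1 in U *; set a2 := x *m N2 in U *.
pose phi z := polar (em z :: nseq d.-1 (em x)) f.
have K z : z *m N1 = 0 -> z *m N2 = 0 -> phi z = 0 -> z = 0.
  move=> z1 z2 z0; apply: (basis_sep d_ge3 uu Hu U) => e ed.
  have [i0|i0] := boolP (0 \in e).
    rewrite (@mem_perm_cons _ (em a1)); last by apply/mapP; exists 0; rewrite // rowK.
    by rewrite -(polar_symmetric _ _ _ S1) z1 polar_em0.
  have [i1|i1] := boolP (1 \in e).
    rewrite (@mem_perm_cons _ (em a2)); last by apply/mapP; exists 1; rewrite // rowK.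
    by rewrite -(polar_symmetric _ _ _ S2) z2 polar_em0.
  rewrite -[RHS]z0 /phi -ed; congr (polar (_ :: _) f).
  elim: (e) i0 i1 => //= i s IH; rewrite !inE !negb_or => /andP[i0 s0] /andP[i1 s1].
  rewrite IH //; congr cons; move: (i) i0 i1; apply: ord3P => //.
  by rewrite rowK /= inordK.
have z1 : a1 *m N1 = 0 by rewrite /a1 -mulmxA N11 mulmx0.
have z2 : a1 *m N2 = 0 by rewrite /a1 -mulmxA N12 mulmx0.
have z3 : a2 *m N1 = 0 by rewrite /a2 -mulmxA N21 mulmx0.
have z4 : a2 *m N2 = 0 by rewrite /a2 -mulmxA N22 mulmx0.
have : phi a2 *: a1 + - phi a1 *: a2 = 0.
  apply: K; rewrite ?mulmxDl -?scalemxAl ?z1 ?z2 ?z3 ?z4 ?scaler0 ?addr0 //.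
  by rewrite /phi emP polarDl polar_emZ -/(phi a1) -/(phi a2); ring.
move=> H; have := rows3_free (x := phi a2) (y := - phi a1) (z := 0) U.
rewrite scale0r addr0 H => /(_ erefl)[_ /eqP]; rewrite oppr_eq0 => /eqP /(K _ z1 z2) a10 _.
have := rows3_free (x := 1) (y := 0) (z := 0) U.
by rewrite a10 !scale0r scaler0 !addr0 => /(_ erefl)[/eqP]; rewrite oner_eq0.
Qed.

Lemma square_zero_degenerate (x y a : 'rV[F]_3) (c e : F) : c != 0 -> a != 0 -> x *m N1 = a -> x *m N2 = 0 ->
  y *m N2 = c *: a -> y *m N1 = e *: a -> False.
Proof.
move=> c0 a0 xN1 xN2 yN2 yN1.
have aN1 : a *m N1 = 0 by rewrite -xN1 -mulmxA N11 mulmx0.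
have aN2 : a *m N2 = 0 by rewrite -xN1 -mulmxA N12 mulmx0.
have U : rows3 x y a \in unitmx.
  apply: rows3_unit => i j k E.
  have j0 : j = 0.
    have := congr1 (mulmx^~ N2) E; rewrite !mulmxDl -!scalemxAl xN2 yN2 aN2 !scaler0 mul0mx.
    rewrite add0r addr0 scalerA => /eqP; rewrite scaler_eq0 (negbTE a0) orbF mulf_eq0 (negbTE c0).
    by rewrite orbF => /eqP.
  have i0 : i = 0.
    have := congr1 (mulmx^~ N1) E; rewrite !mulmxDl -!scalemxAl xN1 yN1 aN1 j0 !scaler0 scale0r.
    by rewrite mul0mx !addr0 => /eqP; rewrite scaler_eq0 (negbTE a0) orbF => /eqP.
  move: E; rewrite i0 j0 !scale0r !add0r => /eqP; rewrite scaler_eq0 (negbTE a0) orbF => /eqP.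
  by [].
have pax s : polar (em a :: em x :: s) f = 0.
  have -> : a = (c^-1 *: y) *m N2 by rewrite -scalemxAl yN2 scalerA mulVf // scale1r.
  by rewrite (polar_symmetric _ _ _ S2) xN2 polar_em0r.
have pa z s : z \in [:: x; y; a] -> polar (em a :: em z :: s) f = 0.
  rewrite !inE => /or3P[] /eqP ->; first exact: pax.
    rewrite -{1}xN1 (polar_symmetric _ _ _ S1) yN1 polar_swap polar_emZ pax mulr0 //.
  by rewrite -{1}xN1 (polar_symmetric _ _ _ S1) aN1 polar_em0r.
move/eqP: a0; apply; apply: (basis_sep d_ge3 uu Hu U) => -[|i w] ed.
  by move: ed => /=; lia.
rewrite /= rowK; apply: pa; exact: mem_nth.
Qed.

End SquareZero.

Lemma square_zero_dependent N1 N2 : symmetric_mx N1 -> symmetric_mx N2 ->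
  N1 *m N1 = 0 -> N1 *m N2 = 0 -> N2 *m N1 = 0 -> N2 *m N2 = 0 ->
  ~ (forall a b, a *: N1 + b *: N2 = 0 -> a = 0 /\ b = 0).
Proof.
move=> S1 S2 N11 N12 N21 N22 ind.
have dep (x : 'rV[F]_3) : exists ab : F * F, ab != 0 /\ ab.1 *: (x *m N1) + ab.2 *: (x *m N2) = 0.
  apply: contrapT => nd; have {}nd a b : a *: (x *m N1) + b *: (x *m N2) = 0 -> a = 0 /\ b = 0.
    move=> E; have [[-> ->] //|ab] := eqVneq (a, b) 0.
    by case: nd; exists (a, b).
  apply: (square_zero_cyclic S1 S2 N11 N12 N21 N22 (x := x)).
  apply: rows3_unit => a b c E.
  have c0 : c = 0.
    have := congr1 (mulmx^~ N1) E.
    rewrite !mulmxDl -!scalemxAl -!mulmxA N11 N21 !mulmx0 !scaler0 !add0r mul0mx => cE.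
    have [//|cn] := eqVneq c 0; have [] := nd 1 0.
      by rewrite scale1r scale0r addr0; apply: (scalerI cn); rewrite scaler0.
    by move/eqP; rewrite oner_eq0.
  by move: E; rewrite c0 scale0r addr0 => /nd[-> ->].
have [x xN1] : exists x : 'rV[F]_3, x *m N1 != 0.
  apply: contrapT => H; have [] := ind 1 0.
    rewrite scale0r addr0 scale1r; apply/row_matrixP => i; rewrite row0 rowE.
    by apply: contrapT => /eqP n0; apply: H; exists (delta_mx 0 i).
  by move/eqP; rewrite oner_eq0.
have [c xN2] : exists c, x *m N2 = c *: (x *m N1).
  have [[a b] /= [ab E]] := dep x.
  have b0 : b != 0.
    apply: contraNneq ab => b0; move/eqP: E; rewrite b0 scale0r addr0 scaler_eq0 (negbTE xN1) orbF.
    by move=> /eqP ->.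
  exists (- a / b); apply: (scalerI b0); rewrite scalerA mulrCA mulfV // mulr1.
  by apply/eqP; rewrite scaleNr -addr_eq0 addrC E.
pose N3 := - c *: N1 + N2.
have S3 : symmetric_mx N3 by apply: symmetric_lin.
have N13 : N1 *m N3 = 0 by rewrite mulmxDr -scalemxAr N11 N12 scaler0 addr0.
have N31 : N3 *m N1 = 0 by rewrite mulmxDl -scalemxAl N11 N21 scaler0 addr0.
have N33 : N3 *m N3 = 0 by rewrite {1}/N3 mulmxDl -scalemxAl N13 scaler0 add0r mulmxDr -scalemxAr N21 N22 scaler0 addr0.
have xN3 : x *m N3 = 0 by rewrite mulmxDr -scalemxAr xN2 scaleNr addNr.
have [y yN3] : exists y : 'rV[F]_3, y *m N3 != 0.
  apply: contrapT => H; have [] := ind (- c) 1.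
    rewrite scale1r -/N3; apply/row_matrixP => i; rewrite row0 rowE.
    by apply: contrapT => /eqP n0; apply: H; exists (delta_mx 0 i).
  by move=> _ /eqP; rewrite oner_eq0.
have par (z : 'rV[F]_3) : z *m N3 != 0 -> exists k, z *m N1 = k *: (z *m N3).
  move=> z3; have [[a b] /= [ab E]] := dep z.
  have {}E : (a + c * b) *: (z *m N1) + b *: (z *m N3) = 0.
    rewrite -[RHS]E mulmxDr -scalemxAr scalerDr scalerA addrA -scalerDl.
    by congr (_ *: _ + _); ring.
  have b0 : a + c * b != 0.
    apply: contraNneq ab => b0; move/eqP: E; rewrite b0 scale0r add0r scaler_eq0 (negbTE z3) orbF => /eqP b1.
    by move: b0; rewrite b1 mulr0 addr0 => ->.
  exists (- b / (a + c * b)); apply: (scalerI b0); rewrite scalerA mulrCA mulfV // mulr1.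
  by apply/eqP; rewrite scaleNr -addr_eq0 E.
have [k yN1] := par y yN3.
have [|l E] := par (x + y).
  by rewrite mulmxDl xN3 add0r.
rewrite !mulmxDl xN3 add0r yN1 in E.
have aE : x *m N1 = (l - k) *: (y *m N3) by rewrite scalerBl -E addrK.
have lk : l - k != 0 by apply: contraNneq xN1 => lk; rewrite aE lk scale0r.
apply: (@square_zero_degenerate N1 N3 S1 S3 N11 N13 x y (x *m N1) (l - k)^-1 (k / (l - k))) => //.
- by rewrite invr_eq0.
- by rewrite aE scalerA mulVf // scale1r.
- by rewrite yN1 aE scalerA divfK.
Qed.

End ConciseCover.

Section Moments.
Variables (F : numClosedFieldType) (p d : nat).
Hypothesis d_ge3 : (3 <= d)%N.
Local Notation W := (Defs.form F p.+2 d).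
Variables (u : 'M[F]_(p.+3)) (f : W).
Hypothesis uu : u \in unitmx.
Hypothesis Hu : forall a, kills (a *m u) f <-> forall j : 'I_p.+3, (j < 3)%N -> a 0 j = 0.
Local Notation em := (em u).
Local Notation symmetric_mx := (symmetric_mx u f).

Lemma cyclic_symmetric : pcone (@powsum F p.+2 d 3) f ->
  exists2 N, symmetric_mx N & cyclic_mx N.
Proof.
move=> Zf; apply: contrapT => nc.
have quad N : symmetric_mx N -> exists a b, N *m N = a *: N + b%:M.
  by move=> SN; have [cN|//] := cyclic_or_quadratic N; case: nc; exists N.
have shift N : symmetric_mx N -> exists c b,
    symmetric_mx (c%:M + N) /\ (c%:M + N) *m (c%:M + N) = b%:M.
  move=> SN; have [a [b NN]] := quad N SN.
  exists (- (a / 2)), (b + (a / 2) ^+ 2); split.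
    by rewrite -[- _]mulr1 -scale_scalar_mx; apply: symmetric_lin => //; apply: symmetric1.
  rewrite mulmxDl !mulmxDr NN !mul_mx_scalar !mul_scalar_mx.
  by apply/matrixP => i j; rewrite !mxE; case: (i == j); rewrite ?mulr1n ?mulr0n; field.
have [M1 [M2 [T1 T2 ind]]] := symmetric_space d_ge3 uu Zf.
have [c1 [b1 [S1 Q1]]] := shift M1 T1; have [c2 [b2 [S2 Q2]]] := shift M2 T2.
set N1 := c1%:M + M1 in S1 Q1; set N2 := c2%:M + M2 in S2 Q2.
have {}ind a b c : a *: N1 + b *: N2 + c%:M = 0 -> [/\ a = 0, b = 0 & c = 0].
  move=> E; have [|-> ->] := ind a b (a * c1 + b * c2 + c).
    rewrite -[RHS]E; apply/matrixP => i j; rewrite !mxE.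
    by case: (i == j); rewrite ?mulr1n ?mulr0n; ring.
  by rewrite !mul0r !add0r.
clearbody N1 N2; have C := symmetric_commute d_ge3 uu Hu S1 S2.
have [e1 [g1 P1]] : exists a b, (N1 + N2) *m (N1 + N2) = a *: (N1 + N2) + b%:M.
  by apply: quad; rewrite -[N1]scale1r; apply: symmetric_lin.
have [e2 [g2 P2]] : exists a b, (-1 *: N1 + N2) *m (-1 *: N1 + N2) = a *: (-1 *: N1 + N2) + b%:M.
  by apply: quad; apply: symmetric_lin.
rewrite mulmxDl !mulmxDr Q1 Q2 -C in P1.
rewrite mulmxDl !mulmxDr -!scalemxAl -!scalemxAr Q1 Q2 -C in P2.
have [X EX] : exists X, X = N1 *m N2 by exists (N1 *m N2).
rewrite -EX in P1 P2.
have [|e12 e21 _] := ind (e1 - e2) (e1 + e2) (g1 + g2 - 2 * (b1 + b2)).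
  apply/matrixP => i j; move/matrixP/(_ i j): P1; move/matrixP/(_ i j): P2; rewrite !mxE.
  move/eqP; rewrite -subr_eq0 => /eqP A /eqP; rewrite -subr_eq0 => /eqP B.
  have /= E := congr2 (fun a b : F => - (a + b)) A B; rewrite addr0 oppr0 in E.
  rewrite -[RHS]E; by case: (i == j); rewrite ?mulr1n ?mulr0n; ring.
have e20 : e2 = 0.
  have : 2 * e2 = 0 by transitivity (e1 + e2 - (e1 - e2)); [ring|rewrite e12 e21 subrr].
  by move/eqP; rewrite mulf_eq0 pnatr_eq0 => /eqP.
have e10 : e1 = 0 by rewrite -[RHS]e12 e20 subr0.
have [g Xg] : exists g, X = g%:M.
  exists ((g1 - b1 - b2) / 2); apply/matrixP => i j; move/matrixP/(_ i j): P1.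
  have two : 2 != 0 :> F by rewrite pnatr_eq0.
  rewrite e10 !mxE mul0r add0r => E; apply: (mulfI two).
  transitivity (b1 *+ (i == j) + X i j + (X i j + b2 *+ (i == j)) - (b1 + b2) *+ (i == j)).
    by case: (i == j); rewrite ?mulr1n ?mulr0n; ring.
  by rewrite E; case: (i == j); rewrite ?mulr1n ?mulr0n; field.
have lin a b : a *: N1 = b *: N2 -> a = 0 /\ b = 0.
  move=> E; have [|-> /eqP] := ind a (- b) 0.
    by rewrite scaleNr E subrr add0r; apply/matrixP => i j; rewrite !mxE mul0rn.
  by rewrite oppr_eq0 => /eqP.
have [g0 b10] : g = 0 /\ b1 = 0.
  apply: lin; rewrite -mul_mx_scalar -mul_scalar_mx -Q1 -Xg EX !mulmxA //.
have [b20 _] : b2 = 0 /\ g = 0.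
  by apply: lin; rewrite -mul_mx_scalar -mul_scalar_mx -Q2 -Xg EX !mulmxA.
have z0 : 0%:M = 0 :> 'M[F]_3 by apply/matrixP => i j; rewrite !mxE mul0rn.
rewrite b10 z0 in Q1; rewrite b20 z0 in Q2; rewrite g0 z0 in Xg.
apply: (square_zero_dependent d_ge3 uu Hu S1 S2 Q1 _ _ Q2); rewrite -?C -?EX //.
by move=> a b E; have [|-> ->] := ind a b 0; rewrite // E z0 addr0.
Qed.


Lemma symmetric_pow N k : symmetric_mx N -> symmetric_mx (N ^+ k).
Proof.
move=> SN; elim: k => [|k IH]; first exact: symmetric1.
move=> x y; have -> : x *m N ^+ k.+1 = x *m N ^+ k *m N by rewrite exprSr -mulmxA.
by rewrite SN IH exprS -mulmxA.
Qed.

Section Krylov.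
Variables (N : 'M[F]_3) (x : 'rV[F]_3).
Hypotheses (SN : symmetric_mx N) (xu : krylov N x \in unitmx).

Definition mu m : F := polar (em (x *m N ^+ m) :: nseq d.-1 (em x)) f.

Lemma polar_krylov y e s :
  polar (em y :: [seq em (x *m N ^+ i) | i <- e] ++ s) f =
  polar (em (y *m N ^+ (sumn e)) :: nseq (size e) (em x) ++ s) f.
Proof.
elim: e y s => [|i e IH] y s; first by rewrite /= expr0 mulmx1.
rewrite [map _ _]/= cat_cons -(polar_symmetric _ _ _ (symmetric_pow i SN)).
have P a b w w' : polar (a :: b :: w ++ w') f = polar (a :: w ++ b :: w') f.
  by apply: polar_perm; rewrite perm_cons -cat1s perm_catCA.
by rewrite P IH -P [sumn _]/= exprD mulmxA.
Qed.

Lemma polar_krylov_mu e : size e = d -> polar [seq em (x *m N ^+ i) | i <- e] f = mu (sumn e).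
Proof.
case: e => [|i e] ed; first by move: ed => /=; lia.
have := polar_krylov (x *m N ^+ i) e [::]; rewrite !cats0 /= => ->.
rewrite /mu exprD mulmxA; congr (polar (_ :: nseq _ _) f).
by rewrite -[LHS]/(size (i :: e)).-1 ed.
Qed.

Lemma krylov_row (k : 'I_3) : row k (krylov N x) = x *m N ^+ k.
Proof.
by move: k; apply: ord3P; rewrite rowK ?inordK //= ?expr0 ?expr1 ?mulmx1 // expr2 mulmxA.
Qed.

Definition mu_hankel : 'M[F]_3 := \matrix_(i, j) mu (i + j).

Lemma mu_hankel_unit : mu_hankel \in unitmx.
Proof.
rewrite -row_free_unit -kermx_eq0; apply/rowV0P => c /sub_kermxP cH.
pose psi y := polar (em y :: nseq d.-1 (em x)) f.
have Hpsi : lform psi by move=> a y z; rewrite /psi emP polarDl.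
pose z := c *m krylov N x.
pose w := x *m N ^+ 3 *m invmx (krylov N x).
have combo (v : 'rV[F]_3) m : psi (v *m krylov N x *m N ^+ m) = \sum_j v 0 j * mu (j + m).
  rewrite -mulmxA mulmx_sum_row (lform_sum Hpsi); apply: eq_bigr => j _.
  by rewrite (lformZ Hpsi) row_mul krylov_row /mu exprD mulmxA.
have rec m : mu (m + 3) = \sum_l w 0 l * mu (l + m).
  by rewrite -combo /w mulmxKV // /mu addnC exprD mulmxA.
have z0 m : psi (z *m N ^+ m) = 0.
  have [k] := ubnP m; elim: k m => // k IH m mk; rewrite combo.
  have [m3|m3] := ltnP m 3.
    by move/rowP/(_ (Ordinal m3)): cH; rewrite !mxE => E; rewrite -[RHS]E; apply: eq_bigr => j _;
      rewrite mxE.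
  rewrite -(subnK m3); under eq_bigr => j _ do rewrite addnA rec mulr_sumr.
  rewrite exchange_big big1 // => l _ /=.
  transitivity (w 0 l * \sum_j c 0 j * mu (j + (m - 3 + l))).
    rewrite mulr_sumr; apply: eq_bigr => j _; rewrite mulrCA addnCA addnC; congr (_ * (_ * mu _)); lia.
  by rewrite -combo IH ?mulr0 //; have := ltn_ord l; lia.
have zz : z = 0.
  apply: (basis_sep d_ge3 uu Hu xu) => e ed.
  have -> : [seq em (row i (krylov N x)) | i <- e] = [seq em (x *m N ^+ i) | i <- map val e].
    by rewrite -map_comp; apply: eq_map => i /=; rewrite krylov_row.
  have := polar_krylov z (map val e) [::]; rewrite !cats0 size_map ed => ->.
  exact: z0.
by rewrite -(mulmxK xu c) -/z zz mul0mx.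
Qed.

End Krylov.
End Moments.

Section Cover.
Variables (F : numClosedFieldType) (p d : nat).
Hypothesis d_ge3 : (3 <= d)%N.
Local Notation W := (Defs.form F p.+2 d).

Section Basis.
Variables (u : 'M[F]_(p.+3)) (f : W).
Hypothesis uu : u \in unitmx.
Hypothesis Hu : forall a, kills (a *m u) f <-> forall j : 'I_p.+3, (j < 3)%N -> a 0 j = 0.
Variables (N : 'M[F]_3) (x : 'rV[F]_3).
Hypotheses (SN : symmetric_mx u f N) (xu : krylov N x \in unitmx).
Local Notation mu := (mu u f N x).
Let u' := base3 u (krylov N x).

Lemma polar_word_mu e : all (fun i : 'I_p.+3 => i < 3)%N e -> size e = d ->
  polar (word u' e) f = mu (sumn (map val e)).
Proof.
move=> e3 ed; rewrite -(polar_krylov_mu d_ge3 uu SN xu) ?size_map //.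
rewrite -map_comp; congr (polar _ f); apply/eq_in_map => i /(allP e3) i3 /=.
by rewrite (row_base3_lt _ _ (k := Ordinal i3)) // krylov_row.
Qed.

Lemma polar_wd_mu a k : (a + k <= d)%N ->
  polar (word u' (wd d a (nseq k ord0))) f = mu (a + 2 * k).
Proof.
move=> akd; rewrite polar_word_mu.
- rewrite /wd !map_cat !map_nseq !sumn_cat !sumn_nseq size_nseq; congr mu => /=.
  by rewrite (_ : bump 0 (bump 0 0) = 2) // (_ : bump 0 0 = 1%N) //; lia.
- by rewrite /wd !all_cat map_nseq !all_nseq !orbT.
- by rewrite (size_wd d_ge3 uu) // size_nseq.
Qed.

Lemma polar_hw_mu k : (k <= d)%N -> polar (word u' (hw p.+1 d k)) f = mu k.
Proof.
move=> kd; rewrite polar_word_mu.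
- rewrite map_cat !map_nseq sumn_cat !sumn_nseq; congr mu => /=.
  by rewrite (_ : bump 0 0 = 1%N) //; lia.
- by rewrite all_cat !all_nseq !orbT.
- by rewrite size_hw.
Qed.

Lemma gram_mu : gram (chart_pi u' f) = mu_hankel u f N x.
Proof.
have h k : (k <= 3)%N -> hv (chart_pi u' f) k = mu k.
  move=> k3; rewrite /hv ffunE /= inordK //; last by apply: leq_trans k3 _.
  by case: k k3 => [|[|[|[|//]]]] _ /=; rewrite (@polar_wd_mu _ 0) ?addn0 ?muln0 //; lia.
have h4 : hv (chart_pi u' f) 4 = mu 4.
  by rewrite /hv ffunE /= inordK //= (@polar_wd_mu 0 2) //; lia.
have m k : (k <= 1)%N -> mv (chart_pi u' f) k ord0 = mu (k + 2).
  move=> k1; rewrite /mv ffunE /= inordK //; last by apply: leq_trans k1 _.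
  by case: k k1 => [|[|//]] _ /=; rewrite (@polar_wd_mu _ 1) //; lia.
apply/matrixP; apply: ord3P; apply: ord3P; rewrite !mxE /= ?inordK //= ?h ?h4 ?m //.
Qed.

Lemma eta_mu : gram_rhs (chart_pi u' f) = col (inord 2) (mu_hankel u f N x).
Proof.
have h k : (k <= 3)%N -> hv (chart_pi u' f) k = mu k.
  move=> k3; rewrite /hv ffunE /= inordK //; last by apply: leq_trans k3 _.
  by case: k k3 => [|[|[|[|//]]]] _ /=; rewrite (@polar_wd_mu _ 0) ?addn0 ?muln0 //; lia.
have m : mv (chart_pi u' f) 2 ord0 = mu 4.
  by rewrite /mv ffunE /= inordK //= (@polar_wd_mu 2 1) //; lia.
apply/colP; apply: ord3P; rewrite !mxE /= ?inordK //= ?h ?m //.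
Qed.

Lemma sigma_mu : sigma (chart_pi u' f) = delta_mx (inord 2) 0.
Proof.
by rewrite /sigma gram_mu eta_mu colE mulKmx // mu_hankel_unit.
Qed.

End Basis.

Lemma concise_cover f : pcone (@powsum F p.+2 d 3) f -> \rank (flattening f) = 3%N ->
  exists2 u, u \in unitmx & [/\ gram (chart_pi u f) \in unitmx,
    sigma (chart_pi u f) (inord 2) 0 != 0 & (4 <= d)%N -> \det (hankel u f) != 0].
Proof.
move=> Zf rf; have [u uu Hu] := adapted_basis (leq_trans (isT : 0 < 3)%N d_ge3) f.
rewrite rf in Hu; have [N SN [x xu]] := cyclic_symmetric d_ge3 uu Hu Zf.
have Hmu := mu_hankel_unit d_ge3 uu Hu SN xu.
exists (base3 u (krylov N x)); first exact: base3_unit.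
split; first by rewrite gram_mu.
  by rewrite (sigma_mu uu Hu) // mxE !eqxx oner_neq0.
move=> d4; rewrite -unitfE -unitmxE (_ : hankel _ _ = mu_hankel u f N x) //.
apply/matrixP => i j; rewrite !mxE polar_hw_mu //.
by have := ltn_ord i; have := ltn_ord j; lia.
Qed.

End Cover.

Section Dimension.
Variables (K : numFieldType) (W : vectType K) (U : {vspace W}) (J : finType).
Variable xi : J -> W -> K.
Hypothesis xi_lin : forall j, lform (xi j).

(* A subspace separated by a family of linear functionals is at least as large. *)
Lemma dim_ge_sep :
  (forall c : J -> K, (forall w, w \in U -> \sum_j c j * xi j w = 0) -> forall j, c j = 0) ->
  (#|J| <= \dim U)%N.
Proof.
move=> H; rewrite leqNgt; apply/negP => dU.
pose M : 'M[K]_(#|J|, \dim U) := \matrix_(i, k) xi (enum_val i) (vbasis U)`_k.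
have /rowV0Pn[x /sub_kermxP xM /eqP] : kermx M != 0.
  by rewrite kermx_eq0 /row_free neq_ltn (leq_ltn_trans (rank_leq_col M) dU).
apply; apply/rowP => i; rewrite mxE -(enum_valK i).
apply: (H (fun j => x 0 (enum_rank j))) => w wU.
rewrite (coord_vbasis wU).
under eq_bigr => j _ do rewrite (lform_sum (xi_lin _)) mulr_sumr.
rewrite exchange_big big1 // => k _ /=.
transitivity (coord (vbasis U) k w * (x *m M) 0 k); last by rewrite xM mxE mulr0.
rewrite mxE mulr_sumr [RHS](reindex (@enum_rank J)) /=; last exact: onW_bij (@enum_rank_bij J).
by apply: eq_bigr => j _; rewrite (lformZ (xi_lin _)) mxE enum_rankK mulrCA.
Qed.

End Dimension.

Section Tangent.
Variables (F : numClosedFieldType) (n d : nat).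
Hypothesis d_gt0 : (0 < d)%N.
Local Notation W := (Defs.form F n d).
Local Notation Z := (pcone (@powsum F n d 3)).
Implicit Types (f : W).

Lemma large_tangent_singular f (J : finType) (xi : J -> W -> F) : Z f ->
  (forall j, lform (xi j)) -> (3 * n.+1 < #|J|)%N ->
  (forall c : J -> F, (forall w, tangent_cone Z f w -> \sum_j c j * xi j w = 0) ->
     forall j, c j = 0) ->
  ~ smooth_at Z f.
Proof.
move=> Zf xi_lin J3 H [r [/(local_dim_lt (@powsum_poly F n d 3)) rT [U [HU dU]]]].
have : (#|J| <= \dim U)%N.
  apply: (dim_ge_sep xi_lin) => c Hc; apply: H => w /HU; exact: Hc.
rewrite dU => /(leq_trans J3); rewrite ltnS leqNgt => /negP; apply.
by rewrite dimvf /dim /= in rT.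
Qed.

Lemma powsumS k (A : 'M[F]_(k, n.+1)) a :
  exists B : 'M_(k.+1, n.+1), powsum d B = powsum d A + pow d a.
Proof.
exists (\matrix_i if unlift ord_max i is Some j then row j A else a).
rewrite {1}/powsum big_ord_recr /=; congr (_ + pow d _); last by rewrite rowK unlift_none.
apply: eq_bigr => i _; rewrite rowK.
have -> : widen_ord (leqnSn k) i = lift ord_max i.
  by apply: val_inj; rewrite /= /bump leqNgt ltn_ord.
by rewrite liftK.
Qed.

(* Adding a multiple of a power to a limit of sums of two powers. *)
Lemma pcone2_pow f P a : pcone (@powsum F n d 2) f -> vanish (@powsum F n d 3) P ->
  peval P (f + pow d a) = 0.
Proof.
move=> f2 HP; apply: (pcone_polyfn f2 (p := fun g => peval P (g + pow d a))).
  apply: (polyfn_comp _ (peval_polyfn P)) => b Hb.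
  have -> : (fun g => b (g + pow d a)) = (fun g => b g + b (pow d a)).
    by apply/funext => g; rewrite lformD.
  by apply: polyfn_add; [apply: polyfn_lin|apply: polyfn_cst].
by move=> A; have [B <-] := powsumS A a; apply: HP.
Qed.

Lemma tangent_powsum f w : (forall P, vanish (@powsum F n d 3) P -> pdiff P f w = 0) ->
  tangent_cone Z f w.
Proof.
have cone3 := @powsum_cone F n d d_gt0 3.
by move=> H; apply: (proj2 (tangent_pcone cone3 (@powsum_neq0 F n d d_gt0 2) f w)).
Qed.

Lemma tangent_secant2 f a : pcone (@powsum F n d 2) f -> tangent_cone Z f (pow d a).
Proof.
move=> f2; apply: tangent_powsum => P HP.
rewrite -[X in pdiff P X](addr0 f) -(scale0r (pow d a)).
apply: (pdiff_velocity0 (velocity_line f (pow d a))) => t.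
have [A EA] := powsum_coef d_gt0 (fun _ : 'I_1 => t) (fun _ => a).
have -> : t *: pow d a = pow d (row 0 A).
  by move: EA; rewrite /powsum !big_ord1 => ->.
exact: pcone2_pow.
Qed.

(* The derivative of the curve of powers through the power of l in the direction v. *)
Lemma velocity_pow l v : exists2 w : W, velocity (fun t => pow d (l + t *: v)) w &
  forall s, size s = d -> exists2 q : {poly F},
    (forall t, \prod_(x <- s) (dot x l + t * dot x v) = q.[t]) &
    polar s w = q^`().[0].
Proof.
have [i|w Hw] := @velocity_exists _ _ (fun t => pow d (l + t *: v)).
  have := polyfn_line l v (@powsum_poly F n d 1 _ (wcoord_lform (W := W) i)).
  congr is_poly; apply/funext => t; congr wcoord; rewrite /powsum big_ord1; congr pow.
  by apply/rowP => j; rewrite mxE ord1.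
exists w => // s sd; have [q Hq ->] := Hw _ (@polar_lform F n d s).
exists q => // t; rewrite -Hq polar_pow //; apply: eq_bigr => x _.
by rewrite !dot_mx linearD linearZ /= mulmxDr -scalemxAr !mxE.
Qed.

Lemma velocity_pow_self l : exists2 w : W, velocity (fun t => pow d (l + t *: l)) w &
  forall s, size s = d -> polar s w = d%:R * \prod_(x <- s) dot x l.
Proof.
have [w Hw H] := velocity_pow l l; exists w => // s sd; have [q Hq ->] := H s sd.
have -> : q = (1 + 'X) ^+ d * (\prod_(x <- s) dot x l)%:P.
  apply: horner_ext => t; rewrite -Hq hornerM hornerC horner_exp hornerD hornerC hornerX.
  rewrite -sd; elim: (s) => [|x s' IH]; first by rewrite !big_nil mulr1.
  by rewrite !big_cons IH /= exprS; ring.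
rewrite derivM derivC mulr0 addr0 hornerM hornerC deriv_exp.
by rewrite derivD derivC derivX add0r mul1r hornerMn horner_exp hornerD hornerC hornerX addr0 expr1n.
Qed.

End Tangent.

Lemma coef_poly0 (F : numFieldType) m (c : 'I_m.+1 -> F) :
  (forall s : F, \sum_k c k * s ^+ k = 0) -> forall k, c k = 0.
Proof.
move=> H k; pose q : {poly F} := \poly_(i < m.+1) c (inord i).
have q0 : q = 0.
  apply: horner_ext0 => s; rewrite horner_poly -[RHS](H s).
  by apply: eq_bigr => i _; rewrite inord_val.
by move/(congr1 (fun q : {poly F} => q`_k)): q0; rewrite coef_poly ltn_ord inord_val coef0.
Qed.

Section SecantSingular.
Variables (F : numClosedFieldType) (p d : nat).
Hypothesis d_ge3 : (3 <= d)%N.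
Local Notation W := (Defs.form F p.+2 d).
Local Notation Z := (pcone (@powsum F p.+2 d 3)).
Local Notation J := ('I_4 + 'I_3 * 'I_p.+1 + 'I_3)%type.

Let d_gt0 : (0 < d)%N. Proof. exact: leq_trans d_ge3. Qed.

(* The monomials 1, s, s^2, s^3; t_j, s t_j, s^2 t_j; t^2, s t^2, t^3. *)
Definition sec_word (i : J) : nat * seq 'I_p.+1 :=
  match i with
  | inl (inl k) => (k : nat, [::])
  | inl (inr (k, j)) => (k : nat, [:: j])
  | inr k => nth (0%N, [::]) [:: (0%N, [:: ord0; ord0]); (1%N, [:: ord0; ord0]);
                                 (0%N, [:: ord0; ord0; ord0])] k
  end.

Lemma sec_word_size i : ((sec_word i).1 + size (sec_word i).2 <= d)%N.
Proof.
apply: leq_trans d_ge3; case: i => [[k|[k j]]|k] /=.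
- by rewrite addn0 -ltnS.
- by rewrite addn1.
- by case: k => -[|[|[|]]].
Qed.

Definition sec_xi i (w : W) : F :=
  polar (word 1%:M (wd d (sec_word i).1 (sec_word i).2)) w.

Lemma sec_xi_pow i (s : F) (t : 'I_p.+1 -> F) :
  sec_xi i (pow d (dual_vec 1%:M (\row_j idx_rec 1 s t j))) =
  s ^+ (sec_word i).1 * \prod_(j <- (sec_word i).2) t j.
Proof.
rewrite /sec_xi polar_pow; last first.
  by rewrite size_map (size_wd d_ge3 (unitmx1 F p.+3)) // sec_word_size.
rewrite big_map; under eq_bigr => j _ do rewrite dot_dual_vec ?unitmx1 // mxE.
rewrite big_cat big_map big_cat !prod_nseq /= idx_rec0 idx_rec1 expr1n mul1r mulrC.
by congr (_ * _); apply: eq_bigr => j _; rewrite idx_recx.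
Qed.

Lemma secant2_singular f : pcone (@powsum F p.+2 d 2) f -> ~ smooth_at Z f.
Proof.
move=> f2; apply: (large_tangent_singular (xi := sec_xi)); first exact: pcone_powsumS.
- by move=> i; apply: polar_lform.
- by rewrite !card_sum card_prod !card_ord; lia.
move=> c Hc.
have E s t : \sum_k c (inl (inl k)) * s ^+ k + \sum_j (\sum_k c (inl (inr (k, j))) * s ^+ k) * t j
   + (c (inr 0) * t ord0 ^+ 2 + c (inr 1) * s * t ord0 ^+ 2 + c (inr (inord 2)) * t ord0 ^+ 3) = 0.
  have := Hc _ (tangent_secant2 d_gt0 (dual_vec 1%:M (\row_j idx_rec 1 s t j)) f2).
  under eq_bigr => i _ do rewrite sec_xi_pow.
  rewrite !big_sumType /= sum3 /= !inordK //= => H; rewrite -[RHS]H; congr (_ + _ + _).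
  - by apply: eq_bigr => k _; rewrite big_nil mulr1.
  - rewrite (eq_bigr (fun kj => c (inl (inr (kj.1, kj.2))) * s ^+ kj.1 * t kj.2)); last first.
      by move=> [k j] _ /=; rewrite big_seq1 mulrA.
    rewrite -(pair_bigA _ (fun k j => c (inl (inr (k, j))) * s ^+ k * t j)) /=.
    by rewrite exchange_big; apply: eq_bigr => j _; rewrite mulr_suml.
  - by rewrite !big_cons !big_nil !expr0 !expr1; ring.
have c1 k : c (inl (inl k)) = 0.
  move: k; apply: coef_poly0 => s; have := E s (fun=> 0).
  move=> H; rewrite -[RHS]H -[LHS]addr0 -addrA; congr (_ + _).
  by rewrite big1 ?add0r => [|j _]; rewrite ?mulr0 // !expr0n /= !mulr0 !addr0.
have c2 (r : F) s j : (\sum_k c (inl (inr (k, j))) * s ^+ k) * r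
   + (j == ord0)%:R * ((c (inr 0) + c (inr 1) * s) * r ^+ 2 + c (inr (inord 2)) * r ^+ 3) = 0.
  have := E s (fun l => (l == j)%:R * r).
  rewrite big1 ?add0r => [|k _]; last by rewrite c1 mul0r.
  have S (G : 'I_p.+1 -> F) : \sum_l G l * ((l == j)%:R * r) = G j * r.
    rewrite (bigD1 j) //= eqxx mul1r big1 ?addr0 // => l /negbTE lj.
    by rewrite lj mul0r mulr0.
  rewrite S => H; rewrite -[RHS]H; congr (_ + _).
  by rewrite eq_sym; case: (_ == j); rewrite ?mul0r ?mul1r; ring.
have [c3 c4] : (forall s j, \sum_k c (inl (inr (k, j))) * s ^+ k = 0) /\
    forall s, c (inr 0) + c (inr 1) * s = 0 /\ c (inr (inord 2)) = 0.
  have vand (a b e : F) : (forall r, a * r + (b * r ^+ 2 + e * r ^+ 3) = 0) ->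
      [/\ a = 0, b = 0 & e = 0].
    move=> H; pose g (k : 'I_4) := [:: 0; a; b; e]`_k; have g0 : forall k, g k = 0.
      by apply: coef_poly0 => r; rewrite -[RHS](H r) !big_ord_recl big_ord0 /g /= /bump /=; ring.
    by split; [have := g0 (inord 1)|have := g0 (inord 2)|have := g0 (inord 3)]; rewrite /g inordK.
  have c2' s j : [/\ \sum_k c (inl (inr (k, j))) * s ^+ k = 0,
      (j == ord0)%:R * (c (inr 0) + c (inr 1) * s) = 0 & (j == ord0)%:R * c (inr (inord 2)) = 0].
    by apply: vand => r; rewrite -[RHS](c2 r s j); ring.
  by split=> [s j|s]; [case: (c2' s j) | case: (c2' s ord0); rewrite eqxx !mul1r].
have c5 s := (c4 s).1.
move=> [[k|[k j]]|k]; first exact: c1.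
  by move: k; apply: coef_poly0 => s; apply: c3.
have c0 : c (inr 0) = 0 by have := c5 0; rewrite mulr0 addr0.
move: k; apply: ord3P => //; last exact: (c4 0).2.
by have := c5 1; rewrite c0 add0r mulr1.
Qed.

End SecantSingular.

(* A Hankel matrix is not the inverse of a symmetric matrix whose quadratic form vanishes
   on the conic. *)
Lemma hankel_inverse (F : numClosedFieldType) (h : nat -> F) (H K : 'M[F]_3) :
  (forall i j, H i j = h (i + j)%N) -> K *m H = 1%:M -> (forall i j, K i j = K j i) ->
  K 0 0 = 0 -> K 0 1 + K 1 0 = 0 -> K 0 (inord 2) + K 1 1 + K (inord 2) 0 = 0 ->
  K 1 (inord 2) + K (inord 2) 1 = 0 -> K (inord 2) (inord 2) = 0 -> False.
Proof.
move=> HE KH Ksym K00 K01 K02 K12 K22.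
have double (x : F) : x + x = 0 -> x = 0.
  by move/eqP; rewrite -mulr2n mulrn_eq0 => /eqP.
move: K01 K12; rewrite (Ksym 1 0) (Ksym (inord 2) 1) => /double K01 /double K12.
have K11 : K 1 1 = - (2 * K 0 (inord 2)).
  by apply/eqP; rewrite -addr_eq0 -[X in _ == X]K02 (Ksym (inord 2) 0); apply/eqP; ring.
have E0 : K 0 (inord 2) * h 2 = 1.
  have := congr1 (fun M : 'M[F]_3 => M 0 0) KH; rewrite mxE sum3 !HE K00 K01 !mul0r !add0r inordK // => ->.
  by rewrite mxE eqxx.
have E1 : K 1 1 * h 2 = 1.
  have := congr1 (fun M : 'M[F]_3 => M 1 1) KH; rewrite mxE sum3 !HE (Ksym 1 0) K01 K12 !mul0r.
  by rewrite add0r addr0 => ->; rewrite mxE eqxx.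
have : 3 = 0 :> F.
  have E2 : - 2 = 1 :> F by rewrite -[RHS]E1 K11 mulNr -mulrA E0 mulr1.
  by rewrite -[LHS]addr0 -(subrr (1 : F)) -{2}E2; ring.
by move/eqP; rewrite pnatr_eq0.
Qed.

Section QuarticSingular.
Variables (F : numClosedFieldType) (q : nat).
Local Notation W := (Defs.form F q.+1 4).
Local Notation Z := (pcone (@powsum F q.+1 4 3)).
Local Notation J := ('I_5 + 'I_4 * 'I_q)%type.
Local Notation i0 := (i0 q).
Local Notation i1 := (i1 q).
Variables (u : 'M[F]_q.+2) (f : W).
Hypothesis uu : u \in unitmx.
Hypothesis Hf : binary u f.
Hypothesis nZf : ~ pcone (@powsum F q.+1 4 2) f.
Hypothesis Hu : \det (hankel u f) != 0.

Let K := invmx (hankel u f).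
Let line (s : F) : 'rV[F]_q.+2 := dual_vec u (\row_j idx_rec 1 s (fun=> 0) j).
Let vs (s : F) : 'cV[F]_3 := \col_i s ^+ i.
Let kappa (s : F) : F := ((vs s)^T *m K *m vs s) 0 0.

Lemma kappa_poly : is_poly kappa.
Proof.
have HR := is_poly_ring F; apply: (rp_mulmx HR) => [i j|i j].
  apply: (rp_mulmx HR) => [i' j'|i' j']; last exact: (rp_cst HR).
  rewrite (_ : (fun x => _) = fun x : F => x ^+ j'); last by apply/funext => x; rewrite !mxE.
  exact: (rp_exp HR _ (is_poly_id F)).
rewrite (_ : (fun x => _) = fun x : F => x ^+ i); last by apply/funext => x; rewrite !mxE.
exact: (rp_exp HR _ (is_poly_id F)).
Qed.

(* A nonsingular symmetric matrix whose quadratic form vanishes on the conic has an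
   inverse that is not a Hankel matrix. *)
Lemma kappa_neq0 : exists s, kappa s != 0.
Proof.
apply: contrapT => H; have k0 s : kappa s = 0.
  by apply: contrapT => /eqP ks; apply: H; exists s.
have KH : K *m hankel u f = 1%:M by rewrite mulVmx // unitmxE unitfE.
have Hsym : (hankel u f)^T = hankel u f by apply/matrixP => i j; rewrite !mxE addnC.
have KT : K^T = K by rewrite /K trmx_inv Hsym.
have Ksym i j : K i j = K j i by rewrite -[in LHS]KT [LHS]mxE.
pose h k := polar (word u (hw q 4 k)) f.
have HE i j : hankel u f i j = h (i + j)%N by rewrite mxE.
have c0 : forall k : 'I_5, [:: K 0 0; K 0 1 + K 1 0; K 0 (inord 2) + K 1 1 + K (inord 2) 0;
    K 1 (inord 2) + K (inord 2) 1; K (inord 2) (inord 2)]`_k = 0.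
  apply: coef_poly0 => s; rewrite -[RHS](k0 s) /kappa mxE sum3 !mxE !sum3 !mxE inordK //.
  by rewrite !big_ord_recl big_ord0 /= /bump /=; ring.
move: (c0 (inord 0)) (c0 (inord 1)) (c0 (inord 2)) (c0 (inord 3)) (c0 (inord 4)).
rewrite !inordK //= => K00 K01 K02 K12 K22.
exact: (hankel_inverse HE KH Ksym K00 K01 K02 K12 K22).
Qed.

Lemma polar_line s e : size e = 4%N ->
  polar (word u e) (pow 4 (line s)) = \prod_(j <- e) idx_rec 1 s (fun=> 0) j.
Proof.
move=> e4; rewrite polar_pow ?size_map // big_map; apply: eq_bigr => j _.
by rewrite dot_dual_vec // mxE.
Qed.

Lemma hankel_line s : hankel u (pow 4 (line s)) = vs s *m (vs s)^T.
Proof.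
apply/matrixP => i j; rewrite mxE polar_line ?size_hw //; last first.
  by have := ltn_ord i; have := ltn_ord j; lia.
by rewrite prod_hw ?idx_rec0 // idx_rec1 mxE big_ord1 !mxE exprD.
Qed.

Lemma binary_line s : binary u (pow 4 (line s)).
Proof.
move=> j; apply: (kills_sep _ uu) => // e e3.
have := @polar_line s (ix j :: e); rewrite /= e3 => /(_ erefl) ->.
by rewrite big_cons idx_recx mul0r.
Qed.

(* Subtracting a suitable multiple of a power makes the Hankel matrix singular. *)
Lemma subtract_line s : kappa s != 0 -> exists2 c, c != 0 &
  pcone (@powsum F q.+1 4 2) (f - c *: pow 4 (line s)).
Proof.
move=> ks; have c0 : (kappa s)^-1 != 0 by rewrite invr_eq0.
exists (kappa s)^-1 => //; set c := (kappa s)^-1 in c0 *; set g := f - _.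
have gE : g = (- c) *: pow 4 (line s) + f by rewrite /g scaleNr addrC.
have g0 : g != 0.
  apply/negP => /eqP g0; apply: nZf.
  have [A EA] := @powsum_coef F q.+1 4 isT 2 (fun i => if i == 0 then c else 0) (fun=> line s).
  have fE : f = powsum 4 A.
    rewrite EA !big_ord_recl big_ord0 /= scale0r !addr0; apply/eqP.
    by rewrite -subr_eq0 -/g g0.
  rewrite fE; apply: pcone_phi; rewrite -fE.
  apply: contraNneq Hu => ->; rewrite (_ : hankel u 0 = 0) ?det0 //.
  by apply/matrixP => i j; rewrite !mxE (lform0 (polar_lform _)).
have Hg : binary u g.
  move=> j; rewrite /kills gE.
  have -> : mpoly_of_dhomog (- c *: pow 4 (line s) + f) =
    - c *: mpoly_of_dhomog (pow 4 (line s)) + mpoly_of_dhomog f by [].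
  by rewrite linearP /= (binary_line s j) (Hf j) scaler0 addr0.
pose y := K *m vs s.
pose b j := y (inord j) 0.
have HK : hankel u f *m K = 1%:M by rewrite mulmxV // unitmxE unitfE.
apply: (@quadric_sigma2 _ _ _ (isT : 2 <= 4)%N u g b uu g0 Hg).
  have /existsP[j yj] : [exists j, y j 0 != 0].
    apply: contraNT ks => /existsPn H; rewrite /kappa -mulmxA -/y (_ : y = 0) ?mulmx0 ?mxE //.
    by apply/colP => j; rewrite [RHS]mxE; apply/eqP/negPn/H.
  by exists j; rewrite // /b inord_val.
have gy : hankel u g *m y = 0.
  have -> : hankel u g = (- c) *: hankel u (pow 4 (line s)) + hankel u f.
    by apply/matrixP => i j; rewrite !mxE gE polar_lform.
  rewrite hankel_line mulmxDl /y -scalemxAl !mulmxA HK mul1mx -!(mulmxA (vs s)).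
  have -> : (vs s)^T *m K *m vs s = (kappa s)%:M by apply/matrixP => i j; rewrite !ord1 [RHS]mxE mulr1n.
  by rewrite mul_mx_scalar scalerA mulNr /c mulVf // scaleN1r addNr.
apply/(binary_op_moments (isT : 2 <= 4)%N b uu Hg (isT : 2 <= 4)%N) => k k2.
have k3 : (k < 3)%N by rewrite -(leq_add2r 2).
move/colP/(_ (Ordinal k3)): gy; rewrite !mxE => E; rewrite -[RHS]E; apply: eq_bigr => j _.
by rewrite mxE /b inord_val mulrC.
Qed.

Lemma tangent_line s w v : kappa s != 0 -> velocity (fun t => pow 4 (line s + t *: v)) w ->
  tangent_cone Z f w.
Proof.
move=> ks Hw; have [c c0 g2] := subtract_line ks; set g := f - _ in g2.
apply: (@tangent_powsum F q.+1 4 isT f w) => P HP.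
pose curve t := g + c *: pow 4 (line s + t *: v).
have Hc : velocity curve (c *: w).
  move=> b Hb; have [r Hr Er] := Hw b Hb; exists ((b g)%:P + c *: r) => [t|].
    by rewrite (lformD Hb) (lformZ Hb) Hr hornerD hornerC hornerZ.
  by rewrite (lformZ Hb) Er derivD derivC add0r derivZ hornerZ.
have : pdiff P (curve 0) (c *: w) = 0.
  apply: (pdiff_velocity0 Hc) => t; rewrite /curve -[c](@rootCK _ 4) // -powZ //.
  exact: pcone2_pow.
rewrite /curve scale0r addr0 subrK (lformZ (pdiff_lform P f)) => /eqP.
by rewrite mulf_eq0 (negbTE c0) => /eqP.
Qed.

Definition line_xi (i : J) (w : W) : F :=
  polar (word u (match i with inl k => hw q 4 k | inr (k, j) => mw 4 k j end)) w.

Lemma quartic_degenerate_singular : (2 <= q)%N -> Z f -> ~ smooth_at Z f.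
Proof.
move=> q2 Zf; apply: (large_tangent_singular (xi := line_xi)) => //.
- by move=> i; apply: polar_lform.
- by rewrite card_sum card_prod !card_ord; lia.
move=> c Hc; have [s0 ks0] := kappa_neq0.
have dens (m : nat) (g : 'I_m.+1 -> F) : (forall s, kappa s != 0 -> \sum_k g k * s ^+ k = 0) ->
    forall k, g k = 0.
  move=> H; apply: coef_poly0; apply: (is_poly_density _ kappa_poly ks0 H).
  by exists (\poly_(i < m.+1) g (inord i)) => t; rewrite horner_poly; apply: eq_bigr => i _; rewrite inord_val.
have c1 k : c (inl k) = 0.
  move: k; apply: dens => s ks; have [w Hw Ew] := @velocity_pow_self F q.+1 4 (line s).
  have := Hc w (tangent_line ks Hw); rewrite big_sumType /=.
  rewrite [X in _ + X]big1 ?addr0 => [H|[k j] _]; last first.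
    rewrite /line_xi Ew ?size_map ?size_mw // big_cons dot_dual_vec // mxE idx_recx.
    by rewrite mul0r !mulr0.
  have four : 4%:R != 0 :> F by rewrite pnatr_eq0.
  apply: (mulfI four); rewrite mulr0 -[RHS]H mulr_sumr; apply: eq_bigr => k _.
  rewrite /line_xi Ew ?size_map ?size_hw -1?ltnS // big_map.
  under eq_bigr => j _ do rewrite dot_dual_vec // mxE.
  by rewrite prod_hw ?idx_rec0 // idx_rec1 mulrCA.
move=> [k|[k j]] //; move: k; apply: dens => s ks.
have [w Hw Ew] := @velocity_pow F q.+1 4 (line s) (dual_vec u (delta_mx 0 (ix j))).
have := Hc w (tangent_line ks Hw); rewrite big_sumType /= big1 ?add0r => [H|k _]; last first.
  by rewrite c1 mul0r.
have xiE (kj : 'I_4 * 'I_q) : line_xi (inr kj) w = (kj.2 == j)%:R * s ^+ kj.1.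
  case: kj => k j' /=; rewrite /line_xi.
  have [|r Hr ->] := Ew (word u (mw 4 k j')); first by rewrite size_map size_mw.
  have -> : r = 'X * ((j' == j)%:R * s ^+ k)%:P.
    apply: horner_ext => t; rewrite -Hr hornerM hornerX hornerC big_map.
    under eq_bigr => l _ do rewrite !dot_dual_vec // !mxE /=.
    rewrite (prod_mw _ _ _ (g := fun l => idx_rec 1 s (fun=> 0) l + t * (l == ix j)%:R)).
      rewrite idx_rec1 idx_recx add0r (_ : (i1 == ix j) = false) // mulr0 addr0.
      by rewrite (inj_eq (@lift_inj _ _)) (inj_eq (@lift_inj _ _)); ring.
    by rewrite idx_rec0 (_ : (i0 == ix j) = false) // mulr0 addr0.
  by rewrite derivM derivX derivC mulr0 addr0 mul1r hornerC.
move: H; under eq_bigr => kj _ do rewrite xiE.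
rewrite (eq_bigr (fun kj => c (inr (kj.1, kj.2)) * ((kj.2 == j)%:R * s ^+ kj.1))); last by case.
rewrite -(pair_bigA _ (fun k l => c (inr (k, l)) * ((l == j)%:R * s ^+ k))) /= => H.
rewrite -[RHS]H; apply: eq_bigr => k _; rewrite (bigD1 j) //= eqxx mul1r big1 ?addr0 // => l /negbTE ->.
by rewrite mul0r mulr0.
Qed.

End QuarticSingular.

Section Essential.
Variables (F : numClosedFieldType) (n d : nat).
Hypothesis d_gt0 : (0 < d)%N.
Implicit Types (f : Defs.form F n d).

Lemma subspace_dim_unique (W : vectType F) (A : set W) r r' :
  subspace_dim A r -> subspace_dim A r' -> r = r'.
Proof.
move=> [U [HU <-]] [U' [HU' <-]]; congr (\dim _); apply/vspaceP => w.
by apply/idP/idP => [/HU/HU'|/HU'/HU].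
Qed.

Lemma kills_linear a (l : Defs.form F n 1) : kills a l <-> polar [:: a] l = 0.
Proof.
split=> [H|H]; first by apply: (polar_kills H); apply: mem_head.
by apply: (kills_sep _ (unitmx1 F n.+1)) => // -[|? ?] //.
Qed.

Lemma essential_dim f : subspace_dim (essential f) (\rank (flattening f)).
Proof.
have [u uu Hu] := adapted_basis d_gt0 f; set r := \rank _ in Hu *.
have rn : (r <= n.+1)%N := rank_leq_row _.
pose L (j : 'I_n.+1) : Defs.form F n 1 := pow 1 (dual_vec u (delta_mx 0 j)).
have polarL i j : polar [:: row i u] (L j) = (i == j)%:R.
  by rewrite polar_pow // big_seq1 dot_dual_vec // mxE eqxx.
pose X := [tuple L (widen_ord rn j) | j < r].
have EX (l : Defs.form F n 1) : essential f l <->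
    forall j : 'I_n.+1, (r <= j)%N -> polar [:: row j u] l = 0.
  split=> [H j rj|H a Ha].
    apply/kills_linear/H; rewrite -/(kills _ f) rowE; apply/Hu => i ir.
    by rewrite mxE eqxx; case: eqP => // ij; rewrite ij ltnNge rj in ir.
  apply/kills_linear.
  have E : a = \sum_j (a *m invmx u) 0 j *: row j u by rewrite -mulmx_sum_row mulmxKV.
  have Hb : forall j : 'I_n.+1, (j < r)%N -> (a *m invmx u) 0 j = 0.
    by apply/Hu; rewrite mulmxKV.
  rewrite E polar_suml big1 // => j _.
  by have [jr|rj] := ltnP j r; [rewrite Hb ?mul0r | rewrite H ?mulr0].
exists <<X>>%VS; split=> [l|].
  split=> [lX|/EX H].
    apply/EX => j rj; rewrite (coord_span lX) (lform_sum (polar_lform _)) big1 // => i _.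
    rewrite (lformZ (polar_lform _)) -tnth_nth tnth_mktuple polarL; case: eqP => [ji|]; last by rewrite mulr0.
    by move: rj; rewrite ji /= leqNgt ltn_ord.
  have -> : l = \sum_(j < r) polar [:: row (widen_ord rn j) u] l *: L (widen_ord rn j).
    apply: (polar_ext uu) => -[|i [|? ?]] // _; rewrite (lform_sum (polar_lform _)).
    rewrite [word _ _]/=; under eq_bigr => j _ do rewrite (lformZ (polar_lform _)) polarL.
    have [ir|ri] := ltnP i r; last first.
      rewrite H // big1 // => j _; case: eqP => [ij|]; last by rewrite mulr0.
      by move: ri; rewrite ij /= leqNgt ltn_ord.
    rewrite (bigD1 (Ordinal ir)) //= big1 ?addr0 => [|j ji].
      by rewrite (_ : widen_ord _ _ = i) ?eqxx ?mulr1 //; apply: val_inj.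
    case: eqP => [ij|]; last by rewrite mulr0.
    by case/eqP: ji; apply: val_inj; rewrite /= ij.
  apply: rpred_sum => j _; apply: rpredZ; apply: memv_span.
  by apply/tnthP; exists j; rewrite tnth_mktuple.
apply/eqP; rewrite eqn_leq; apply/andP; split.
  by apply: leq_trans (dim_span _) _; rewrite size_tuple.
rewrite -{1}(card_ord r).
apply: (dim_ge_sep (xi := fun j w => polar [:: row (widen_ord rn j) u] w)) => [j|c H j].
  exact: polar_lform.
have := H (L (widen_ord rn j)); rewrite memv_span; last by apply/tnthP; exists j; rewrite tnth_mktuple.
move=> /(_ isT); rewrite (bigD1 j) //= polarL eqxx mulr1 big1 ?addr0 // => i ij.
by rewrite polarL -val_eqE /= val_eqE (negbTE ij) mulr0.
Qed.

End Essential.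

Section Main.
Variable F : numClosedFieldType.

Lemma adapted_binary (p d : nat) (u : 'M[F]_p.+3) (f : Defs.form F p.+2 d) r : (r <= 2)%N ->
  (forall a, kills (a *m u) f <-> forall j : 'I_p.+3, (j < r)%N -> a 0 j = 0) -> binary u f.
Proof.
move=> r2 Hu j; rewrite rowE; apply/Hu => i ir; rewrite mxE eqxx /=.
by case: eqP => // ij; move: ir; rewrite ij ltnNge (leq_trans r2).
Qed.

Lemma rank1_secant2 (p d : nat) (f : Defs.form F p.+2 d) : (2 <= d)%N -> f != 0 ->
  (\rank (flattening f) <= 1)%N -> pcone (@powsum F p.+2 d 2) f.
Proof.
move=> d2 f0 r1; have [u uu Hu] := adapted_basis (ltnW d2) f.
have Hf := adapted_binary (leq_trans r1 (isT : 1 <= 2)%N) Hu.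
have K1 : kills (row (i1 p.+1) u) f.
  rewrite rowE; apply/Hu => i ir; rewrite mxE eqxx /=.
  by case: eqP => // ij; move: ir; rewrite ij ltnNge r1.
apply: (@quadric_sigma2 _ _ _ d2 u f (fun j => (j == 2)%:R) uu f0 Hf).
  by exists (inord 2) => //; rewrite inordK // eqxx oner_neq0.
rewrite /binary_op !big_ord_recr big_ord0 /= !scale0r !add0r scale1r.
by move: K1; rewrite /kills => ->; rewrite linear0.
Qed.

Lemma smooth_off_secant2 p d (f : Defs.form F p.+2 d) : (3 <= d)%N ->
  pcone (@powsum F p.+2 d 3) f -> ~ pcone (@powsum F p.+2 d 2) f ->
  ~ [/\ d = 4%N, (1 <= p)%N & \rank (flattening f) = 2%N] ->
  smooth_at (pcone (@powsum F p.+2 d 3)) f.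
Proof.
move=> d3 Zf nf exc; have f0 : f != 0 by case: Zf.
have d2 : (2 <= d)%N := ltnW d3; have d1 : (1 <= d)%N := ltnW d2.
have := flattening_rank d1 Zf; rewrite leq_eqVlt => /predU1P[r3|r2].
  have [u uu [G S _]] := concise_cover d3 Zf r3.
  exact: (concise_smooth d3 uu Zf G S).
have [u uu Hu] := adapted_basis d1 f; have Hf := adapted_binary r2 Hu.
move: d3; rewrite leq_eqVlt => /predU1P[d3|d4].
  by case: nf; apply: (binary_cubic_sigma2 d2 uu (esym d3) f0 Hf).
have [t Ht] := binary_hankel d2 uu d4 Hf Zf nf.
have uu' := transvect_unit t uu.
move: (d4); rewrite leq_eqVlt => /predU1P[d4'|d5]; last exact: (hankel_smooth d1 uu' d5 Zf Ht).
subst d; case: p f Zf nf exc f0 r2 u uu Hu Hf t Ht uu' => [|p] f Zf nf exc f0 r2 u uu Hu Hf t Ht uu'.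
  exact: (quartic_smooth uu' Zf Ht).
case: exc; split=> //; apply/eqP; rewrite eqn_leq -ltnS r2 ltnNge; apply/negP => r1.
by case: nf; apply: rank1_secant2.
Qed.

Lemma degenerate_singular p (f : Defs.form F p.+3 4) : degenerate F p.+3 4 f ->
  ~ smooth_at (pcone (@powsum F p.+3 4 3)) f.
Proof.
move=> []; rewrite !secant_powsum // => Zf nf /(subspace_dim_unique (essential_dim (isT : 0 < 4)%N f)) r2.
have [u uu Hu] := adapted_basis (isT : 0 < 4)%N f.
have Hf := adapted_binary (eq_leq r2) Hu.
have [t Ht] := binary_hankel (isT : 2 <= 4)%N uu isT Hf Zf nf.
exact: (quartic_degenerate_singular (transvect_unit t uu) (binary_transvect t Hf) nf Ht).
Qed.

Lemma Sing_secant3 d n : (3 <= d)%N -> (2 <= n)%N -> ~ (d = 4%N /\ (3 <= n)%N) ->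
  Sing (secant 3 (veronese F n d)) = secant 2 (veronese F n d).
Proof.
case: n => [|[|p]] // d3 _ exc; have d1 : (0 < d)%N by apply: leq_trans d3.
rewrite !secant_powsum //; apply/seteqP; split=> f.
  move=> [Zf ns]; apply: contrapT => nf; apply: ns; apply: smooth_off_secant2 => // -[d4 p1 _].
  by apply: exc; split.
by move=> f2; split; [apply: pcone_powsumS | apply: secant2_singular].
Qed.

Lemma Sing_secant3_quartic n : (3 <= n)%N ->
  Sing (secant 3 (veronese F n 4)) = degenerate F n 4 `|` secant 2 (veronese F n 4).
Proof.
case: n => [|[|[|p]]] // _; apply/seteqP; split=> f.
  move=> [Zf ns]; have [f2|nf] := pselect (secant 2 (veronese F p.+3 4) f); [by right|left].
  have r2 : \rank (flattening f) = 2%N.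
    apply: contrapT => r2; apply: ns; rewrite !secant_powsum // in Zf nf *.
    by apply: smooth_off_secant2 => // -[].
  by split; [exact: Zf | exact: nf | have := essential_dim (isT : 0 < 4)%N f; rewrite r2].
move=> [fD|f2]; split.
- by case: fD.
- by rewrite secant_powsum //; apply: degenerate_singular.
- by rewrite !secant_powsum // in f2 *; apply: pcone_powsumS.
- by rewrite !secant_powsum // in f2 *; apply: secant2_singular.
Qed.

End Main.

Close Scope ring_scope.
Theorem theorem2p1 (R : realType) :
  (forall d n : nat, 3 <= d -> 2 <= n -> ~ (d = 4 /\ 3 <= n) ->
     Sing (secant 3 (veronese (complex R) n d)) =
     secant 2 (veronese (complex R) n d))
  /\
  (forall n : nat, 3 <= n ->
     Sing (secant 3 (veronese (complex R) n 4)) =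
     degenerate (complex R) n 4 `|` secant 2 (veronese (complex R) n 4)).
Proof.
split=> [d n|n]; first exact: (@Sing_secant3 (complex R : numClosedFieldType) d n).
exact: (@Sing_secant3_quartic (complex R : numClosedFieldType) n).
Qed.
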